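(* Let $0<d<\pi/2$, $\mathscr{D}_d=\{\zeta\in\mathbb{C}:|\Im\zeta|<d\}$, $\mathscr{D}_d^{-}=\{\zeta\in\mathscr{D}_d:\Re\zeta<0\}$, $\mathscr{D}_d^{+}=\{\zeta\in\mathscr{D}_d:\Re\zeta\ge0\}$, and $\psi(t)=\sinh[(\pi/2)\sinh t]$. Assume $f$ is analytic on $\psi(\mathscr{D}_d)$ and there are constants $K,\alpha,\beta>0$ such that $|f(z)|\le K|1+z^2|^{-(\alpha+1)/2}$ for all $z\in\psi(\mathscr{D}_d^{-})$ and $|f(z)|\le K|1+z^2|^{-(\beta+1)/2}$ for all $z\in\psi(\mathscr{D}_d^{+})$. Let $\mu=\min\{\alpha,\beta\}$, $\nu=\max\{\alpha,\beta\}$, let $n$ be a positive integer, $h=\log(8dn/\mu)/n$, and let $M=n$, $N=n-\lfloor\log(\beta/\alpha)/h\rfloor$ if $\mu=\alpha$, and $N=n$, $M=n-\lfloor\log(\alpha/\beta)/h\rfloor$ if $\mu=\beta$. Suppose $n\ge \nu e/(8d)$, $Mh\ge x_{\alpha/2}$ and $Nh\ge x_{\beta/2}$. Then \[ \left|\int_{-\infty}^{\infty}f(t)\,dt-h\sum_{k=-M}^{N}f(\psi(kh))\psi'(kh)\right|\le C_1e^{-2\pi dn/\log(8dn/\mu)}, \] with $C_1=\frac{2^{\nu+1}K}{\mu}\left\{\frac{2}{(1-e^{-\pi\mu e/4})\{\cos(\frac{\pi}{2}\sin d)\}^{\nu}\cos d}+e^{\pi\nu/4}\right\}$.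
   Context: For $\gamma>0$, $x_\gamma=\operatorname{arcsinh}\!\left(\frac{\sqrt{1+\sqrt{1-(2\pi\gamma)^2}}}{2\pi\gamma}\right)$ if $0<\gamma<1/(2\pi)$, and $x_\gamma=\operatorname{arcsinh}(1)$ if $\gamma\ge 1/(2\pi)$. $\psi(\cdot)$ of a set denotes its image. *)

(* Defs.v *)
From Stdlib Require Import Reals ZArith List.
From Coquelicot Require Import Coquelicot.
Open Scope R_scope.

Definition Cexp (z : C) : C :=
  (exp (Re z) * cos (Im z), exp (Re z) * sin (Im z)).
Definition Csinh (z : C) : C := ((Cexp z - Cexp (- z)) / 2)%C.

Definition psi (z : C) : C := Csinh (RtoC (PI / 2) * Csinh z)%C.
Definition psiR (t : R) : R := sinh ((PI / 2) * sinh t).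

Definition strip (d : R) (z : C) : Prop := Rabs (Im z) < d.
Definition strip_minus (d : R) (z : C) : Prop := strip d z /\ Re z < 0.
Definition strip_plus (d : R) (z : C) : Prop := strip d z /\ 0 <= Re z.

Definition psi_image (A : C -> Prop) (z : C) : Prop := exists w, A w /\ z = psi w.

Definition analytic_on (A : C -> Prop) (f : C -> C) : Prop :=
  forall z : C, A z -> ex_derive (K := C_AbsRing) (V := C_NormedModule) f z.

Definition x_gamma (g : R) : R :=
  if Rlt_dec g (/ (2 * PI)) then
    arcsinh (sqrt (1 + sqrt (1 - (2 * PI * g) ^ 2)) / (2 * PI * g))
  else arcsinh 1.

Definition floorZ (x : R) : Z := Int_part x.

(* sum_{k=a}^{b} g k over integers (empty if b < a) *)
Definition zsum (a b : Z) (g : Z -> C) : C :=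
  fold_right Cplus (RtoC 0)
    (map (fun i : nat => g (a + Z.of_nat i)%Z) (seq 0 (Z.to_nat (b - a + 1)))).

(* Main.v *)
Require Import Defs.
From Stdlib Require Import Reals ZArith List.
From Stdlib Require Import Lra Lia Psatz Classical ClassicalEpsilon.
From Coquelicot Require Import Coquelicot.
Open Scope R_scope.

(* Put F(w) = f(psi(w)) psi'(w), so that the integral of f is that of F over the real line.  The
   kernel 1 / (1 - exp (2 pi i w / h)) has residue -h / (2 pi i) at each node kh, is exponentially
   close to 1 high in the upper half plane and to 0 low in the lower one; integrating F times it
   around long rectangles in the strip therefore bounds the error of the infinite trapezoidal sum by
   q / (1 - q), q = exp (-2 pi d / h), times the integrals of |F| along the two edges.  Those
   integrals are controlled by
   |cosh (pi/2 sinh (x+iy))| >= cosh (pi/2 sinh x cos y) cos (pi/2 sin y).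
   The truncation error is compared with the integral of p cosh x exp (-p sinh x), p = pi c / 2
   with c = alpha or beta.  This density need not be decreasing beyond x_{c/2}; the excess of the
   sum over the integral is absorbed by the gap between exp (-2 pi d n) and
   exp (-2 pi d n / log (8 d n / mu)). *)

(** * Complex differentiability *)

(** With p = pi c / 2 < 1/2 and s = sinh x, the critical points of the density solve p (1 + s^2) =
    s; the last one is s = (1 + r) / (2 p), r = sqrt (1 - 4 p^2), whereas sinh x_{c/2} is only sqrt
    (1 + r) / (2 p). In between the density rises, and a sum of right-end values can exceed the
    integral. The step satisfies e^{n h} = 8 d n / mu; a tail starting at e^X >= 8 d n / c has size
    about exp (- p e^X / 2) <= exp (- 2 pi d n), far below the target, and this surplus is spent by
    dividing the exponent by X. Since 1 + psi^2 is the square of cosh (pi/2 sinh w), which is also a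
    factor of psi', the bound on f becomes |F| <= K (pi/2) |cosh w| |cosh (pi/2 sinh w)|^{-c}. Hence
    a lower bound for that cosh is the central estimate in the strip. The residue of the kernel is
    obtained from its period: over one cell the vertical sides cancel and the horizontal ones can be
    moved to infinity. The hypotheses hold in the open strip only, so contours stay at height D < d
    and D is brought close to d afterwards. *)

Definition Cderiv (g : C -> C) (z l : C) : Prop :=
  is_derive (K := C_AbsRing) (V := AbsRing_NormedModule C_AbsRing) g z l.
Definition Ccont (g : C -> C) (z : C) : Prop :=
  continuous (T := AbsRing_UniformSpace C_AbsRing) (U := AbsRing_UniformSpace C_AbsRing) g z.

Lemma Ccont_eps (g : C -> C) (z : C) :
  Ccont g z <->
  forall eps, 0 < eps -> exists del, 0 < del /\
    forall w, Cmod (w - z) < del -> Cmod (g w - g z) < eps.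
Proof.
  split.
  - intros H eps He.
    destruct (proj1 (filterlim_locally (U := AbsRing_UniformSpace C_AbsRing) g (g z)) H (mkposreal eps He)) as [del Hd].
    exists del; split; [apply cond_pos|]. intros w Hw. exact (Hd w Hw).
  - intros H. unfold Ccont, continuous.
    apply (proj2 (filterlim_locally (U := AbsRing_UniformSpace C_AbsRing) g (g z))).
    intros eps. destruct (H eps (cond_pos eps)) as (del & Hd & Hw).
    exists (mkposreal del Hd). intros w Hb. exact (Hw w Hb).
Qed.

Lemma Cderiv_eps (g : C -> C) (z l : C) :
  Cderiv g z l <->
  forall eps, 0 < eps -> exists del, 0 < del /\
    forall w, Cmod (w - z) < del -> Cmod (g w - g z - (w - z) * l) <= eps * Cmod (w - z).
Proof.
  split.
  - intros [_ H] eps He.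
    destruct (H z (fun P h => h) (mkposreal eps He)) as [del Hd].
    exists del; split; [apply cond_pos|]. intros w Hw. exact (Hd w Hw).
  - intros H. split; [apply is_linear_scal_l|].
    intros x Hx.
    apply (is_filter_lim_locally_unique (K := C_AbsRing) (V := AbsRing_NormedModule C_AbsRing)) in Hx. subst x.
    intros eps. destruct (H eps (cond_pos eps)) as (del & Hd & Hw).
    exists (mkposreal del Hd). intros w Hb. exact (Hw w Hb).
Qed.

(** The hypothesis on [f] uses [C_NormedModule], while [Cderiv] takes C as a module over itself, as
    the product rule requires. The two norms are convertible, so the epsilon form passes from one to
    the other. *)
Lemma ex_derive_Cderiv (g : C -> C) (z : C) :
  ex_derive (K := C_AbsRing) (V := C_NormedModule) g z -> exists l, Cderiv g z l.
Proof.
  intros [l [_ H]]. exists l. apply Cderiv_eps. intros eps He.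
  destruct (H z (fun P h => h) (mkposreal eps He)) as [del Hd].
  exists del; split; [apply cond_pos|]. intros w Hw.
  generalize (Hd w Hw). exact (fun h => h).
Qed.

Lemma Cderiv_cont (g : C -> C) (z l : C) : Cderiv g z l -> Ccont g z.
Proof.
  intros H. apply (ex_derive_continuous (K := C_AbsRing) (V := AbsRing_NormedModule C_AbsRing)).
  exists l. exact H.
Qed.

Lemma Cderiv_const (c z : C) : Cderiv (fun _ => c) z 0.
Proof. exact (is_derive_const (K := C_AbsRing) (V := AbsRing_NormedModule C_AbsRing) c z). Qed.

Lemma Cderiv_id (z : C) : Cderiv (fun w => w) z 1.
Proof. exact (is_derive_id (K := C_AbsRing) z). Qed.

Lemma Cderiv_plus (f g : C -> C) (z a b : C) :
  Cderiv f z a -> Cderiv g z b -> Cderiv (fun w => f w + g w)%C z (a + b)%C.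
Proof. exact (is_derive_plus (K := C_AbsRing) (V := AbsRing_NormedModule C_AbsRing) f g z a b). Qed.

Lemma Cderiv_minus (f g : C -> C) (z a b : C) :
  Cderiv f z a -> Cderiv g z b -> Cderiv (fun w => f w - g w)%C z (a - b)%C.
Proof. exact (is_derive_minus (K := C_AbsRing) (V := AbsRing_NormedModule C_AbsRing) f g z a b). Qed.

Lemma Cderiv_mult (f g : C -> C) (z a b : C) :
  Cderiv f z a -> Cderiv g z b -> Cderiv (fun w => f w * g w)%C z (a * g z + f z * b)%C.
Proof.
  intros Hf Hg. exact (is_derive_mult (K := C_AbsRing) f g z a b Hf Hg Cmult_comm).
Qed.

Lemma Cderiv_comp (f g : C -> C) (z a b : C) :
  Cderiv f (g z) a -> Cderiv g z b -> Cderiv (fun w => f (g w)) z (b * a)%C.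
Proof. exact (is_derive_comp (K := C_AbsRing) (V := AbsRing_NormedModule C_AbsRing) f g z a b). Qed.

Lemma Cderiv_ext (f g : C -> C) (z a b : C) :
  (forall w, f w = g w) -> a = b -> Cderiv f z a -> Cderiv g z b.
Proof.
  intros E <- H. exact (is_derive_ext (K := C_AbsRing) (V := AbsRing_NormedModule C_AbsRing) f g z a E H).
Qed.

Lemma Cderiv_scal (c : C) (f : C -> C) (z a : C) :
  Cderiv f z a -> Cderiv (fun w => c * f w)%C z (c * a)%C.
Proof.
  intros H. refine (Cderiv_ext _ _ z _ _ (fun w => eq_refl) _ (Cderiv_mult _ _ z _ _ (Cderiv_const c z) H)).
  ring.
Qed.

Lemma Cderiv_inv (z : C) : z <> 0 -> Cderiv (fun w => / w)%C z (- / (z * z))%C.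
Proof.
  intros Hz. apply Cderiv_eps. intros eps He.
  pose proof (Cmod_gt_0 z) as [Hm _]. specialize (Hm Hz).
  set (m := Cmod z) in *.
  (* The error is (w - z)^2 / (w z^2); the radius [m / 2] keeps |w| >= m / 2, and the second radius
     then makes the factor beside |w - z| at most [eps]. *)
  exists (Rmin (m / 2) (eps * (m * m * m) / 2)). split.
  { apply Rmin_glb_lt; [lra|]. apply Rdiv_lt_0_compat; [|lra]. repeat apply Rmult_lt_0_compat; lra. }
  intros w Hw.
  assert (H1 : Cmod (w - z) < m / 2) by (eapply Rlt_le_trans; [exact Hw|apply Rmin_l]).
  assert (H2 : Cmod (w - z) < eps * (m * m * m) / 2) by (eapply Rlt_le_trans; [exact Hw|apply Rmin_r]).
  assert (H3 : m / 2 <= Cmod w).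
  { pose proof (Cmod_triangle w (z - w)) as H. replace (w + (z - w))%C with z in H by ring.
    replace (z - w)%C with (- (w - z))%C in H by ring. rewrite Cmod_opp in H. fold m in H. lra. }
  assert (Hw0 : w <> 0) by (intros E; subst w; rewrite Cmod_0 in H3; lra).
  replace (/ w - / z - (w - z) * - / (z * z))%C with ((w - z) * ((w - z) / (w * (z * z))))%C
    by (field; auto).
  rewrite Cmod_mult, Rmult_comm. apply Rmult_le_compat_r; [apply Cmod_ge_0|].
  rewrite Cmod_div, !Cmod_mult by (repeat apply Cmult_neq_0; auto). fold m.
  assert (Hp : 0 < Cmod w * (m * m)) by (repeat apply Rmult_lt_0_compat; lra).
  apply Rmult_le_reg_r with (1 := Hp).
  unfold Rdiv. rewrite Rmult_assoc, Rinv_l, Rmult_1_r by lra.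
  assert (m / 2 * (m * m) * eps <= Cmod w * (m * m) * eps).
  { apply Rmult_le_compat_r; [lra|]. apply Rmult_le_compat_r; [nra|lra]. }
  lra.
Qed.

Lemma Ccont_plus (f g : C -> C) (z : C) : Ccont f z -> Ccont g z -> Ccont (fun w => f w + g w)%C z.
Proof. exact (continuous_plus (U := AbsRing_UniformSpace C_AbsRing) (K := C_AbsRing) (V := AbsRing_NormedModule C_AbsRing) f g z). Qed.

Lemma Ccont_mult (f g : C -> C) (z : C) : Ccont f z -> Ccont g z -> Ccont (fun w => f w * g w)%C z.
Proof. exact (continuous_mult (U := AbsRing_UniformSpace C_AbsRing) (K := C_AbsRing) f g z). Qed.

(** * The complex exponential and its derivative *)

Lemma Cexp_add (z w : C) : Cexp (z + w) = (Cexp z * Cexp w)%C.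
Proof.
  unfold Cexp, Cmult, Re, Im. destruct z as [a b], w as [c e]. simpl.
  rewrite exp_plus, cos_plus, sin_plus. f_equal; ring.
Qed.

Lemma Cmod_Cexp (z : C) : Cmod (Cexp z) = exp (Re z).
Proof.
  unfold Cmod, Cexp. cbn [fst snd].
  replace ((exp (Re z) * cos (Im z)) ^ 2 + (exp (Re z) * sin (Im z)) ^ 2) with (exp (Re z) ^ 2 * ((cos (Im z))^2 + (sin (Im z))^2)) by ring.
  replace ((cos (Im z))^2 + (sin (Im z))^2) with 1 by (pose proof (sin2_cos2 (Im z)); unfold Rsqr in *; simpl; lra).
  rewrite Rmult_1_r. apply sqrt_pow2. left. apply exp_pos.
Qed.

Lemma Cexp_0 : Cexp 0 = 1.
Proof. unfold Cexp, Re, Im, RtoC. cbn [fst snd]. rewrite exp_0, cos_0, sin_0. f_equal; ring. Qed.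

Lemma Cmod_le_abs (z : C) : Cmod z <= Rabs (Re z) + Rabs (Im z).
Proof.
  unfold Cmod. destruct z as [a b]. unfold Re, Im. cbn [fst snd].
  pose proof (Rabs_pos a). pose proof (Rabs_pos b).
  apply Rsqr_incr_0_var; [|lra].
  rewrite Rsqr_sqrt by nra. unfold Rsqr.
  replace (a ^ 2) with (Rabs a * Rabs a) by (rewrite <- Rabs_mult, Rabs_right; [ring|nra]).
  replace (b ^ 2) with (Rabs b * Rabs b) by (rewrite <- Rabs_mult, Rabs_right; [ring|nra]).
  nra.
Qed.

Lemma Re_le_Cmod (z : C) : Rabs (Re z) <= Cmod z.
Proof. pose proof (Rmax_Cmod z). pose proof (Rmax_l (Rabs (fst z)) (Rabs (snd z))). unfold Re. lra. Qed.

Lemma Im_le_Cmod (z : C) : Rabs (Im z) <= Cmod z.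
Proof. pose proof (Rmax_Cmod z). pose proof (Rmax_r (Rabs (fst z)) (Rabs (snd z))). unfold Im. lra. Qed.

Lemma real_lin_approx (g : R -> R) (l : R) :
  is_derive g 0 l -> forall eps, 0 < eps -> exists del, 0 < del /\
    forall t, Rabs t < del -> Rabs (g t - g 0 - t * l) <= eps * Rabs t.
Proof.
  intros [_ H] eps He.
  destruct (H 0 (fun P h => h) (mkposreal eps He)) as [del Hd].
  exists del; split; [apply cond_pos|]. intros t Ht.
  assert (E : ball (0 : R_UniformSpace) del t).
  { change (Rabs (t - 0) < del). rewrite Rminus_0_r. exact Ht. }
  specialize (Hd t E). change (Rabs (g t - g 0 - (t - 0) * l) <= eps * Rabs (t - 0)) in Hd.
  rewrite Rminus_0_r in Hd. exact Hd.
Qed.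

(** The real expansions of exp, cos and sin at 0 are multiplied out; the law [Cexp_add] then carries
    the derivative from 0 to any point. *)
Lemma Cderiv_Cexp_0 : Cderiv Cexp 0 1.
Proof.
  apply Cderiv_eps. intros eps He.
  assert (Hex : is_derive exp 0 1) by (pose proof (is_derive_exp 0) as H; rewrite exp_0 in H; exact H).
  assert (Hco : is_derive cos 0 0) by (pose proof (is_derive_cos 0) as H; rewrite sin_0, Ropp_0 in H; exact H).
  assert (Hsi : is_derive sin 0 1) by (pose proof (is_derive_sin 0) as H; rewrite cos_0 in H; exact H).
  (* Multiplying out leaves nine error terms, four in the real and five in the imaginary part, each
     at most [e * m]; [e <= 1] is used for the products of two errors. *)
  set (e := Rmin 1 (eps / 9)).
  assert (He0 : 0 < e) by (apply Rmin_glb_lt; lra).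
  assert (He1 : e <= 1) by apply Rmin_l.
  assert (He2 : e <= eps / 9) by apply Rmin_r.
  destruct (real_lin_approx _ _ Hex e He0) as (d1 & Hd1 & H1).
  destruct (real_lin_approx _ _ Hco e He0) as (d2 & Hd2 & H2).
  destruct (real_lin_approx _ _ Hsi e He0) as (d3 & Hd3 & H3).
  exists (Rmin (Rmin d1 d2) (Rmin d3 e)). split.
  { apply Rmin_glb_lt; (apply Rmin_glb_lt; assumption). }
  intros w Hw. clearbody e.
  replace (w - 0)%C with w in * by ring. rewrite Cexp_0.
  assert (Hw1 : Cmod w < d1 /\ Cmod w < d2 /\ Cmod w < d3 /\ Cmod w < e).
  { pose proof (Rmin_l (Rmin d1 d2) (Rmin d3 e)). pose proof (Rmin_r (Rmin d1 d2) (Rmin d3 e)).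
    pose proof (Rmin_l d1 d2). pose proof (Rmin_r d1 d2). pose proof (Rmin_l d3 e). pose proof (Rmin_r d3 e). lra. }
  pose proof (Re_le_Cmod w) as Hx. pose proof (Im_le_Cmod w) as Hy.
  specialize (H1 (Re w) ltac:(lra)). specialize (H2 (Im w) ltac:(lra)). specialize (H3 (Im w) ltac:(lra)).
  rewrite exp_0, Rmult_1_r in H1. rewrite cos_0, Rmult_0_r in H2. rewrite sin_0, Rmult_1_r in H3.
  eapply Rle_trans; [apply Cmod_le_abs|].
  unfold Cexp. destruct w as [x y]. unfold Re, Im, Cminus, Cplus, Cmult, Copp, RtoC in *. cbn [fst snd] in *.
  set (m := Cmod (x, y)) in *.
  pose proof (Rabs_pos x). pose proof (Rabs_pos y).
  set (E := exp x - 1 - x) in *. set (G := cos y - 1 - 0) in *. set (S := sin y - 0 - y) in *.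
  replace (exp x) with (1 + x + E) by (unfold E; ring).
  replace (cos y) with (1 + G) by (unfold G; ring).
  replace (sin y) with (y + S) by (unfold S; ring).
  replace ((1 + x + E) * (1 + G) + - (1) + - (x * 1 - y * 0)) with (E + G + (x * G + E * G)) by ring.
  replace ((1 + x + E) * (y + S) + - 0 + - (x * 0 + y * 1)) with (S + (x * y + E * y + x * S + E * S)) by ring.
  assert (HB : forall t, t <= m -> e * t <= e * m) by (intros; apply Rmult_le_compat_l; lra).
  assert (A1 : Rabs E <= e * m) by (eapply Rle_trans; [exact H1|apply HB; lra]).
  assert (A2 : Rabs G <= e * m) by (eapply Rle_trans; [exact H2|apply HB; lra]).
  assert (A3 : Rabs S <= e * m) by (eapply Rle_trans; [exact H3|apply HB; lra]).
  assert (A4 : Rabs (E + G + (x * G + E * G)) <= Rabs E + Rabs G + (Rabs x * Rabs G + Rabs E * Rabs G)).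
  { rewrite <- !Rabs_mult. eapply Rle_trans; [apply Rabs_triang|]. apply Rplus_le_compat; apply Rabs_triang. }
  assert (A5 : Rabs (S + (x * y + E * y + x * S + E * S)) <= Rabs S + (Rabs x * Rabs y + Rabs E * Rabs y + Rabs x * Rabs S + Rabs E * Rabs S)).
  { rewrite <- !Rabs_mult. eapply Rle_trans; [apply Rabs_triang|]. apply Rplus_le_compat_l.
    eapply Rle_trans; [apply Rabs_triang|]. apply Rplus_le_compat_r.
    eapply Rle_trans; [apply Rabs_triang|]. apply Rplus_le_compat_r. apply Rabs_triang. }
  pose proof (Rabs_pos E). pose proof (Rabs_pos G). pose proof (Rabs_pos S).
  assert (Hm0 : 0 <= m) by apply Cmod_ge_0.
  assert (B : forall a b u v, 0 <= a -> 0 <= b -> a <= u -> b <= v -> a * b <= u * v) by (intros; apply Rmult_le_compat; assumption).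
  assert (Hmm : m * m <= e * m) by (apply Rmult_le_compat_r; lra).
  assert (Hem : e * m <= m) by (rewrite <- (Rmult_1_l m) at 2; apply Rmult_le_compat_r; lra).
  pose proof (B (Rabs x) (Rabs G) m (e * m) ltac:(lra) ltac:(lra) ltac:(lra) ltac:(lra)).
  pose proof (B (Rabs E) (Rabs G) m (e * m) ltac:(lra) ltac:(lra) ltac:(lra) ltac:(lra)).
  pose proof (B (Rabs x) (Rabs y) m m ltac:(lra) ltac:(lra) ltac:(lra) ltac:(lra)).
  pose proof (B (Rabs E) (Rabs y) m m ltac:(lra) ltac:(lra) ltac:(lra) ltac:(lra)).
  pose proof (B (Rabs x) (Rabs S) m (e * m) ltac:(lra) ltac:(lra) ltac:(lra) ltac:(lra)).
  pose proof (B (Rabs E) (Rabs S) m (e * m) ltac:(lra) ltac:(lra) ltac:(lra) ltac:(lra)).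
  assert (m * (e * m) <= e * m) by (apply Rle_trans with (m * m); [apply Rmult_le_compat_l; lra|exact Hmm]).
  assert (9 * (e * m) <= eps * m) by (rewrite <- Rmult_assoc; apply Rmult_le_compat_r; lra).
  lra.
Qed.

Lemma Cderiv_Cexp (z : C) : Cderiv Cexp z (Cexp z).
Proof.
  assert (H0 : Cderiv (fun w => w - z)%C z 1).
  { refine (Cderiv_ext _ _ z _ _ (fun w => eq_refl) _ (Cderiv_minus _ _ z _ _ (Cderiv_id z) (Cderiv_const z z))). ring. }
  assert (H1 : Cderiv Cexp (z - z)%C 1) by (replace (z - z)%C with (RtoC 0) by ring; exact Cderiv_Cexp_0).
  refine (Cderiv_ext _ _ z _ _ _ _ (Cderiv_scal (Cexp z) _ z _ (Cderiv_comp Cexp (fun w => w - z)%C z _ _ H1 H0))).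
  - intros w. rewrite <- Cexp_add. f_equal. ring.
  - ring.
Qed.

(** * Cauchy's theorem on rectangles *)

(* [Vint] is taken with respect to the real parameter, without the factor [Ci]; [oint] is the
   counterclockwise integral along the boundary of [x1, x2] x [y1, y2]. *)
Definition Hint (g : C -> C) (y a b : R) : C :=
  RInt (V := C_R_CompleteNormedModule) (fun t => g (t, y)) a b.
Definition Vint (g : C -> C) (x a b : R) : C :=
  RInt (V := C_R_CompleteNormedModule) (fun t => g (x, t)) a b.
Definition oint (g : C -> C) (x1 x2 y1 y2 : R) : C :=
  (Hint g y1 x1 x2 + Ci * Vint g x2 y1 y2 - Hint g y2 x1 x2 - Ci * Vint g x1 y1 y2)%C.

(** Integrals run over a real parameter with values in C as a real normed module, whose norm is the
    product norm; this carries the norm estimates for integrals over to [Cmod]. *)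
Lemma Cmod_norm_R (z : C) : norm (K := R_AbsRing) (V := C_R_NormedModule) z = Cmod z.
Proof.
  unfold norm, Cmod. cbn. unfold prod_norm. f_equal.
  unfold norm; cbn. unfold abs; cbn.
  rewrite !Rmult_1_r. rewrite <- !Rabs_mult. rewrite !Rabs_right; nra.
Qed.

Lemma C_R_continuous (g : R -> C) (t : R) :
  (forall eps, 0 < eps -> exists del, 0 < del /\
    forall s, Rabs (s - t) < del -> Cmod (g s - g t) < eps) ->
  continuous (T := R_UniformSpace) (U := C_R_CompleteNormedModule) g t.
Proof.
  intros H. unfold continuous. apply (proj2 (filterlim_locally (U := C_R_CompleteNormedModule) g (g t))).
  intros eps. destruct (H eps (cond_pos eps)) as (del & Hd & Hs).
  exists (mkposreal del Hd). intros s Hb. specialize (Hs s Hb).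
  exact (C_NormedModule_mixin_compat1 (g t) (g s) eps Hs).
Qed.

Lemma Cmod_Hdist (a b y : R) : Cmod ((a, y) - (b, y))%C = Rabs (a - b).
Proof.
  replace ((a, y) - (b, y))%C with (RtoC (a - b)) by (unfold Cminus, Cplus, Copp, RtoC; cbn; f_equal; ring).
  apply Cmod_R.
Qed.

Lemma Cmod_Vdist (a b x : R) : Cmod ((x, a) - (x, b))%C = Rabs (a - b).
Proof.
  replace ((x, a) - (x, b))%C with (Ci * RtoC (a - b))%C by (unfold Cminus, Cplus, Copp, Cmult, Ci, RtoC; cbn; f_equal; ring).
  rewrite Cmod_mult, Cmod_R. replace (Cmod Ci) with 1; [ring|].
  unfold Cmod, Ci. cbn [fst snd]. replace (0 ^ 2 + 1 ^ 2) with 1 by ring. symmetry. apply sqrt_1.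
Qed.

Lemma Ccont_H (g : C -> C) (x y : R) : Ccont g (x, y) ->
  continuous (T := R_UniformSpace) (U := C_R_CompleteNormedModule) (fun t => g (t, y)) x.
Proof.
  intros H. apply C_R_continuous. intros eps He.
  destruct (proj1 (Ccont_eps g (x, y)) H eps He) as (del & Hd & Hw).
  exists del; split; [exact Hd|]. intros s Hs. apply Hw. rewrite Cmod_Hdist. exact Hs.
Qed.

Lemma Ccont_V (g : C -> C) (x y : R) : Ccont g (x, y) ->
  continuous (T := R_UniformSpace) (U := C_R_CompleteNormedModule) (fun t => g (x, t)) y.
Proof.
  intros H. apply C_R_continuous. intros eps He.
  destruct (proj1 (Ccont_eps g (x, y)) H eps He) as (del & Hd & Hw).
  exists del; split; [exact Hd|]. intros s Hs. apply Hw. rewrite Cmod_Vdist. exact Hs.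
Qed.

Lemma ex_RInt_H (g : C -> C) (y a b : R) : a <= b ->
  (forall x, a <= x <= b -> Ccont g (x, y)) ->
  ex_RInt (V := C_R_CompleteNormedModule) (fun t => g (t, y)) a b.
Proof.
  intros Hab H. apply (ex_RInt_continuous (V := C_R_CompleteNormedModule)).
  rewrite Rmin_left, Rmax_right by exact Hab. intros x Hx. apply Ccont_H, H, Hx.
Qed.

Lemma ex_RInt_V (g : C -> C) (x a b : R) : a <= b ->
  (forall y, a <= y <= b -> Ccont g (x, y)) ->
  ex_RInt (V := C_R_CompleteNormedModule) (fun t => g (x, t)) a b.
Proof.
  intros Hab H. apply (ex_RInt_continuous (V := C_R_CompleteNormedModule)).
  rewrite Rmin_left, Rmax_right by exact Hab. intros y Hy. apply Ccont_V, H, Hy.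
Qed.

(** A complex factor is not a scalar of the real module, so the integral is split into its two
    coordinates and recombined. *)
Lemma is_RInt_Cmult (c : C) (g : R -> C) (a b : R) (l : C) :
  is_RInt (V := C_R_NormedModule) g a b l ->
  is_RInt (V := C_R_NormedModule) (fun t => c * g t)%C a b (c * l)%C.
Proof.
  intros H.
  pose proof (is_RInt_fct_extend_fst (U := R_NormedModule) (V := R_NormedModule) g a b l H) as H1.
  pose proof (is_RInt_fct_extend_snd (U := R_NormedModule) (V := R_NormedModule) g a b l H) as H2.
  apply (is_RInt_fct_extend_pair (U := R_NormedModule) (V := R_NormedModule)).
  - exact (is_RInt_minus (V := R_NormedModule) _ _ _ _ _ _ (is_RInt_scal _ _ _ (fst c) _ H1) (is_RInt_scal _ _ _ (snd c) _ H2)).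
  - exact (is_RInt_plus (V := R_NormedModule) _ _ _ _ _ _ (is_RInt_scal _ _ _ (fst c) _ H2) (is_RInt_scal _ _ _ (snd c) _ H1)).
Qed.

Lemma Hint_Chasles (g : C -> C) (y a b c : R) : a <= b -> b <= c ->
  (forall x, a <= x <= c -> Ccont g (x, y)) ->
  Hint g y a c = (Hint g y a b + Hint g y b c)%C.
Proof.
  intros Hab Hbc H. symmetry.
  refine (RInt_Chasles (V := C_R_CompleteNormedModule) (fun t => g (t, y)) a b c _ _);
    apply ex_RInt_H; try assumption; intros; apply H; lra.
Qed.

Lemma Vint_Chasles (g : C -> C) (x a b c : R) : a <= b -> b <= c ->
  (forall y, a <= y <= c -> Ccont g (x, y)) ->
  Vint g x a c = (Vint g x a b + Vint g x b c)%C.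
Proof.
  intros Hab Hbc H. symmetry.
  refine (RInt_Chasles (V := C_R_CompleteNormedModule) (fun t => g (x, t)) a b c _ _);
    apply ex_RInt_V; try assumption; intros; apply H; lra.
Qed.

Lemma oint_split_x (g : C -> C) (x1 m x2 y1 y2 : R) : x1 <= m -> m <= x2 ->
  (forall x, x1 <= x <= x2 -> Ccont g (x, y1)) ->
  (forall x, x1 <= x <= x2 -> Ccont g (x, y2)) ->
  oint g x1 x2 y1 y2 = (oint g x1 m y1 y2 + oint g m x2 y1 y2)%C.
Proof.
  intros H1 H2 C1 C2. unfold oint.
  rewrite (Hint_Chasles g y1 x1 m x2 H1 H2 C1), (Hint_Chasles g y2 x1 m x2 H1 H2 C2). ring.
Qed.

Lemma oint_split_y (g : C -> C) (x1 x2 y1 m y2 : R) : y1 <= m -> m <= y2 ->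
  (forall y, y1 <= y <= y2 -> Ccont g (x1, y)) ->
  (forall y, y1 <= y <= y2 -> Ccont g (x2, y)) ->
  oint g x1 x2 y1 y2 = (oint g x1 x2 y1 m + oint g x1 x2 m y2)%C.
Proof.
  intros H1 H2 C1 C2. unfold oint.
  rewrite (Vint_Chasles g x1 y1 m y2 H1 H2 C1), (Vint_Chasles g x2 y1 m y2 H1 H2 C2). ring.
Qed.

Lemma Cmod_Hint_le (g : C -> C) (y a b M : R) : a <= b ->
  (forall x, a <= x <= b -> Ccont g (x, y)) ->
  (forall x, a <= x <= b -> Cmod (g (x, y)) <= M) ->
  Cmod (Hint g y a b) <= (b - a) * M.
Proof.
  intros Hab Hc HM. rewrite <- Cmod_norm_R.
  apply (norm_RInt_le_const (V := C_R_NormedModule) (fun t => g (t, y)) a b _ M Hab).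
  - intros x Hx. rewrite Cmod_norm_R. exact (HM x Hx).
  - apply (RInt_correct (V := C_R_CompleteNormedModule)), ex_RInt_H; assumption.
Qed.

Lemma Cmod_Vint_le (g : C -> C) (x a b M : R) : a <= b ->
  (forall y, a <= y <= b -> Ccont g (x, y)) ->
  (forall y, a <= y <= b -> Cmod (g (x, y)) <= M) ->
  Cmod (Vint g x a b) <= (b - a) * M.
Proof.
  intros Hab Hc HM. rewrite <- Cmod_norm_R.
  apply (norm_RInt_le_const (V := C_R_NormedModule) (fun t => g (x, t)) a b _ M Hab).
  - intros y Hy. rewrite Cmod_norm_R. exact (HM y Hy).
  - apply (RInt_correct (V := C_R_CompleteNormedModule)), ex_RInt_V; assumption.
Qed.

Lemma Cmod_Ci : Cmod Ci = 1.
Proof. unfold Cmod, Ci. cbn [fst snd]. replace (0 ^ 2 + 1 ^ 2) with 1 by ring. apply sqrt_1. Qed.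

Lemma Cmod_oint_le (g : C -> C) (x1 x2 y1 y2 M : R) : x1 <= x2 -> y1 <= y2 ->
  (forall x y, x1 <= x <= x2 -> y1 <= y <= y2 -> Ccont g (x, y)) ->
  (forall x y, x1 <= x <= x2 -> y1 <= y <= y2 -> Cmod (g (x, y)) <= M) ->
  Cmod (oint g x1 x2 y1 y2) <= 2 * ((x2 - x1) + (y2 - y1)) * M.
Proof.
  intros Hx Hy Hc HM. unfold oint.
  assert (A1 := Cmod_Hint_le g y1 x1 x2 M Hx ltac:(intros; apply Hc; lra) ltac:(intros; apply HM; lra)).
  assert (A2 := Cmod_Hint_le g y2 x1 x2 M Hx ltac:(intros; apply Hc; lra) ltac:(intros; apply HM; lra)).
  assert (A3 := Cmod_Vint_le g x1 y1 y2 M Hy ltac:(intros; apply Hc; lra) ltac:(intros; apply HM; lra)).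
  assert (A4 := Cmod_Vint_le g x2 y1 y2 M Hy ltac:(intros; apply Hc; lra) ltac:(intros; apply HM; lra)).
  unfold Cminus.
  eapply Rle_trans; [apply Cmod_triangle|]. eapply Rle_trans; [apply Rplus_le_compat_r, Cmod_triangle|].
  eapply Rle_trans; [apply Rplus_le_compat_r, Rplus_le_compat_r, Cmod_triangle|].
  rewrite !Cmod_opp, !Cmod_mult, Cmod_Ci. lra.
Qed.

(** Integrands that contain the kernel are singular inside the rectangle, so linearity and
    extensionality of [oint] ask for continuity or equality on the boundary alone. *)
Definition on_bd (x1 x2 y1 y2 x y : R) : Prop :=
  x1 <= x <= x2 /\ y1 <= y <= y2 /\ (x = x1 \/ x = x2 \/ y = y1 \/ y = y2).

Lemma oint_plus (f g : C -> C) (x1 x2 y1 y2 : R) : x1 <= x2 -> y1 <= y2 ->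
  (forall x y, on_bd x1 x2 y1 y2 x y -> Ccont f (x, y)) ->
  (forall x y, on_bd x1 x2 y1 y2 x y -> Ccont g (x, y)) ->
  oint (fun z => f z + g z)%C x1 x2 y1 y2 = (oint f x1 x2 y1 y2 + oint g x1 x2 y1 y2)%C.
Proof.
  intros Hx Hy Hf Hg.
  assert (H : forall y, y = y1 \/ y = y2 -> Hint (fun z => f z + g z)%C y x1 x2 = (Hint f y x1 x2 + Hint g y x1 x2)%C).
  { intros y Hy'. refine (RInt_plus (V := C_R_CompleteNormedModule) (fun t => f (t, y)) (fun t => g (t, y)) x1 x2 _ _);
    (apply ex_RInt_H; [assumption|intros]); [apply Hf|apply Hg]; unfold on_bd; intuition (subst; lra). }
  assert (V : forall x, x = x1 \/ x = x2 -> Vint (fun z => f z + g z)%C x y1 y2 = (Vint f x y1 y2 + Vint g x y1 y2)%C).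
  { intros x Hx'. refine (RInt_plus (V := C_R_CompleteNormedModule) (fun t => f (x, t)) (fun t => g (x, t)) y1 y2 _ _);
    (apply ex_RInt_V; [assumption|intros]); [apply Hf|apply Hg]; unfold on_bd; intuition (subst; lra). }
  unfold oint. rewrite (H y1), (H y2), (V x1), (V x2) by (auto; lra). ring.
Qed.

Lemma oint_scal (c : C) (g : C -> C) (x1 x2 y1 y2 : R) : x1 <= x2 -> y1 <= y2 ->
  (forall x y, on_bd x1 x2 y1 y2 x y -> Ccont g (x, y)) ->
  oint (fun z => c * g z)%C x1 x2 y1 y2 = (c * oint g x1 x2 y1 y2)%C.
Proof.
  intros Hx Hy Hg.
  assert (H : forall y, y = y1 \/ y = y2 -> Hint (fun z => c * g z)%C y x1 x2 = (c * Hint g y x1 x2)%C).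
  { intros y Hy'. apply (is_RInt_unique (V := C_R_CompleteNormedModule)), is_RInt_Cmult.
    apply (RInt_correct (V := C_R_CompleteNormedModule)), ex_RInt_H; [assumption|intros; apply Hg; unfold on_bd; intuition (subst; lra)]. }
  assert (V : forall x, x = x1 \/ x = x2 -> Vint (fun z => c * g z)%C x y1 y2 = (c * Vint g x y1 y2)%C).
  { intros x Hx'. apply (is_RInt_unique (V := C_R_CompleteNormedModule)), is_RInt_Cmult.
    apply (RInt_correct (V := C_R_CompleteNormedModule)), ex_RInt_V; [assumption|intros; apply Hg; unfold on_bd; intuition (subst; lra)]. }
  unfold oint. rewrite (H y1), (H y2), (V x1), (V x2) by (auto; lra). ring.
Qed.

Lemma C_R_derive (g : R -> C) (t : R) (l : C) :
  (forall eps, 0 < eps -> exists del, 0 < del /\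
    forall s, Rabs (s - t) < del -> Cmod (g s - g t - RtoC (s - t) * l) <= eps * Rabs (s - t)) ->
  is_derive (K := R_AbsRing) (V := C_R_CompleteNormedModule) g t l.
Proof.
  intros H. split; [apply is_linear_scal_l|].
  intros x Hx.
  apply (is_filter_lim_locally_unique (K := R_AbsRing) (V := R_NormedModule)) in Hx. subst x.
  intros eps. destruct (H eps (cond_pos eps)) as (del & Hd & Hs).
  exists (mkposreal del Hd). intros s Hb. specialize (Hs s Hb).
  refine (Rle_trans _ _ _ (Req_le _ _ _) Hs).
  refine (eq_trans (Cmod_norm_R _) _). f_equal.
  unfold minus, plus, opp, scal. cbn. unfold prod_plus, prod_opp, prod_scal, Cminus, Cplus, Copp, Cmult, RtoC.
  unfold minus, plus, opp, scal, mult; cbn. unfold mult; cbn. f_equal; ring.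
Qed.

Lemma Cderiv_H (G : C -> C) (x y : R) (l : C) : Cderiv G (x, y) l ->
  is_derive (K := R_AbsRing) (V := C_R_CompleteNormedModule) (fun t => G (t, y)) x l.
Proof.
  intros H. apply C_R_derive. intros eps He.
  destruct (proj1 (Cderiv_eps G (x, y) l) H eps He) as (del & Hd & Hw).
  exists del; split; [exact Hd|]. intros s Hs. rewrite <- (Cmod_Hdist s x y).
  replace (RtoC (s - x)) with ((s, y) - (x, y))%C by (unfold Cminus, Cplus, Copp, RtoC; cbn; f_equal; ring).
  apply Hw. rewrite Cmod_Hdist. exact Hs.
Qed.

Lemma Cderiv_V (G : C -> C) (x y : R) (l : C) : Cderiv G (x, y) l ->
  is_derive (K := R_AbsRing) (V := C_R_CompleteNormedModule) (fun t => G (x, t)) y (Ci * l)%C.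
Proof.
  intros H. apply C_R_derive. intros eps He.
  destruct (proj1 (Cderiv_eps G (x, y) l) H eps He) as (del & Hd & Hw).
  exists del; split; [exact Hd|]. intros s Hs. rewrite <- (Cmod_Vdist s y x).
  replace (RtoC (s - y) * (Ci * l))%C with (((x, s) - (x, y)) * l)%C
    by (unfold Cminus, Cplus, Copp, RtoC, Cmult, Ci; cbn; f_equal; ring).
  apply Hw. rewrite Cmod_Vdist. exact Hs.
Qed.

(** Each side contributes a difference of values of [G] at two corners, and these cancel around the
    rectangle; on vertical sides the chain rule produces the factor [Ci] that stands before
    [Vint]. *)
Lemma oint_primitive (G g : C -> C) (x1 x2 y1 y2 : R) : x1 <= x2 -> y1 <= y2 ->
  (forall x y, x1 <= x <= x2 -> y1 <= y <= y2 -> Ccont g (x, y)) ->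
  (forall x y, x1 <= x <= x2 -> y1 <= y <= y2 -> Cderiv G (x, y) (g (x, y))) ->
  oint g x1 x2 y1 y2 = 0.
Proof.
  intros Hx Hy Hc Hd.
  assert (H : forall y, y1 <= y <= y2 -> Hint g y x1 x2 = (G (x2, y) - G (x1, y))%C).
  { intros y Hy'. apply (is_RInt_unique (V := C_R_CompleteNormedModule)).
    apply (is_RInt_derive (V := C_R_CompleteNormedModule) (fun t => G (t, y)) (fun t => g (t, y)));
      rewrite Rmin_left, Rmax_right by exact Hx; intros x Hx'.
    - apply Cderiv_H, Hd; assumption.
    - apply Ccont_H, Hc; assumption. }
  assert (V : forall x, x1 <= x <= x2 -> (Ci * Vint g x y1 y2)%C = (G (x, y2) - G (x, y1))%C).
  { intros x Hx'.
    transitivity (RInt (V := C_R_CompleteNormedModule) (fun t => Ci * g (x, t))%C y1 y2).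
    - symmetry. apply (is_RInt_unique (V := C_R_CompleteNormedModule)), is_RInt_Cmult.
      apply (RInt_correct (V := C_R_CompleteNormedModule)), ex_RInt_V; auto.
    - apply (is_RInt_unique (V := C_R_CompleteNormedModule)).
      apply (is_RInt_derive (V := C_R_CompleteNormedModule) (fun t => G (x, t)) (fun t => Ci * g (x, t))%C);
      rewrite Rmin_left, Rmax_right by exact Hy; intros y Hy'.
      + apply Cderiv_V, Hd; assumption.
      + apply (Ccont_V (fun z => Ci * g z)%C), Ccont_mult; [|apply Hc; assumption].
        exact (Cderiv_cont _ _ _ (Cderiv_const Ci _)). }
  unfold oint. rewrite (H y1), (H y2), (V x1), (V x2) by (auto; lra). ring.
Qed.

(** Left endpoints increase and every right endpoint bounds all of them, so their supremum lies in
    each interval. *)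
Lemma nested_dyadic (a : nat -> R) (w : R) : 0 <= w ->
  (forall n, a n <= a (S n) <= a n + w / 2 ^ (S n)) ->
  exists u, forall n, a n <= u <= a n + w / 2 ^ n.
Proof.
  intros Hw H.
  assert (P2 : forall n, 0 < 2 ^ n) by (intros; apply pow_lt; lra).
  assert (Hup : forall n k, a (n + k)%nat + w / 2 ^ (n + k) <= a n + w / 2 ^ n).
  { intros n k. induction k as [|k IH]; [rewrite Nat.add_0_r; lra|].
    rewrite Nat.add_succ_r. specialize (H (n + k)%nat).
    replace (w / 2 ^ (n + k)) with (2 * (w / 2 ^ S (n + k))) in IH; [lra|].
    simpl pow. field. apply Rgt_not_eq, P2. }
  assert (Hinc : forall n k, a n <= a (n + k)%nat).
  { intros n k. induction k as [|k IH]; [rewrite Nat.add_0_r; lra|].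
    rewrite Nat.add_succ_r. specialize (H (n + k)%nat). lra. }
  assert (Hpos : forall n, 0 <= w / 2 ^ n).
  { intros n. apply Rmult_le_pos; [exact Hw|]. left. apply Rinv_0_lt_compat, P2. }
  assert (Hub : forall n, is_upper_bound (fun x => exists m, x = a m) (a n + w / 2 ^ n)).
  { intros n x [m ->]. destruct (Nat.le_ge_cases n m) as [L|L].
    - pose proof (Hup n (m - n)%nat) as U. replace (n + (m - n))%nat with m in U by lia.
      pose proof (Hpos m). lra.
    - pose proof (Hinc m (n - m)%nat) as U. replace (m + (n - m))%nat with n in U by lia.
      pose proof (Hpos n). lra. }
  destruct (completeness (fun x => exists m, x = a m)) as [u [Hu1 Hu2]].
  - exists (a 0%nat + w / 2 ^ 0). apply Hub.
  - exists (a 0%nat), 0%nat. reflexivity.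
  - exists u. intros n. split; [apply Hu1; exists n; reflexivity|apply Hu2, Hub].
Qed.

(** Dependent choice on lower left corners: [constructive_indefinite_description] turns the
    existential step into a function, and the sequence is built by recursion together with the
    proofs of [P]. Each coordinate is then a case of [nested_dyadic]. *)
Lemma bisection (P : nat -> R * R -> Prop) (p0 : R * R) (w l : R) : 0 <= w -> 0 <= l ->
  P 0%nat p0 ->
  (forall n p, P n p -> exists q, P (S n) q /\
     fst p <= fst q <= fst p + w / 2 ^ (S n) /\ snd p <= snd q <= snd p + l / 2 ^ (S n)) ->
  exists u v, forall n, exists p, P n p /\
    fst p <= u <= fst p + w / 2 ^ n /\ snd p <= v <= snd p + l / 2 ^ n.
Proof.
  intros Hw Hl H0 Hstep.
  pose (T := fun n => {p | P n p}).
  pose (step := fun n (p : T n) =>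
    let s := constructive_indefinite_description _ (Hstep n (proj1_sig p) (proj2_sig p)) in
    exist (P (S n)) (proj1_sig s) (proj1 (proj2_sig s)) : T (S n)).
  pose (sq := nat_rect T (exist _ p0 H0) step).
  pose (a := fun n => proj1_sig (sq n)).
  assert (Ha : forall n, fst (a n) <= fst (a (S n)) <= fst (a n) + w / 2 ^ (S n) /\
                         snd (a n) <= snd (a (S n)) <= snd (a n) + l / 2 ^ (S n)).
  { intros n. exact (proj2 (proj2_sig (constructive_indefinite_description _ (Hstep n (proj1_sig (sq n)) (proj2_sig (sq n)))))). }
  destruct (nested_dyadic (fun n => fst (a n)) w Hw (fun n => proj1 (Ha n))) as [u Hu].
  destruct (nested_dyadic (fun n => snd (a n)) l Hl (fun n => proj2 (Ha n))) as [v Hv].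
  exists u, v. intros n. exists (a n). split; [exact (proj2_sig (sq n))|]. split; [apply Hu|apply Hv].
Qed.

Lemma Cderiv_affine (p q z : C) : Cderiv (fun w => p * w + q / 2 * (w * w))%C z (p + q * z)%C.
Proof.
  refine (Cderiv_ext _ _ z _ _ (fun w => eq_refl) _
    (Cderiv_plus _ _ z _ _ (Cderiv_scal p _ z _ (Cderiv_id z))
      (Cderiv_scal (q / 2) _ z _ (Cderiv_mult _ _ z _ _ (Cderiv_id z) (Cderiv_id z))))).
  field.
Qed.

Lemma Ccont_affine (p q z : C) : Ccont (fun w => p + q * w)%C z.
Proof.
  exact (Cderiv_cont _ _ _ (Cderiv_plus _ _ z _ _ (Cderiv_const p z) (Cderiv_scal q _ z _ (Cderiv_id z)))).
Qed.

Lemma oint_ext (f g : C -> C) (x1 x2 y1 y2 : R) : x1 <= x2 -> y1 <= y2 ->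
  (forall x y, on_bd x1 x2 y1 y2 x y -> f (x, y) = g (x, y)) ->
  oint f x1 x2 y1 y2 = oint g x1 x2 y1 y2.
Proof.
  intros Hx Hy E. unfold oint, Hint, Vint.
  assert (A : forall y, y = y1 \/ y = y2 -> RInt (V := C_R_CompleteNormedModule) (fun t => f (t, y)) x1 x2
     = RInt (V := C_R_CompleteNormedModule) (fun t => g (t, y)) x1 x2).
  { intros y Hy'. apply (RInt_ext (V := C_R_CompleteNormedModule)).
    rewrite Rmin_left, Rmax_right by exact Hx. intros x Hx'. apply E; unfold on_bd; intuition (subst; lra). }
  assert (B : forall x, x = x1 \/ x = x2 -> RInt (V := C_R_CompleteNormedModule) (fun t => f (x, t)) y1 y2
     = RInt (V := C_R_CompleteNormedModule) (fun t => g (x, t)) y1 y2).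
  { intros x Hx'. apply (RInt_ext (V := C_R_CompleteNormedModule)).
    rewrite Rmin_left, Rmax_right by exact Hy. intros y Hy'. apply E; unfold on_bd; intuition (subst; lra). }
  rewrite (A y1), (A y2), (B x1), (B x2) by auto. reflexivity.
Qed.

(** The affine expansion at (u, v) has a primitive and integrates to 0. The remainder is at most
    [eps] times the half perimeter s, along a contour of length 2 s, whence the square. *)
Lemma Cmod_oint_local (g : C -> C) (u v : R) (L : C) (eps x1 x2 y1 y2 : R) :
  x1 <= u <= x2 -> y1 <= v <= y2 ->
  (forall x y, x1 <= x <= x2 -> y1 <= y <= y2 -> Ccont g (x, y)) ->
  (forall x y, x1 <= x <= x2 -> y1 <= y <= y2 ->
     Cmod (g (x, y) - g (u, v) - ((x, y) - (u, v)) * L) <= eps * Cmod ((x, y) - (u, v))) ->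
  0 <= eps ->
  Cmod (oint g x1 x2 y1 y2) <= 2 * eps * ((x2 - x1) + (y2 - y1)) ^ 2.
Proof.
  intros Hu Hv Hc Hd He.
  set (z := (u, v) : C).
  set (A := fun w : C => ((g z - z * L) + L * w)%C).
  set (D := fun w : C => (g w + (- (g z - z * L) + (- L) * w))%C).
  assert (HcA : forall w, Ccont A w) by (intros; apply Ccont_affine).
  assert (HcD : forall x y, x1 <= x <= x2 -> y1 <= y <= y2 -> Ccont D (x, y)).
  { intros x y Hx Hy. apply Ccont_plus; [apply Hc; assumption|apply Ccont_affine]. }
  assert (E : oint g x1 x2 y1 y2 = oint D x1 x2 y1 y2).
  { rewrite (oint_ext g (fun w => D w + A w)%C) by (try lra; intros; unfold D, A; ring).
    rewrite oint_plus by (try lra; unfold on_bd; intuition auto).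
    rewrite (oint_primitive (fun w => (g z - z * L) * w + L / 2 * (w * w))%C A)
      by (try lra; auto; intros; apply Cderiv_affine). ring. }
  rewrite E. set (s := (x2 - x1) + (y2 - y1)).
  assert (Hs : 0 <= s) by (unfold s; lra).
  eapply Rle_trans; [apply (Cmod_oint_le D x1 x2 y1 y2 (eps * s)); try lra; auto|].
  - intros x y Hx Hy. specialize (Hd x y Hx Hy).
    replace (D (x, y)) with (g (x, y) - g (u, v) - ((x, y) - (u, v)) * L)%C
      by (unfold D, z; ring).
    eapply Rle_trans; [exact Hd|]. apply Rmult_le_compat_l; [exact He|].
    eapply Rle_trans; [apply Cmod_le_abs|].
    unfold Cminus, Cplus, Copp, Re, Im; cbn [fst snd].
    assert (Rabs (x + - u) <= x2 - x1) by (apply Rabs_le; lra).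
    assert (Rabs (y + - v) <= y2 - y1) by (apply Rabs_le; lra).
    unfold s; lra.
  - fold s. lra.
Qed.

(* Goursat: a failure at scale [s] would persist, relative to the area, in one quarter of the
   rectangle, hence at arbitrarily small scales around a point, against differentiability there. *)
Lemma goursat (g : C -> C) (x1 x2 y1 y2 : R) : x1 <= x2 -> y1 <= y2 ->
  (forall x y, x1 <= x <= x2 -> y1 <= y <= y2 -> exists l, Cderiv g (x, y) l) ->
  oint g x1 x2 y1 y2 = 0.
Proof.
  intros Hx Hy Hd.
  assert (Hc : forall x y, x1 <= x <= x2 -> y1 <= y <= y2 -> Ccont g (x, y)).
  { intros x y H1 H2. destruct (Hd x y H1 H2) as [l Hl]. exact (Cderiv_cont _ _ _ Hl). }
  apply Cmod_eq_0. apply Rle_antisym; [|apply Cmod_ge_0]. apply Rnot_lt_le. intros Hpos.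
  (* The summand 1 keeps [s] positive even for a degenerate rectangle. *)
  set (w := x2 - x1). set (l := y2 - y1). set (s := w + l + 1).
  assert (Hs : 0 < s) by (unfold s, w, l; lra).
  (* Half of the ratio of the integral to s^2, so that the invariant [P] holds strictly at scale
     0. *)
  set (eps := Cmod (oint g x1 x2 y1 y2) / (2 * s ^ 2)).
  assert (Hs2 : 0 < s ^ 2) by (apply pow_lt; exact Hs).
  assert (He : 0 < eps) by (apply Rdiv_lt_0_compat; lra).
  set (P := fun (n : nat) (p : R * R) =>
    (x1 <= fst p /\ fst p + w / 2 ^ n <= x2 /\ y1 <= snd p /\ snd p + l / 2 ^ n <= y2) /\
    eps * (s / 2 ^ n) ^ 2 < Cmod (oint g (fst p) (fst p + w / 2 ^ n) (snd p) (snd p + l / 2 ^ n))).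
  assert (P2 : forall n, 0 < 2 ^ n) by (intros; apply pow_lt; lra).
  destruct (bisection P (x1, y1) w l) as (u & v & Huv).
  - unfold w; lra.
  - unfold l; lra.
  - split; cbn [fst snd]; unfold w, l; simpl pow; rewrite !Rdiv_1_r;
      [repeat split; lra|].
    replace (x1 + (x2 - x1)) with x2 by ring. replace (y1 + (y2 - y1)) with y2 by ring.
    unfold eps. apply Rlt_le_trans with (2 * (Cmod (oint g x1 x2 y1 y2) / (2 * s ^ 2) * (s * (s * 1)))).
    + assert (0 < Cmod (oint g x1 x2 y1 y2) / (2 * s ^ 2) * (s * (s * 1))) by
        (apply Rmult_lt_0_compat; [exact He|nra]). lra.
    + right. field. lra.
  - intros n [a b] [(B1 & B2 & B3 & B4) Hbig]. cbn [fst snd] in *.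
    set (w' := w / 2 ^ S n). set (l' := l / 2 ^ S n).
    assert (Ew : w / 2 ^ n = w' + w') by (unfold w'; simpl pow; field; apply Rgt_not_eq, P2).
    assert (El : l / 2 ^ n = l' + l') by (unfold l'; simpl pow; field; apply Rgt_not_eq, P2).
    assert (Es : s / 2 ^ n = 2 * (s / 2 ^ S n)) by (simpl pow; field; apply Rgt_not_eq, P2).
    assert (Hw' : 0 <= w') by (apply Rmult_le_pos; [unfold w; lra|left; apply Rinv_0_lt_compat, P2]).
    assert (Hl' : 0 <= l') by (apply Rmult_le_pos; [unfold l; lra|left; apply Rinv_0_lt_compat, P2]).
    rewrite Ew in B2, Hbig. rewrite El in B4, Hbig. rewrite Es in Hbig.
    set (s' := s / 2 ^ S n) in *.
    rewrite (oint_split_x g a (a + w') (a + (w' + w'))) in Hbig by (try lra; intros; apply Hc; lra).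
    rewrite (oint_split_y g a (a + w') b (b + l')) in Hbig by (try lra; intros; apply Hc; lra).
    rewrite (oint_split_y g (a + w') (a + (w' + w')) b (b + l')) in Hbig by (try lra; intros; apply Hc; lra).
    rewrite <- !Rplus_assoc in Hbig.
    destruct (Rlt_dec (eps * s' ^ 2) (Cmod (oint g a (a + w') b (b + l')))) as [K1|K1].
    { exists (a, b). unfold P; fold w' l' s'. cbn [fst snd]. repeat split; try lra. }
    destruct (Rlt_dec (eps * s' ^ 2) (Cmod (oint g a (a + w') (b + l') (b + l' + l')))) as [K2|K2].
    { exists (a, b + l'). unfold P; fold w' l' s'. cbn [fst snd]. repeat split; try lra. }
    destruct (Rlt_dec (eps * s' ^ 2) (Cmod (oint g (a + w') (a + w' + w') b (b + l')))) as [K3|K3].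
    { exists (a + w', b). unfold P; fold w' l' s'. cbn [fst snd]. repeat split; try lra. }
    destruct (Rlt_dec (eps * s' ^ 2) (Cmod (oint g (a + w') (a + w' + w') (b + l') (b + l' + l')))) as [K4|K4].
    { exists (a + w', b + l'). unfold P; fold w' l' s'. cbn [fst snd]. repeat split; try lra. }
    exfalso. apply (Rlt_not_le _ _ Hbig).
    eapply Rle_trans; [apply Cmod_triangle|].
    eapply Rle_trans; [apply Rplus_le_compat; apply Cmod_triangle|]. lra.
  - assert (Huv0 : x1 <= u <= x2 /\ y1 <= v <= y2).
    { destruct (Huv 0%nat) as ([a b] & [(B1 & B2 & B3 & B4) _] & U & V). cbn [fst snd] in *. lra. }
    destruct (Hd u v (proj1 Huv0) (proj2 Huv0)) as [L HL].
    (* With [eps / 2], the local estimate yields at most [eps] times the squared half perimeter,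
       which contradicts the strict lower bound in [P]. *)
    destruct (proj1 (Cderiv_eps g (u, v) L) HL (eps / 2) ltac:(lra)) as (del & Hdel & Hw).
    destruct (pow_lt_1_zero (/ 2) ltac:(rewrite Rabs_right; lra) (del / s) ltac:(apply Rdiv_lt_0_compat; lra)) as [n Hn].
    specialize (Hn n (le_n n)). rewrite Rabs_right in Hn by (left; apply pow_lt; lra).
    rewrite pow_inv in Hn.
    assert (Hsn : s / 2 ^ n < del).
    { unfold Rdiv. apply Rmult_lt_reg_r with (/ s); [apply Rinv_0_lt_compat, Hs|].
      replace (s * / 2 ^ n * / s) with (/ 2 ^ n) by (field; split; apply Rgt_not_eq; first [exact Hs | apply P2]). exact Hn. }
    destruct (Huv n) as ([a b] & [(B1 & B2 & B3 & B4) Hbig] & U & V). cbn [fst snd] in *.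
    assert (Hi : 0 < / 2 ^ n) by (apply Rinv_0_lt_compat, P2).
    assert (Es : w / 2 ^ n + l / 2 ^ n <= s / 2 ^ n) by (unfold Rdiv, s; nra).
    assert (Hsl : 0 <= w / 2 ^ n + l / 2 ^ n) by (unfold Rdiv, w, l; nra).
    assert (Hloc : Cmod (oint g a (a + w / 2 ^ n) b (b + l / 2 ^ n)) <=
       2 * (eps / 2) * ((a + w / 2 ^ n - a) + (b + l / 2 ^ n - b)) ^ 2).
    { apply (Cmod_oint_local g u v L); try lra.
      - intros; apply Hc; lra.
      - intros x y Hx' Hy'. apply Hw.
        eapply Rle_lt_trans; [apply Cmod_le_abs|].
        unfold Cminus, Cplus, Copp, Re, Im; cbn [fst snd].
        assert (Rabs (x + - u) <= w / 2 ^ n) by (apply Rabs_le; lra).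
        assert (Rabs (y + - v) <= l / 2 ^ n) by (apply Rabs_le; lra). lra. }
    apply (Rlt_not_le _ _ Hbig). eapply Rle_trans; [exact Hloc|].
    replace (2 * (eps / 2)) with eps by field. apply Rmult_le_compat_l; [lra|].
    apply pow_incr. lra.
Qed.

(** * Isolated points and removable singularities *)

Lemma Cderiv_ext_near (f g : C -> C) (z l : C) (del : R) : 0 < del ->
  (forall w, Cmod (w - z) < del -> f w = g w) -> Cderiv f z l -> Cderiv g z l.
Proof.
  intros Hd E H. apply Cderiv_eps. intros eps He.
  destruct (proj1 (Cderiv_eps f z l) H eps He) as (d & Hd' & Hw).
  exists (Rmin del d). split; [apply Rmin_glb_lt; assumption|].
  intros w Hlt. pose proof (Rmin_l del d). pose proof (Rmin_r del d).
  rewrite <- (E w) by lra. rewrite <- (E z).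
  - apply Hw. lra.
  - replace (z - z)%C with (RtoC 0) by ring. rewrite Cmod_0. exact Hd.
Qed.

Lemma Cdist_pos (w z : C) : w <> z -> 0 < Cmod (w - z).
Proof.
  intros H. apply Cmod_gt_0. intros E. apply H.
  replace w with ((w - z) + z)%C by ring. rewrite E. ring.
Qed.

(** A square of half side [r] around the point leaves four rectangles to which [goursat] applies;
    continuity bounds the integral around the square by 8 r M, with [r] as small as desired. *)
Lemma goursat_punctured (g : C -> C) (u v x1 x2 y1 y2 : R) :
  x1 < u < x2 -> y1 < v < y2 ->
  (forall x y, x1 <= x <= x2 -> y1 <= y <= y2 -> (x, y) <> (u, v) -> exists l, Cderiv g (x, y) l) ->
  Ccont g (u, v) ->
  oint g x1 x2 y1 y2 = 0.
Proof.
  intros Hu Hv Hd Hc0.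
  assert (Hc : forall x y, x1 <= x <= x2 -> y1 <= y <= y2 -> Ccont g (x, y)).
  { intros x y H1 H2. destruct (classic ((x, y) = (u, v))) as [E|E]; [rewrite E; exact Hc0|].
    destruct (Hd x y H1 H2 E) as [l Hl]. exact (Cderiv_cont _ _ _ Hl). }
  apply Cmod_eq_0. apply Rle_antisym; [|apply Cmod_ge_0]. apply Rle_plus_epsilon. intros eps He.
  rewrite Rplus_0_l.
  destruct (proj1 (Ccont_eps g (u, v)) Hc0 1 Rlt_0_1) as (del & Hdel & Hw).
  set (M := Cmod (g (u, v)) + 1).
  assert (HM : 0 < M) by (pose proof (Cmod_ge_0 (g (u, v))); unfold M; lra).
  assert (exists r, 0 < r /\ r <= u - x1 /\ r <= x2 - u /\ r <= v - y1 /\ r <= y2 - v /\ r < del / 2 /\ 8 * r * M <= eps) as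
    (r & Hr & R1 & R2 & R3 & R4 & R5 & R6).
  { set (r := Rmin (Rmin (Rmin (u - x1) (x2 - u)) (Rmin (v - y1) (y2 - v))) (Rmin (del / 3) (eps / (8 * M)))).
    assert (0 < eps / (8 * M)) by (apply Rdiv_lt_0_compat; lra).
    pose proof (Rmin_l (Rmin (Rmin (u - x1) (x2 - u)) (Rmin (v - y1) (y2 - v))) (Rmin (del / 3) (eps / (8 * M)))).
    pose proof (Rmin_r (Rmin (Rmin (u - x1) (x2 - u)) (Rmin (v - y1) (y2 - v))) (Rmin (del / 3) (eps / (8 * M)))).
    pose proof (Rmin_l (Rmin (u - x1) (x2 - u)) (Rmin (v - y1) (y2 - v))).
    pose proof (Rmin_r (Rmin (u - x1) (x2 - u)) (Rmin (v - y1) (y2 - v))).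
    pose proof (Rmin_l (u - x1) (x2 - u)). pose proof (Rmin_r (u - x1) (x2 - u)).
    pose proof (Rmin_l (v - y1) (y2 - v)). pose proof (Rmin_r (v - y1) (y2 - v)).
    pose proof (Rmin_l (del / 3) (eps / (8 * M))). pose proof (Rmin_r (del / 3) (eps / (8 * M))).
    exists r. split; [unfold r; repeat apply Rmin_glb_lt; lra|].
    repeat split; try (unfold r; lra).
    apply Rle_trans with (8 * (eps / (8 * M)) * M); [|right; field; lra].
    apply Rmult_le_compat_r; [lra|]. unfold r. lra. }
  assert (N : forall x y, x <> u \/ y <> v -> (x, y) <> (u, v)).
  { intros x y H E. injection E as E1 E2. destruct H; auto. }
  rewrite (oint_split_x g x1 (u - r) x2) by (try lra; intros; apply Hc; lra).
  rewrite (oint_split_x g (u - r) (u + r) x2) by (try lra; intros; apply Hc; lra).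
  rewrite (oint_split_y g (u - r) (u + r) y1 (v - r) y2) by (try lra; intros; apply Hc; lra).
  rewrite (oint_split_y g (u - r) (u + r) (v - r) (v + r) y2) by (try lra; intros; apply Hc; lra).
  rewrite (goursat g x1 (u - r)), (goursat g (u + r) x2), (goursat g (u - r) (u + r) y1), (goursat g (u - r) (u + r) (v + r))
    by (try lra; intros; apply Hd; try lra; apply N; lra).
  match goal with |- Cmod ?e <= _ => replace e with (oint g (u - r) (u + r) (v - r) (v + r)) by ring end.
  eapply Rle_trans; [apply (Cmod_oint_le g _ _ _ _ M); try lra|].
  - intros; apply Hc; lra.
  - intros x y H1 H2.
    replace (g (x, y)) with ((g (x, y) - g (u, v)) + g (u, v))%C by ring.
    eapply Rle_trans; [apply Cmod_triangle|]. unfold M. rewrite (Rplus_comm _ 1). apply Rplus_le_compat_r.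
    left. apply Hw. eapply Rle_lt_trans; [apply Cmod_le_abs|].
    unfold Cminus, Cplus, Copp, Re, Im; cbn [fst snd].
    assert (Rabs (x + - u) <= r) by (apply Rabs_le; lra).
    assert (Rabs (y + - v) <= r) by (apply Rabs_le; lra). lra.
  - lra.
Qed.

(** The difference quotient, given the derivative as its value at [c]; a quotient of two slopes
    removes the singularity of a product with the kernel. *)
Definition slope (F : C -> C) (c l : C) (w : C) : C :=
  if Ceq_dec w c then l else ((F w - F c) / (w - c))%C.

Lemma Ccont_slope (F : C -> C) (c l : C) : Cderiv F c l -> Ccont (slope F c l) c.
Proof.
  intros H. apply Ccont_eps. intros eps He.
  destruct (proj1 (Cderiv_eps F c l) H (eps / 2) ltac:(lra)) as (del & Hd & Hw).
  exists del; split; [exact Hd|]. intros w Hlt. unfold slope.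
  destruct (Ceq_dec c c) as [_|N]; [|destruct (N eq_refl)].
  destruct (Ceq_dec w c) as [E|N].
  - replace (l - l)%C with (RtoC 0) by ring. rewrite Cmod_0. exact He.
  - specialize (Hw w Hlt). pose proof (Cdist_pos w c N) as Hp.
    assert (Hne : (w - c)%C <> 0) by (intros E; rewrite E, Cmod_0 in Hp; lra).
    replace ((F w - F c) / (w - c) - l)%C with ((F w - F c - (w - c) * l) / (w - c))%C by (field; exact Hne).
    rewrite Cmod_div by exact Hne. apply Rmult_lt_reg_r with (Cmod (w - c)); [exact Hp|].
    unfold Rdiv. rewrite Rmult_assoc, Rinv_l, Rmult_1_r by lra. nra.
Qed.

Lemma Ccont_inv (g : C -> C) (z : C) : Ccont g z -> g z <> 0 -> Ccont (fun w => / g w)%C z.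
Proof.
  intros Hg Hz. pose proof (Cderiv_cont _ _ _ (Cderiv_inv (g z) Hz)) as Hi.
  exact (continuous_comp (U := AbsRing_UniformSpace C_AbsRing) (V := AbsRing_UniformSpace C_AbsRing)
    (W := AbsRing_UniformSpace C_AbsRing) g (fun w => / w)%C z Hg Hi).
Qed.

(** The total inverse gives [ker] the value 0 at its poles, which keeps an identity in [oint_cell]
    true at the other nodes as well. *)
Lemma Cinv_0 : (/ 0 = 0)%C.
Proof. unfold Cinv, RtoC; cbn [fst snd]. f_equal; unfold Rdiv; rewrite ?Ropp_0; apply Rmult_0_l. Qed.

(** * The kernel with poles at the nodes *)

Definition Ephase (h : R) (w : C) : C := Cexp (Ci * RtoC (2 * PI / h) * w)%C.
Definition ker (h : R) (w : C) : C := (/ (1 - Ephase h w))%C.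

Lemma Ephase_xy (h x y : R) :
  Ephase h (x, y) = (exp (- (2 * PI / h * y)) * cos (2 * PI / h * x), exp (- (2 * PI / h * y)) * sin (2 * PI / h * x)).
Proof.
  unfold Ephase, Cexp.
  replace (Re (Ci * RtoC (2 * PI / h) * (x, y))) with (- (2 * PI / h * y))
    by (unfold Ci, RtoC, Cmult, Re; cbn [fst snd]; ring).
  replace (Im (Ci * RtoC (2 * PI / h) * (x, y))) with (2 * PI / h * x)
    by (unfold Ci, RtoC, Cmult, Im; cbn [fst snd]; ring).
  reflexivity.
Qed.

Lemma Cmod_Ephase (h x y : R) : Cmod (Ephase h (x, y)) = exp (- (2 * PI / h * y)).
Proof.
  unfold Ephase. rewrite Cmod_Cexp. f_equal. unfold Ci, RtoC, Cmult, Re; cbn [fst snd]; ring.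
Qed.

Lemma Ephase_add (h : R) (z w : C) : Ephase h (z + w) = (Ephase h z * Ephase h w)%C.
Proof. unfold Ephase. rewrite <- Cexp_add. f_equal. ring. Qed.

Lemma Ephase_node (h : R) (k : Z) : 0 < h -> Ephase h (RtoC (IZR k * h)) = 1.
Proof.
  intros Hh. unfold RtoC at 1. rewrite Ephase_xy.
  replace (2 * PI / h * (IZR k * h)) with (2 * (IZR k * PI)) by (field; lra).
  assert (Hs : sin (IZR k * PI) = 0) by (apply sin_eq_0_1; exists k; reflexivity).
  rewrite cos_2a_sin, sin_2a, Hs, Rmult_0_r, Ropp_0, exp_0. unfold RtoC. f_equal; ring.
Qed.

(** Halfway between nodes the phase is a negative real, so 1 minus it exceeds 1: vertical sides
    placed there meet no pole, and the kernel is at most 1 on them. *)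
Lemma Ephase_mid (h : R) (k : Z) (y : R) : 0 < h ->
  Ephase h ((IZR k + / 2) * h, y) = RtoC (- exp (- (2 * PI / h * y))).
Proof.
  intros Hh.
  replace (((IZR k + / 2) * h, y) : C) with (RtoC (IZR k * h) + ((h / 2)%R, y))%C
    by (unfold RtoC, Cplus; cbn [fst snd]; f_equal; field).
  rewrite Ephase_add, Ephase_node, Ephase_xy by exact Hh.
  replace (2 * PI / h * (h / 2)) with PI by (field; lra).
  rewrite cos_PI, sin_PI. unfold RtoC, Cmult; cbn [fst snd]. f_equal; ring.
Qed.

Lemma cos_eq_1 (t : R) : Rabs t <= PI -> cos t = 1 -> t = 0.
Proof.
  intros Ht Hc. pose proof PI_RGT_0.
  replace t with (2 * (t / 2)) in Hc by field. rewrite cos_2a_sin in Hc.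
  assert (Hs : sin (t / 2) = 0) by nra.
  destruct (Rtotal_order t 0) as [L|[L|L]]; [|exact L|].
  - rewrite Rabs_left in Ht by lra. pose proof (sin_gt_0 (- (t / 2)) ltac:(lra) ltac:(lra)) as G.
    rewrite sin_neg in G. lra.
  - rewrite Rabs_right in Ht by lra. pose proof (sin_gt_0 (t / 2) ltac:(lra) ltac:(lra)). lra.
Qed.

(** The modulus forces y = 0, and then an angle in [- pi, pi] has cosine 1. After a translation, the
    node is thus the only pole in its cell. *)
Lemma Ephase_eq_1 (h x y : R) : 0 < h -> Rabs x <= h / 2 -> Ephase h (x, y) = 1 -> x = 0 /\ y = 0.
Proof.
  intros Hh Hx E. pose proof PI_RGT_0 as Hpi.
  assert (Hk : 0 < 2 * PI / h) by (apply Rdiv_lt_0_compat; lra).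
  assert (Hy : y = 0).
  { pose proof (f_equal Cmod E) as M. rewrite Cmod_Ephase, Cmod_1, <- exp_0 in M.
    apply exp_inv in M. nra. }
  subst y. split; [|reflexivity].
  rewrite Ephase_xy, Rmult_0_r, Ropp_0, exp_0 in E. injection E as E _. rewrite Rmult_1_l in E.
  apply cos_eq_1 in E.
  - nra.
  - rewrite Rabs_mult, (Rabs_right (2 * PI / h)) by lra.
    apply Rle_trans with (2 * PI / h * (h / 2)); [apply Rmult_le_compat_l; lra|right; field; lra].
Qed.

Lemma Cderiv_Ephase (h : R) (z : C) : Cderiv (Ephase h) z (Ci * RtoC (2 * PI / h) * Ephase h z)%C.
Proof.
  refine (Cderiv_ext _ _ z _ _ (fun w => eq_refl) _
    (Cderiv_comp Cexp (fun w => Ci * RtoC (2 * PI / h) * w)%C z _ _ (Cderiv_Cexp _)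
       (Cderiv_scal _ _ z _ (Cderiv_id z)))).
  unfold Ephase. ring.
Qed.

Lemma Cderiv_1_Ephase (h : R) (z : C) : Cderiv (fun w => 1 - Ephase h w)%C z (- (Ci * RtoC (2 * PI / h) * Ephase h z))%C.
Proof.
  refine (Cderiv_ext _ _ z _ _ (fun w => eq_refl) _
    (Cderiv_minus _ _ z _ _ (Cderiv_const 1 z) (Cderiv_Ephase h z))). ring.
Qed.

Lemma Cderiv_ker (h : R) (z : C) : Ephase h z <> 1 -> exists l, Cderiv (ker h) z l.
Proof.
  intros H. eexists.
  refine (Cderiv_comp (fun w => / w)%C (fun w => 1 - Ephase h w)%C z _ _ (Cderiv_inv _ _) (Cderiv_1_Ephase h z)).
  intros E. apply H. replace (Ephase h z) with (1 - (1 - Ephase h z))%C by ring. rewrite E. ring.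
Qed.

Lemma Ephase_neq_1 (h x y : R) : 0 < h -> y <> 0 -> Ephase h (x, y) <> 1.
Proof.
  intros Hh Hy E. pose proof PI_RGT_0 as Hpi.
  assert (Hk : 0 < 2 * PI / h) by (apply Rdiv_lt_0_compat; lra).
  pose proof (f_equal Cmod E) as M. rewrite Cmod_Ephase, Cmod_1, <- exp_0 in M.
  apply exp_inv in M. apply Hy. nra.
Qed.

Lemma Cmod_1_minus_ge (z : C) : Rabs (1 - Cmod z) <= Cmod (1 - z).
Proof.
  assert (A : 1 <= Cmod (1 - z) + Cmod z).
  { pose proof (Cmod_triangle (1 - z) z) as T. replace (1 - z + z)%C with (RtoC 1) in T by ring.
    rewrite Cmod_1 in T. exact T. }
  assert (B : Cmod z <= Cmod (1 - z) + 1).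
  { pose proof (Cmod_triangle (- (1 - z)) 1) as T. replace (- (1 - z) + 1)%C with z in T by ring.
    rewrite Cmod_opp, Cmod_1 in T. exact T. }
  apply Rabs_le. lra.
Qed.

Lemma ker_top (h D x y : R) : 0 < h -> 0 < D -> D <= y ->
  Cmod (ker h (x, y) - 1) <= exp (- (2 * PI / h * D)) / (1 - exp (- (2 * PI / h * D))).
Proof.
  intros Hh HD Hy. pose proof PI_RGT_0 as Hpi.
  assert (Hk : 0 < 2 * PI / h) by (apply Rdiv_lt_0_compat; lra).
  assert (Hne : (1 - Ephase h (x, y))%C <> 0).
  { intros E. apply (Ephase_neq_1 h x y Hh ltac:(lra)).
    replace (Ephase h (x, y)) with (1 - (1 - Ephase h (x, y)))%C by ring. rewrite E. ring. }
  unfold ker. replace (/ (1 - Ephase h (x, y)) - 1)%C with (Ephase h (x, y) / (1 - Ephase h (x, y)))%C by (field; exact Hne).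
  rewrite Cmod_div by exact Hne.
  pose proof (Cmod_1_minus_ge (Ephase h (x, y))) as G. rewrite Cmod_Ephase in *.
  assert (exp (- (2 * PI / h * y)) <= exp (- (2 * PI / h * D))).
  { destruct (Rle_lt_or_eq_dec _ _ Hy) as [L|<-]; [left; apply exp_increasing; nra|lra]. }
  assert (exp (- (2 * PI / h * D)) < 1) by (rewrite <- exp_0; apply exp_increasing; nra).
  pose proof (exp_pos (- (2 * PI / h * y))).
  pose proof (Rle_abs (1 - exp (- (2 * PI / h * y)))).
  apply Rmult_le_compat; try lra.
  - left. apply Rinv_0_lt_compat. lra.
  - apply Rinv_le_contravar; lra.
Qed.

(** Here |E| >= 1 / q for the phase E, hence |1 - E| >= 1 / q - 1, whose inverse is again q / (1 -
    q), the constant of the upper edge. *)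
Lemma ker_bottom (h D x y : R) : 0 < h -> 0 < D -> y <= - D ->
  Cmod (ker h (x, y)) <= exp (- (2 * PI / h * D)) / (1 - exp (- (2 * PI / h * D))).
Proof.
  intros Hh HD Hy. pose proof PI_RGT_0 as Hpi.
  assert (Hk : 0 < 2 * PI / h) by (apply Rdiv_lt_0_compat; lra).
  assert (Hne : (1 - Ephase h (x, y))%C <> 0).
  { intros E. apply (Ephase_neq_1 h x y Hh ltac:(lra)).
    replace (Ephase h (x, y)) with (1 - (1 - Ephase h (x, y)))%C by ring. rewrite E. ring. }
  unfold ker. rewrite Cmod_inv by exact Hne.
  pose proof (Cmod_1_minus_ge (Ephase h (x, y))) as G. rewrite Cmod_Ephase in *.
  set (q := exp (- (2 * PI / h * D))) in *.
  assert (Hq : 0 < q) by apply exp_pos.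
  assert (q < 1) by (unfold q; rewrite <- exp_0; apply exp_increasing; nra).
  assert (HQ : / q <= exp (- (2 * PI / h * y))).
  { unfold q. rewrite <- exp_Ropp. destruct (Rle_lt_or_eq_dec _ _ Hy) as [L| ->]; [left; apply exp_increasing; nra|right; f_equal; ring]. }
  rewrite <- Rabs_Ropp in G.
  pose proof (Rle_abs (- (1 - exp (- (2 * PI / h * y))))).
  assert (1 < / q) by (rewrite <- Rinv_1; apply Rinv_lt_contravar; lra).
  apply Rle_trans with (/ (/ q - 1)); [apply Rinv_le_contravar; lra|].
  right. field. split; lra.
Qed.

Lemma ker_mid (h y : R) (k : Z) : 0 < h -> Cmod (ker h ((IZR k + / 2) * h, y)) <= 1.
Proof.
  intros Hh. unfold ker. rewrite Ephase_mid by exact Hh.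
  pose proof (exp_pos (- (2 * PI / h * y))).
  replace (1 - RtoC (- exp (- (2 * PI / h * y))))%C with (RtoC (1 + exp (- (2 * PI / h * y))))
    by (rewrite RtoC_plus, RtoC_opp; ring).
  rewrite Cmod_inv, Cmod_R, Rabs_right by (try lra; intros E; apply RtoC_inj in E; lra).
  rewrite <- Rinv_1. apply Rinv_le_contravar; lra.
Qed.

Lemma Ephase_mid_neq_1 (h y : R) (k : Z) : 0 < h -> Ephase h ((IZR k + / 2) * h, y) <> 1.
Proof.
  intros Hh E. rewrite Ephase_mid in E by exact Hh. apply RtoC_inj in E.
  pose proof (exp_pos (- (2 * PI / h * y))). lra.
Qed.

Lemma Hint_plus (f g : C -> C) (y a b : R) : a <= b ->
  (forall x, a <= x <= b -> Ccont f (x, y)) -> (forall x, a <= x <= b -> Ccont g (x, y)) ->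
  Hint (fun z => f z + g z)%C y a b = (Hint f y a b + Hint g y a b)%C.
Proof.
  intros Hab Hf Hg.
  refine (RInt_plus (V := C_R_CompleteNormedModule) (fun t => f (t, y)) (fun t => g (t, y)) a b _ _);
    apply ex_RInt_H; assumption.
Qed.

Lemma Hint_const (c : C) (y a b : R) : Hint (fun _ => c) y a b = (RtoC (b - a) * c)%C.
Proof.
  unfold Hint. rewrite (RInt_const (V := C_R_CompleteNormedModule)).
  unfold scal; cbn. unfold prod_scal, scal; cbn. unfold mult; cbn. unfold Cmult, RtoC; cbn [fst snd].
  f_equal; ring.
Qed.

(** The left side is 1 / (exp t - 1). This crude decay in the height suffices for pushing a
    horizontal side to infinity. *)
Lemma geom_ratio_le (t : R) : 0 < t -> exp (- t) / (1 - exp (- t)) <= / t.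
Proof.
  intros Ht. pose proof (exp_ineq1 t ltac:(lra)) as H. pose proof (exp_pos t).
  rewrite exp_Ropp.
  replace (/ exp t / (1 - / exp t)) with (/ (exp t - 1)) by (field; split; lra).
  apply Rinv_le_contravar; lra.
Qed.

(** Serves to let the height of a horizontal side tend to infinity; if z and w differed, the bound
    at the single height [Y] of the proof would already be contradictory. *)
Lemma Cmod_small_eq (z w : C) (A : R) : 0 < A -> (forall Y, A <= Y -> Cmod (z - w) <= A / Y) -> z = w.
Proof.
  intros HA H. apply NNPP. intros N. pose proof (Cdist_pos z w N) as Hp.
  set (Y := 2 * A / Cmod (z - w) + A).
  assert (0 < 2 * A / Cmod (z - w)) by (apply Rdiv_lt_0_compat; lra).
  specialize (H Y ltac:(unfold Y; lra)).
  assert (Cmod (z - w) * Y <= A).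
  { apply Rmult_le_reg_r with (/ Y); [apply Rinv_0_lt_compat; unfold Y; lra|].
    rewrite Rmult_assoc, Rinv_r, Rmult_1_r by (unfold Y; lra). exact H. }
  assert (Cmod (z - w) * Y = 2 * A + Cmod (z - w) * A) by (unfold Y; field; lra).
  nra.
Qed.

Lemma Ccont_ker (h : R) (z : C) : Ephase h z <> 1 -> Ccont (ker h) z.
Proof. intros H. destruct (Cderiv_ker h z H) as [l Hl]. exact (Cderiv_cont _ _ _ Hl). Qed.

Lemma Vint_ker_mid (h y1 y2 : R) (k l : Z) : 0 < h ->
  Vint (ker h) ((IZR k + / 2) * h) y1 y2 = Vint (ker h) ((IZR l + / 2) * h) y1 y2.
Proof.
  intros Hh. unfold Vint. apply (RInt_ext (V := C_R_CompleteNormedModule)). intros y _.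
  unfold ker. rewrite !Ephase_mid by exact Hh. reflexivity.
Qed.

(** The kernel is holomorphic on a rectangle off the real axis, and by its period [h] the two
    vertical sides cancel. *)
Lemma Hint_ker_const (h y1 y2 : R) (k l : Z) : 0 < h -> (k <= l)%Z -> y1 <= y2 -> 0 < y1 \/ y2 < 0 ->
  Hint (ker h) y1 ((IZR k + / 2) * h) ((IZR l + / 2) * h) = Hint (ker h) y2 ((IZR k + / 2) * h) ((IZR l + / 2) * h).
Proof.
  intros Hh Hkl Hy H0. apply IZR_le in Hkl.
  assert (Hx : (IZR k + / 2) * h <= (IZR l + / 2) * h) by (apply Rmult_le_compat_r; lra).
  assert (G : oint (ker h) ((IZR k + / 2) * h) ((IZR l + / 2) * h) y1 y2 = 0).
  { apply goursat; [exact Hx|exact Hy|]. intros x y _ Hy'. apply Cderiv_ker, Ephase_neq_1; [exact Hh|lra]. }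
  unfold oint in G. rewrite (Vint_ker_mid h y1 y2 k l Hh) in G.
  match type of G with (?a + ?c - ?b - ?c = _)%C => transitivity ((a + c - b - c) + b)%C; [ring|rewrite G; ring] end.
Qed.

(** By [Hint_ker_const] the side may be moved up to any height, and high up the kernel tends to 1;
    what remains is the length of the side. *)
Lemma Hint_ker_top (h D : R) (k l : Z) : 0 < h -> (k <= l)%Z -> 0 < D ->
  Hint (ker h) D ((IZR k + / 2) * h) ((IZR l + / 2) * h) = RtoC (IZR (l - k) * h).
Proof.
  intros Hh Hkl HD. pose proof PI_RGT_0 as Hpi.
  assert (Hk : 0 < 2 * PI / h) by (apply Rdiv_lt_0_compat; lra).
  set (x1 := (IZR k + / 2) * h). set (x2 := (IZR l + / 2) * h).
  pose proof (IZR_le _ _ Hkl) as Hkl'.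
  assert (Hx : x1 <= x2) by (unfold x1, x2; apply Rmult_le_compat_r; lra).
  assert (Ex : x2 - x1 = IZR (l - k) * h) by (rewrite minus_IZR; unfold x1, x2; ring).
  rewrite <- Ex.
  apply (Cmod_small_eq _ _ (D + (x2 - x1) / (2 * PI / h))).
  { assert (0 <= (x2 - x1) / (2 * PI / h)) by (apply Rmult_le_pos; [lra|left; apply Rinv_0_lt_compat, Hk]). lra. }
  assert (H0 : 0 <= (x2 - x1) / (2 * PI / h)) by (apply Rmult_le_pos; [lra|left; apply Rinv_0_lt_compat, Hk]).
  intros Y HY. unfold x1, x2. rewrite (Hint_ker_const h D Y k l) by (trivial; lra). fold x1 x2.
  assert (Hc : forall x, x1 <= x <= x2 -> Ccont (ker h) (x, Y)).
  { intros x _. apply Ccont_ker, Ephase_neq_1; lra. }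
  replace (Hint (ker h) Y x1 x2 - RtoC (x2 - x1))%C with (Hint (fun z => ker h z + - (1))%C Y x1 x2).
  2:{ rewrite Hint_plus, Hint_const; trivial; [ring|]. intros x _. exact (Cderiv_cont _ _ _ (Cderiv_const _ _)). }
  assert (HYp : 0 < Y) by lra.
  eapply Rle_trans; [apply (Cmod_Hint_le _ Y x1 x2 (/ (2 * PI / h * Y)))|].
  - exact Hx.
  - intros x Hx'. apply Ccont_plus; [apply Hc, Hx'|exact (Cderiv_cont _ _ _ (Cderiv_const _ _))].
  - intros x _. eapply Rle_trans; [apply (ker_top h Y x Y Hh HYp (Rle_refl Y))|].
    apply geom_ratio_le. apply Rmult_lt_0_compat; lra.
  - apply Rle_trans with ((x2 - x1) / (2 * PI / h) / Y); [right; field; repeat split; lra|].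
    apply Rmult_le_compat_r; [left; apply Rinv_0_lt_compat, HYp|lra].
Qed.

Lemma Hint_ker_bottom (h D : R) (k l : Z) : 0 < h -> (k <= l)%Z -> 0 < D ->
  Hint (ker h) (- D) ((IZR k + / 2) * h) ((IZR l + / 2) * h) = 0.
Proof.
  intros Hh Hkl HD. pose proof PI_RGT_0 as Hpi.
  assert (Hk : 0 < 2 * PI / h) by (apply Rdiv_lt_0_compat; lra).
  set (x1 := (IZR k + / 2) * h). set (x2 := (IZR l + / 2) * h).
  pose proof (IZR_le _ _ Hkl) as Hkl'.
  assert (Hx : x1 <= x2) by (unfold x1, x2; apply Rmult_le_compat_r; lra).
  assert (H0 : 0 <= (x2 - x1) / (2 * PI / h)) by (apply Rmult_le_pos; [lra|left; apply Rinv_0_lt_compat, Hk]).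
  apply (Cmod_small_eq _ _ (D + (x2 - x1) / (2 * PI / h))); [lra|].
  intros Y HY. unfold x1, x2. rewrite <- (Hint_ker_const h (- Y) (- D) k l) by (trivial; lra). fold x1 x2.
  assert (HYp : 0 < Y) by lra.
  match goal with |- Cmod ?e <= _ => replace e with (Hint (ker h) (- Y) x1 x2) by ring end.
  eapply Rle_trans; [apply (Cmod_Hint_le _ (- Y) x1 x2 (/ (2 * PI / h * Y)))|].
  - exact Hx.
  - intros x _. apply Ccont_ker, Ephase_neq_1; lra.
  - intros x _. eapply Rle_trans; [apply (ker_bottom h Y x (- Y) Hh HYp (Rle_refl (- Y)))|].
    apply geom_ratio_le. apply Rmult_lt_0_compat; lra.
  - apply Rle_trans with ((x2 - x1) / (2 * PI / h) / Y); [right; field; repeat split; lra|].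
    apply Rmult_le_compat_r; [left; apply Rinv_0_lt_compat, HYp|lra].
Qed.

(** The vertical sides cancel by periodicity and the lower side gives 0, so only minus the length of
    the upper side is left: 2 pi i times the residue. *)
Lemma oint_ker_cell (h D : R) (k : Z) : 0 < h -> 0 < D ->
  oint (ker h) ((IZR (k - 1) + / 2) * h) ((IZR k + / 2) * h) (- D) D = RtoC (- h).
Proof.
  intros Hh HD. unfold oint.
  rewrite (Hint_ker_bottom h D), (Hint_ker_top h D), (Vint_ker_mid h _ _ (k - 1) k) by (trivial; lia).
  replace (k - (k - 1))%Z with 1%Z by lia. rewrite Rmult_1_l, RtoC_opp. ring.
Qed.

(* Residue formula on one cell: after subtracting the value at the node, the product with the
   kernel extends continuously across the node, so only the integral of the kernel is left. *)
Lemma oint_cell (F : C -> C) (h D : R) (k : Z) : 0 < h -> 0 < D ->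
  (forall x y, Rabs y <= D -> exists l, Cderiv F (x, y) l) ->
  oint (fun z => F z * ker h z)%C ((IZR (k - 1) + / 2) * h) ((IZR k + / 2) * h) (- D) D
  = (- (RtoC h * F (RtoC (IZR k * h))))%C.
Proof.
  intros Hh HD HF. pose proof PI_RGT_0 as Hpi.
  assert (Hk : 0 < 2 * PI / h) by (apply Rdiv_lt_0_compat; lra).
  set (x1 := (IZR (k - 1) + / 2) * h). set (x2 := (IZR k + / 2) * h).
  set (c := RtoC (IZR k * h)).
  assert (E1 : x1 = IZR k * h - h / 2) by (unfold x1; rewrite minus_IZR; field).
  assert (E2 : x2 = IZR k * h + h / 2) by (unfold x2; field).
  destruct (HF (IZR k * h) 0) as [l Hl]; [rewrite Rabs_R0; lra|]. fold c in Hl.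
  assert (He : Ephase h c = 1) by (apply Ephase_node, Hh).
  assert (Hnode : forall x y, x1 <= x <= x2 -> (x, y) <> c -> Ephase h (x, y) <> 1).
  { intros x y Hx N E. apply N.
    replace ((x, y) : C) with (((x - IZR k * h)%R, y) + c)%C in E
      by (unfold c, RtoC, Cplus; cbn [fst snd]; f_equal; ring).
    rewrite Ephase_add, He, Cmult_1_r in E.
    apply Ephase_eq_1 in E; [|exact Hh|apply Rabs_le; lra]. destruct E as [Ea ->].
    unfold c, RtoC. f_equal. lra. }
  set (E' := (- (Ci * RtoC (2 * PI / h) * Ephase h c))%C).
  assert (HE' : Cderiv (fun w => 1 - Ephase h w)%C c E') by apply Cderiv_1_Ephase.
  assert (HE0 : E' <> 0).
  { unfold E'. rewrite He. intros E. apply (f_equal Cmod) in E.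
    rewrite Cmod_opp, !Cmod_mult, Cmod_Ci, Cmod_R, Cmod_1, Cmod_0, Rabs_right in E; lra. }
  (* Off the node this is (F w - F c) times the kernel; at the node it is continuous because [E'] is
     not 0. *)
  set (G := fun w => (slope F c l w * / slope (fun w => 1 - Ephase h w) c E' w)%C).
  assert (HG : forall w, w <> c -> ((F w - F c) * ker h w)%C = G w).
  { intros w N. unfold G, slope. destruct (Ceq_dec w c) as [E|_]; [contradiction|].
    rewrite He. replace (1 - Ephase h w - (1 - 1))%C with (1 - Ephase h w)%C by ring. unfold ker.
    assert (Hwc : (w - c)%C <> 0) by (intros E; apply N; replace w with ((w - c) + c)%C by ring; rewrite E; ring).
    (* At the other zeros of [1 - Ephase h w] both sides are 0, the inverse of 0 being 0. *)
    destruct (Ceq_dec (1 - Ephase h w) 0) as [Z|Z].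
    - rewrite Z. unfold Cdiv. rewrite Cmult_0_l, Cinv_0. ring.
    - field. split; assumption. }
  assert (Hyc : forall y, y = - D \/ y = D -> forall x, (x, y) <> c).
  { intros y Hy x E. unfold c, RtoC in E. injection E as _ E. lra. }
  assert (Hxc : forall x, x = x1 \/ x = x2 -> forall y, (x, y) <> c).
  { intros x Hx y E. unfold c, RtoC in E. injection E as E _. lra. }
  assert (Hbd : forall x y, on_bd x1 x2 (- D) D x y -> (x, y) <> c).
  { intros x y (_ & _ & [A|[A|[A|A]]]); [apply Hxc|apply Hxc|apply Hyc|apply Hyc]; auto. }
  assert (HGd : forall x y, x1 <= x <= x2 -> - D <= y <= D -> (x, y) <> c -> exists l, Cderiv G (x, y) l).
  { intros x y Hx Hy N. destruct (HF x y) as [l1 H1]; [apply Rabs_le; lra|].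
    destruct (Cderiv_ker h (x, y) (Hnode x y Hx N)) as [l2 H2].
    eexists. apply (Cderiv_ext_near (fun w => (F w - F c) * ker h w)%C G (x, y) _ (Cmod ((x, y) - c))).
    - apply Cdist_pos, N.
    - intros w Hw. apply HG. intros ->.
      rewrite <- Cmod_opp in Hw. replace (- (c - (x, y)))%C with ((x, y) - c)%C in Hw by ring. lra.
    - exact (Cderiv_mult _ _ _ _ _ (Cderiv_minus _ _ _ _ _ H1 (Cderiv_const (F c) _)) H2). }
  assert (HGc : Ccont G c).
  { apply Ccont_mult; [apply Ccont_slope, Hl|]. apply Ccont_inv; [apply Ccont_slope, HE'|].
    unfold slope. destruct (Ceq_dec c c) as [_|N]; [exact HE0|destruct (N eq_refl)]. }
  assert (HG0 : oint G x1 x2 (- D) D = 0).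
  { apply (goursat_punctured G (IZR k * h) 0); try lra; [|exact HGc]. intros x y Hx Hy N. exact (HGd x y Hx Hy N). }
  assert (HcG : forall x y, on_bd x1 x2 (- D) D x y -> Ccont G (x, y)).
  { intros x y B. destruct (HGd x y (proj1 B) (proj1 (proj2 B)) (Hbd x y B)) as [m Hm]. exact (Cderiv_cont _ _ _ Hm). }
  assert (Hck : forall x y, on_bd x1 x2 (- D) D x y -> Ccont (ker h) (x, y)).
  { intros x y B. apply Ccont_ker, Hnode; [apply B|apply Hbd, B]. }
  rewrite (oint_ext _ (fun w => G w + F c * ker h w)%C) by
    (try lra; intros x y B; rewrite <- HG by (apply Hbd, B); ring).
  rewrite oint_plus, oint_scal, HG0; try lra; trivial.
  - unfold x1, x2. rewrite oint_ker_cell by assumption. rewrite RtoC_opp. ring.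
  - intros x y B. apply Ccont_mult; [exact (Cderiv_cont _ _ _ (Cderiv_const _ _))|apply Hck, B].
Qed.

Fixpoint csum (g : nat -> C) (n : nat) : C :=
  match n with O => RtoC 0 | S n => (csum g n + g n)%C end.

Lemma oint_cells (F : C -> C) (h D : R) (k : Z) (n : nat) : 0 < h -> 0 < D ->
  (forall x y, Rabs y <= D -> exists l, Cderiv F (x, y) l) ->
  oint (fun z => F z * ker h z)%C ((IZR (k - 1) + / 2) * h) ((IZR (k + Z.of_nat n - 1) + / 2) * h) (- D) D
  = (- (RtoC h * csum (fun i => F (RtoC (IZR (k + Z.of_nat i) * h))) n))%C.
Proof.
  intros Hh HD HF. induction n as [|n IH].
  - cbn [csum Z.of_nat]. rewrite Z.add_0_r. unfold oint.
    unfold Hint. rewrite !(RInt_point (V := C_R_CompleteNormedModule)).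
    change (zero : C_R_CompleteNormedModule) with (RtoC 0). ring.
  - rewrite (oint_split_x _ _ ((IZR (k + Z.of_nat n - 1) + / 2) * h)).
    + rewrite IH. replace (k + Z.of_nat (S n) - 1)%Z with (k + Z.of_nat n)%Z by lia.
      rewrite oint_cell by assumption. cbn [csum]. ring.
    + apply Rmult_le_compat_r; [lra|]. apply Rplus_le_compat_r, IZR_le. lia.
    + apply Rmult_le_compat_r; [lra|]. apply Rplus_le_compat_r, IZR_le. lia.
    + intros x _. destruct (HF x (- D)) as [l Hl]; [rewrite Rabs_Ropp, Rabs_right; lra|].
      apply Ccont_mult; [exact (Cderiv_cont _ _ _ Hl)|apply Ccont_ker, Ephase_neq_1; lra].
    + intros x _. destruct (HF x D) as [l Hl]; [rewrite Rabs_right; lra|].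
      apply Ccont_mult; [exact (Cderiv_cont _ _ _ Hl)|apply Ccont_ker, Ephase_neq_1; lra].
Qed.

(** * The trapezoidal rule on a strip *)

Lemma Cmod_Hint_le_RInt (g : C -> C) (B : R -> R) (y a b T : R) : a <= b ->
  (forall x, a <= x <= b -> Ccont g (x, y)) ->
  (forall x, a <= x <= b -> Cmod (g (x, y)) <= B x) ->
  is_RInt B a b T -> Cmod (Hint g y a b) <= T.
Proof.
  intros Hab Hc HB HT. rewrite <- Cmod_norm_R.
  apply (norm_RInt_le (V := C_R_NormedModule) (fun t => g (t, y)) B a b _ T Hab).
  - intros x Hx. rewrite Cmod_norm_R. exact (HB x Hx).
  - apply (RInt_correct (V := C_R_CompleteNormedModule)), ex_RInt_H; assumption.
  - exact HT.
Qed.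

Definition nodes (F : C -> C) (h : R) (m : nat) : C :=
  csum (fun i => F (RtoC (IZR (- Z.of_nat m + Z.of_nat i) * h))) (2 * m + 1).

(** Two contours are combined: [F] times the kernel around the heights from - D to D gives the sum,
    and [F] around the upper half moves the integral up to D. There only F (ker - 1) survives, so
    both edges carry the factor q / (1 - q). The vertical sides have total length 4 D + 2 D, whence
    6 D S. *)
Lemma trapezoid_finite (F : C -> C) (B : R -> R) (h D S T : R) (m : nat) : 0 < h -> 0 < D ->
  (forall x y, Rabs y <= D -> exists l, Cderiv F (x, y) l) ->
  (forall x y, Rabs y <= D -> Cmod (F (x, y)) <= B x) ->
  let X := (INR m + / 2) * h in
  (forall y, Rabs y <= D -> Cmod (F (X, y)) <= S /\ Cmod (F (- X, y)) <= S) ->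
  is_RInt B (- X) X T ->
  let q := exp (- (2 * PI / h * D)) in
  Cmod (Hint F 0 (- X) X - RtoC h * nodes F h m) <= q / (1 - q) * (2 * T) + 6 * D * S.
Proof.
  intros Hh HD HF HB X HS HT q. pose proof PI_RGT_0 as Hpi.
  assert (Hk : 0 < 2 * PI / h) by (apply Rdiv_lt_0_compat; lra).
  pose proof (pos_INR m) as Hm.
  assert (HX : 0 < X) by (apply Rmult_lt_0_compat; lra).
  assert (Hq0 : 0 < q) by apply exp_pos.
  assert (Hq1 : q < 1) by (unfold q; rewrite <- exp_0; apply exp_increasing; nra).
  assert (Hr : 0 <= q / (1 - q)) by (apply Rmult_le_pos; [lra|left; apply Rinv_0_lt_compat; lra]).
  assert (E2 : X = (IZR (Z.of_nat m) + / 2) * h) by (unfold X; rewrite INR_IZR_INZ; reflexivity).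
  assert (E1 : - X = (IZR (- Z.of_nat m - 1) + / 2) * h).
  { rewrite minus_IZR, opp_IZR, E2. field. }
  assert (HcF : forall x y, Rabs y <= D -> Ccont F (x, y)).
  { intros x y Hy. destruct (HF x y Hy) as [l Hl]. exact (Cderiv_cont _ _ _ Hl). }
  assert (HcK : forall x y, y = D \/ y = - D \/ x = X \/ x = - X -> Ccont (ker h) (x, y)).
  { intros x y Hxy. apply Ccont_ker. destruct Hxy as [ ->|[ ->|[ ->| ->]]].
    - apply Ephase_neq_1; lra.
    - apply Ephase_neq_1; lra.
    - rewrite E2. apply Ephase_mid_neq_1, Hh.
    - rewrite E1. apply Ephase_mid_neq_1, Hh. }
  pose proof (oint_cells F h D (- Z.of_nat m) (2 * m + 1) Hh HD HF) as A.
  rewrite <- E1 in A.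
  replace (- Z.of_nat m + Z.of_nat (2 * m + 1) - 1)%Z with (Z.of_nat m) in A by lia.
  rewrite <- E2 in A. fold (nodes F h m) in A.
  assert (G : oint F (- X) X 0 D = 0).
  { apply goursat; try lra. intros x y _ Hy. apply HF. rewrite Rabs_right; lra. }
  unfold oint in A, G.
  set (FK := fun z => (F z * ker h z)%C) in *.
  set (R1 := fun z => (F z * (ker h z + - (1)))%C).
  assert (Hc1 : forall x y, y = D \/ y = - D \/ x = X \/ x = - X -> Ccont (fun z => ker h z + - (1))%C (x, y)).
  { intros x y Hxy. apply Ccont_plus; [apply HcK, Hxy|exact (Cderiv_cont _ _ _ (Cderiv_const _ _))]. }
  assert (ER : Hint FK D (- X) X = (Hint R1 D (- X) X + Hint F D (- X) X)%C).
  { rewrite <- Hint_plus.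
    - unfold Hint. apply (RInt_ext (V := C_R_CompleteNormedModule)). intros x _.
      change (FK (x, D) = (R1 (x, D) + F (x, D))%C). unfold FK, R1. ring.
    - lra.
    - intros x _. apply Ccont_mult; [apply HcF; rewrite Rabs_right; lra|apply Hc1; auto].
    - intros x _. apply HcF; rewrite Rabs_right; lra. }
  assert (B1 : Cmod (Hint R1 D (- X) X) <= q / (1 - q) * T).
  { apply (Cmod_Hint_le_RInt R1 (fun x => q / (1 - q) * B x)); [lra| | |exact (is_RInt_scal B (- X) X (q / (1 - q)) T HT)].
    - intros x _. apply Ccont_mult; [apply HcF; rewrite Rabs_right; lra|apply Hc1; auto].
    - intros x _. unfold R1. rewrite Cmod_mult, Rmult_comm.
      apply Rmult_le_compat; try apply Cmod_ge_0.
      + exact (ker_top h D x D Hh HD (Rle_refl D)).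
      + apply HB. rewrite Rabs_right; lra. }
  assert (B2 : Cmod (Hint FK (- D) (- X) X) <= q / (1 - q) * T).
  { apply (Cmod_Hint_le_RInt FK (fun x => q / (1 - q) * B x)); [lra| | |exact (is_RInt_scal B (- X) X (q / (1 - q)) T HT)].
    - intros x _. apply Ccont_mult; [apply HcF; rewrite Rabs_Ropp, Rabs_right; lra|apply HcK; auto].
    - intros x _. unfold FK. rewrite Cmod_mult, Rmult_comm.
      apply Rmult_le_compat; try apply Cmod_ge_0.
      + exact (ker_bottom h D x (- D) Hh HD (Rle_refl (- D))).
      + apply HB. rewrite Rabs_Ropp, Rabs_right; lra. }
  assert (BV : forall x, x = X \/ x = - X -> Cmod (Vint FK x (- D) D) <= (D - - D) * S).
  { intros x Hx. apply Cmod_Vint_le; [lra| |].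
    - intros y Hy. apply Ccont_mult; [apply HcF, Rabs_le; lra|apply HcK; tauto].
    - intros y Hy. unfold FK. rewrite Cmod_mult, <- (Rmult_1_r S).
      apply Rmult_le_compat; try apply Cmod_ge_0.
      + destruct (HS y) as [S1 S2]; [apply Rabs_le; lra|]. destruct Hx as [ ->| ->]; assumption.
      + destruct Hx as [ ->| ->]; [rewrite E2|rewrite E1]; apply ker_mid, Hh. }
  assert (BW : forall x, x = X \/ x = - X -> Cmod (Vint F x 0 D) <= (D - 0) * S).
  { intros x Hx. apply Cmod_Vint_le; [lra| |].
    - intros y Hy. apply HcF, Rabs_le; lra.
    - intros y Hy. destruct (HS y) as [S1 S2]; [apply Rabs_le; lra|]. destruct Hx as [ ->| ->]; assumption. }
  pose proof (BV X (or_introl eq_refl)) as V1. pose proof (BV (- X) (or_intror eq_refl)) as V2.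
  pose proof (BW X (or_introl eq_refl)) as W1. pose proof (BW (- X) (or_intror eq_refl)) as W2.
  rewrite ER in A.
  set (H0 := Hint F 0 (- X) X) in *.
  assert (EQ : (H0 - RtoC h * nodes F h m)%C =
     (Hint FK (- D) (- X) X + - Hint R1 D (- X) X
      + (Ci * Vint FK X (- D) D + - (Ci * Vint FK (- X) (- D) D))
      + (- (Ci * Vint F X 0 D) + Ci * Vint F (- X) 0 D))%C).
  { replace (H0 - RtoC h * nodes F h m)%C with (H0 + - (RtoC h * nodes F h m))%C by ring.
    rewrite <- A.
    match type of G with ?e = _ => replace (Hint F D (- X) X) with (Hint F D (- X) X + e)%C by (rewrite G; ring) end.
    ring. }
  rewrite EQ.
  assert (T2 : forall a b c e u v : C, Cmod (a + - b + (Ci * c + - (Ci * e)) + (- (Ci * u) + Ci * v)) <=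
     Cmod a + Cmod b + (Cmod c + Cmod e) + (Cmod u + Cmod v)).
  { intros a b c e u v.
    eapply Rle_trans; [apply Cmod_triangle|]. apply Rplus_le_compat.
    - eapply Rle_trans; [apply Cmod_triangle|]. apply Rplus_le_compat.
      + eapply Rle_trans; [apply Cmod_triangle|]. rewrite Cmod_opp. lra.
      + eapply Rle_trans; [apply Cmod_triangle|]. rewrite Cmod_opp, !Cmod_mult, Cmod_Ci. lra.
    - eapply Rle_trans; [apply Cmod_triangle|]. rewrite Cmod_opp, !Cmod_mult, Cmod_Ci. lra. }
  eapply Rle_trans; [apply T2|]. lra.
Qed.

(* [b] is the decay rate: the primitive of [PI / 2 * cosh x * exp (- (b * (PI / 2)) * sinh x)] is
   [- exp (- (b * (PI / 2)) * sinh x) / b]. *)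
Definition de_bound (A b x : R) : R := A * (PI / 2 * cosh x * exp (- (b * (PI / 2)) * sinh x)).

Lemma is_derive_sinh (x : R) : is_derive sinh x (cosh x).
Proof. apply is_derive_Reals, derivable_pt_lim_sinh. Qed.

Lemma continuous_de_bound (A b x : R) : continuous (de_bound A b) x.
Proof.
  apply (ex_derive_continuous (K := R_AbsRing) (V := R_NormedModule)). unfold de_bound.
  auto_derive. trivial.
Qed.

Lemma is_RInt_de_bound (A b u v : R) : 0 < b ->
  is_RInt (de_bound A b) u v
    (A / b * (exp (- (b * (PI / 2)) * sinh u) - exp (- (b * (PI / 2)) * sinh v))).
Proof.
  intros Hb.
  replace (A / b * (exp (- (b * (PI / 2)) * sinh u) - exp (- (b * (PI / 2)) * sinh v)))
    with (minus (- (A / b) * exp (- (b * (PI / 2)) * sinh v)) (- (A / b) * exp (- (b * (PI / 2)) * sinh u)))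
    by (unfold minus, plus, opp; cbn; ring).
  apply (is_RInt_derive (fun x => - (A / b) * exp (- (b * (PI / 2)) * sinh x))).
  - intros x _. unfold de_bound. auto_derive.
    + trivial.
    + field. lra.
  - intros x _. apply continuous_de_bound.
Qed.

(** Letting [m] tend to infinity keeps the rate, and the later error estimates use the rate besides
    the existence of the limit. *)
Lemma real_cauchy_rate (u : nat -> R) (A : R) :
  (forall n m, (1 <= n)%nat -> (n <= m)%nat -> Rabs (u m - u n) <= A / INR n) ->
  exists l, forall n, (1 <= n)%nat -> Rabs (u n - l) <= A / INR n.
Proof.
  intros H.
  assert (HA : 0 <= A).
  { specialize (H 1%nat 1%nat (le_n _) (le_n _)). rewrite Rminus_diag, Rabs_R0 in H. simpl in H. lra. }
  destruct (Rcomplete.R_complete u) as [l Hl].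
  - intros eps He.
    destruct (archimed_cor1 (eps / (2 * A + 1))) as (N & HN & HN0); [apply Rdiv_lt_0_compat; lra|].
    exists N. intros n m Hn Hm. unfold Rdist.
    assert (HNp : 0 < / INR N) by (apply Rinv_0_lt_compat, lt_0_INR, HN0).
    assert (B : 2 * (A / INR N) < eps).
    { apply Rle_lt_trans with ((2 * A + 1) * / INR N); [unfold Rdiv; nra|].
      replace eps with ((2 * A + 1) * (eps / (2 * A + 1))) by (field; lra).
      apply Rmult_lt_compat_l; lra. }
    pose proof (H N n HN0 Hn) as H1. pose proof (H N m HN0 Hm) as H2.
    apply Rabs_le_between in H1. apply Rabs_le_between in H2. apply Rabs_lt_between. lra.
  - exists l. intros n Hn. apply Rle_plus_epsilon. intros eps He.
    destruct (Hl eps He) as [N HN].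
    specialize (HN (N + n)%nat ltac:(lia)). specialize (H n (N + n)%nat Hn ltac:(lia)).
    unfold Rdist in HN. apply Rabs_lt_between in HN. apply Rabs_le_between in H. apply Rabs_le_between. lra.
Qed.

(** The factor 2 is the price of treating real and imaginary parts separately. *)
Lemma C_cauchy_rate (u : nat -> C) (A : R) :
  (forall n m, (1 <= n)%nat -> (n <= m)%nat -> Cmod (u m - u n) <= A / INR n) ->
  exists l, forall n, (1 <= n)%nat -> Cmod (u n - l) <= 2 * A / INR n.
Proof.
  intros H.
  destruct (real_cauchy_rate (fun n => Re (u n)) A) as [a Ha].
  { intros n m Hn Hm. eapply Rle_trans; [|exact (H n m Hn Hm)]. exact (Re_le_Cmod (u m - u n)). }
  destruct (real_cauchy_rate (fun n => Im (u n)) A) as [b Hb].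
  { intros n m Hn Hm. eapply Rle_trans; [|exact (H n m Hn Hm)]. exact (Im_le_Cmod (u m - u n)). }
  exists (a, b). intros n Hn. eapply Rle_trans; [apply Cmod_le_abs|].
  replace (2 * A / INR n) with (A / INR n + A / INR n) by (unfold Rdiv; ring).
  apply Rplus_le_compat; [exact (Ha n Hn)|exact (Hb n Hn)].
Qed.

Lemma cosh_ge_1 (x : R) : 1 <= cosh x.
Proof.
  unfold cosh. pose proof (exp_pos x). pose proof (exp_pos (- x)).
  assert (exp x * exp (- x) = 1) by (rewrite <- exp_plus, Rplus_opp_r; apply exp_0).
  pose proof (pow2_ge_0 (exp x - exp (- x))).
  destruct (Rle_lt_dec 2 (exp x + exp (- x))); [lra|nra].
Qed.

Lemma sinh_ge_id (x : R) : 0 <= x -> x <= sinh x.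
Proof.
  intros Hx. destruct (Rle_lt_or_eq_dec _ _ Hx) as [L|<-]; [|rewrite sinh_0; lra].
  destruct (MVT_gen sinh 0 x cosh) as (c & Hc & E).
  - intros t _. apply is_derive_sinh.
  - intros t _. apply continuity_pt_filterlim, (ex_derive_continuous (K := R_AbsRing) (V := R_NormedModule)).
    eexists; apply is_derive_sinh.
  - rewrite sinh_0 in E. pose proof (cosh_ge_1 c). nra.
Qed.

Lemma cosh_le_1_sinh (x : R) : 0 <= x -> cosh x <= 1 + sinh x.
Proof.
  intros Hx. unfold cosh, sinh.
  assert (exp (- x) <= 1).
  { rewrite <- exp_0. destruct (Rle_lt_or_eq_dec _ _ Hx) as [L|<-]; [left; apply exp_increasing; lra|rewrite Ropp_0; lra]. }
  lra.
Qed.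

Lemma cosh_pos (x : R) : 0 < cosh x.
Proof. unfold cosh. pose proof (exp_pos x). pose proof (exp_pos (- x)). lra. Qed.

Lemma exp_neg_le_inv (t : R) : 0 < t -> exp (- t) <= / t.
Proof.
  intros Ht. rewrite exp_Ropp. apply Rinv_le_contravar; [exact Ht|].
  pose proof (exp_ineq1 t ltac:(lra)). lra.
Qed.

(** Decay like 1 / X is enough to make the vertical sides vanish. With s = sinh X >= X, exp (- c s)
    <= (1 + c s / 2)^(-2) beats cosh X <= 1 + s; in the constant, 4 / c^2 pays for s^2 and 1 / c for
    s. *)
Lemma de_bound_le_inv (A b X : R) : 0 <= A -> 0 < b -> 0 < X ->
  de_bound A b X <= A * (PI / 2) * (4 / (b * (PI / 2)) ^ 2 + / (b * (PI / 2))) / X.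
Proof.
  intros HA Hb HX. pose proof PI_RGT_0 as Hpi. unfold de_bound.
  set (c := b * (PI / 2)). assert (Hc : 0 < c) by (unfold c; apply Rmult_lt_0_compat; lra).
  pose proof (sinh_ge_id X ltac:(lra)) as Hs. pose proof (cosh_le_1_sinh X ltac:(lra)) as Hch.
  set (s := sinh X) in *. pose proof (cosh_pos X) as Hcp.
  assert (Hcs : 0 < c * s) by (apply Rmult_lt_0_compat; lra).
  assert (He : exp (- c * s) <= / ((1 + c * s / 2) * (1 + c * s / 2))).
  { replace (- c * s) with (- (c * s / 2) + - (c * s / 2)) by field. rewrite exp_plus, exp_Ropp, <- Rinv_mult.
    pose proof (exp_ineq1 (c * s / 2) ltac:(lra)).
    apply Rinv_le_contravar; [apply Rmult_lt_0_compat; lra|apply Rmult_le_compat; lra]. }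
  assert (H1 : cosh X * exp (- c * s) <= (4 / c ^ 2 + / c) / X).
  { apply Rle_trans with ((1 + s) * / ((1 + c * s / 2) * (1 + c * s / 2))).
    { apply Rmult_le_compat; try lra. left; apply exp_pos. }
    assert (Hd : 0 < (1 + c * s / 2) * (1 + c * s / 2)) by (apply Rmult_lt_0_compat; lra).
    apply Rmult_le_reg_r with (1 := Hd). rewrite Rmult_assoc, Rinv_l, Rmult_1_r by lra.
    apply Rmult_le_reg_r with (1 := HX).
    replace ((4 / c ^ 2 + / c) / X * ((1 + c * s / 2) * (1 + c * s / 2)) * X)
      with ((4 / c ^ 2 + / c) * (1 + c * s) + s * s + c * s * s / 4) by (field; lra).
    assert (0 < 4 / c ^ 2) by (apply Rdiv_lt_0_compat; [lra|apply pow_lt, Hc]).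
    assert (0 < / c) by (apply Rinv_0_lt_compat, Hc).
    assert (E : / c * (c * s) = s) by (field; lra).
    assert (0 < c * s * s) by (apply Rmult_lt_0_compat; lra).
    assert ((1 + s) * X <= (1 + s) * s) by (apply Rmult_le_compat_l; lra).
    assert (0 < 4 / c ^ 2 * (1 + c * s)) by (apply Rmult_lt_0_compat; lra).
    lra. }
  replace (A * (PI / 2 * cosh X * exp (- c * s))) with (A * (PI / 2) * (cosh X * exp (- c * s))) by ring.
  replace (A * (PI / 2) * (4 / c ^ 2 + / c) / X) with (A * (PI / 2) * ((4 / c ^ 2 + / c) / X)) by (unfold Rdiv; ring).
  apply Rmult_le_compat_l; [|exact H1]. apply Rmult_le_pos; lra.
Qed.

Lemma de_bound_opp_RInt (A b u v : R) : 0 < b ->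
  is_RInt (fun x => de_bound A b (- x)) (- v) (- u)
    (A / b * (exp (- (b * (PI / 2)) * sinh u) - exp (- (b * (PI / 2)) * sinh v))).
Proof.
  intros Hb. pose proof (is_RInt_de_bound A b v u Hb) as H.
  rewrite <- (Ropp_involutive v), <- (Ropp_involutive u) in H.
  apply is_RInt_comp_opp, is_RInt_opp in H.
  rewrite !Ropp_involutive in H.
  eapply is_RInt_ext; [|replace (A / b * (exp (- (b * (PI / 2)) * sinh u) - exp (- (b * (PI / 2)) * sinh v))) with
    (opp (A / b * (exp (- (b * (PI / 2)) * sinh v) - exp (- (b * (PI / 2)) * sinh u)))); [exact H|]].
  - intros x _. unfold opp; cbn. ring.
  - unfold opp; cbn. ring.
Qed.

Lemma de_bound_tail_le (A b u v : R) : 0 <= A -> 0 < b -> 0 < u ->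
  A / b * (exp (- (b * (PI / 2)) * sinh u) - exp (- (b * (PI / 2)) * sinh v)) <= A / b * / (b * (PI / 2)) / u.
Proof.
  intros HA Hb Hu. pose proof PI_RGT_0 as Hpi.
  set (c := b * (PI / 2)). assert (Hc : 0 < c) by (unfold c; apply Rmult_lt_0_compat; lra).
  assert (HAb : 0 <= A / b) by (apply Rmult_le_pos; [lra|left; apply Rinv_0_lt_compat, Hb]).
  pose proof (sinh_ge_id u ltac:(lra)) as Hs. pose proof (exp_pos (- c * sinh v)).
  assert (Hcu : 0 < c * u) by (apply Rmult_lt_0_compat; lra).
  assert (exp (- c * sinh u) <= / (c * u)).
  { rewrite Ropp_mult_distr_l_reverse. eapply Rle_trans; [apply exp_neg_le_inv; nra|].
    apply Rinv_le_contravar; [exact Hcu|apply Rmult_le_compat_l; lra]. }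
  replace (A / b * / c / u) with (A / b * / (c * u)) by (field; lra).
  apply Rmult_le_compat_l; lra.
Qed.

(** * The trapezoidal sum over the whole line, with separate bounds on the left and on the right *)

Section Trapezoid.
Variables (F : C -> C) (d h Al bl Ar br : R).
Hypotheses (Hd : 0 < d) (Hh : 0 < h) (HAl : 0 <= Al) (HAr : 0 <= Ar) (Hbl : 0 < bl) (Hbr : 0 < br).
Hypothesis HF : forall x y, Rabs y < d -> exists l, Cderiv F (x, y) l.
Hypothesis HR : forall x y, Rabs y < d -> 0 <= x -> Cmod (F (x, y)) <= de_bound Ar br x.
Hypothesis HL : forall x y, Rabs y < d -> x < 0 -> Cmod (F (x, y)) <= de_bound Al bl (- x).

(** Integral of the majorant over the whole line, one quotient from each half line. *)
Let T := Al / bl + Ar / br.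

Lemma strip_cont (x y : R) : Rabs y < d -> Ccont F (x, y).
Proof. intros Hy. destruct (HF x y Hy) as [l Hl]. exact (Cderiv_cont _ _ _ Hl). Qed.

Lemma real_cont (x : R) : Ccont F (x, 0).
Proof. apply strip_cont. rewrite Rabs_R0. exact Hd. Qed.

Lemma Hint_right_le (a b : R) : 0 <= a -> a <= b ->
  Cmod (Hint F 0 a b) <= Ar / br * (exp (- (br * (PI / 2)) * sinh a) - exp (- (br * (PI / 2)) * sinh b)).
Proof.
  intros Ha Hab. apply (Cmod_Hint_le_RInt F (de_bound Ar br)); trivial.
  - intros; apply real_cont.
  - intros x Hx. apply HR; [rewrite Rabs_R0; exact Hd|lra].
  - apply is_RInt_de_bound, Hbr.
Qed.

Lemma Hint_left_le (a b : R) : 0 < a -> a <= b ->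
  Cmod (Hint F 0 (- b) (- a)) <= Al / bl * (exp (- (bl * (PI / 2)) * sinh a) - exp (- (bl * (PI / 2)) * sinh b)).
Proof.
  intros Ha Hab. apply (Cmod_Hint_le_RInt F (fun x => de_bound Al bl (- x))); [lra| | |].
  - intros; apply real_cont.
  - intros x Hx. apply HL; [rewrite Rabs_R0; exact Hd|lra].
  - apply de_bound_opp_RInt, Hbl.
Qed.

(** Numerator of the 1 / n bound that [de_bound_tail_le] gives for the two tails together. *)
Let tail := Al / bl * / (bl * (PI / 2)) + Ar / br * / (br * (PI / 2)).

Lemma tail_pos : 0 <= tail.
Proof.
  pose proof PI_RGT_0 as Hpi.
  apply Rplus_le_le_0_compat; repeat apply Rmult_le_pos; try lra; left; apply Rinv_0_lt_compat; trivial;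
    apply Rmult_lt_0_compat; lra.
Qed.

Lemma Hint_tail_le (n a b : R) : 0 < n -> n <= a -> n <= b ->
  Cmod (Hint F 0 (- a) b - Hint F 0 (- n) n) <= tail / n.
Proof.
  intros Hn Ha Hb.
  rewrite (Hint_Chasles F 0 (- a) (- n) b), (Hint_Chasles F 0 (- n) n b) by (try lra; intros; apply real_cont).
  match goal with |- Cmod ?e <= _ => replace e with (Hint F 0 (- a) (- n) + Hint F 0 n b)%C by ring end.
  eapply Rle_trans; [apply Cmod_triangle|]. unfold tail, Rdiv at 1. rewrite Rmult_plus_distr_r.
  apply Rplus_le_compat.
  - eapply Rle_trans; [apply Hint_left_le; assumption|]. apply de_bound_tail_le; assumption.
  - eapply Rle_trans; [apply Hint_right_le; lra|]. apply de_bound_tail_le; assumption.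
Qed.

(** The endpoints vary independently because the improper integral is a limit along a product of two
    filters. In the constant 3, one unit is the passage from [- n, n] to [- a, b], two come from
    [C_cauchy_rate]. *)
Lemma trapezoid_integral : exists I : C,
  forall n : nat, (1 <= n)%nat -> forall a b, INR n <= a -> INR n <= b ->
    Cmod (Hint F 0 (- a) b - I) <= 3 * tail / INR n.
Proof.
  destruct (C_cauchy_rate (fun n => Hint F 0 (- INR n) (INR n)) tail) as [I HI].
  - intros n m Hn Hm. apply Hint_tail_le; [apply lt_0_INR; lia|apply le_INR, Hm|apply le_INR, Hm].
  - exists I. intros n Hn a b Ha Hb.
    pose proof (Hint_tail_le (INR n) a b ltac:(apply lt_0_INR; lia) Ha Hb) as H1.
    pose proof (HI n Hn) as H2. cbn beta in H2.
    replace (Hint F 0 (- a) b - I)%C with ((Hint F 0 (- a) b - Hint F 0 (- INR n) (INR n)) + (Hint F 0 (- INR n) (INR n) - I))%C by ring.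
    eapply Rle_trans; [apply Cmod_triangle|].
    replace (3 * tail / INR n) with (tail / INR n + 2 * tail / INR n) by (unfold Rdiv; ring).
    apply Rplus_le_compat; assumption.
Qed.

Definition two_sided_bound (x : R) : R :=
  if Rlt_dec x 0 then de_bound Al bl (- x) else de_bound Ar br x.

Lemma two_sided_bound_spec (x y : R) : Rabs y < d -> Cmod (F (x, y)) <= two_sided_bound x.
Proof.
  intros Hy. unfold two_sided_bound. destruct (Rlt_dec x 0) as [L|L]; [apply HL|apply HR]; trivial. lra.
Qed.

Lemma two_sided_bound_RInt (X : R) : 0 < X ->
  exists T', is_RInt two_sided_bound (- X) X T' /\ T' <= T.
Proof.
  intros HX.
  pose proof (de_bound_opp_RInt Al bl 0 X Hbl) as H1. pose proof (is_RInt_de_bound Ar br 0 X Hbr) as H2.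
  rewrite Ropp_0 in H1. rewrite sinh_0, !Rmult_0_r, !exp_0 in *.
  eexists. split.
  - apply (is_RInt_Chasles _ (- X) 0 X); (eapply is_RInt_ext; [|eassumption]);
      intros x; rewrite ?Rmin_left, ?Rmax_right by lra; intros Hx; unfold two_sided_bound;
      destruct (Rlt_dec x 0); trivial; lra.
  - unfold plus; cbn. unfold T.
    assert (0 <= Al / bl) by (apply Rmult_le_pos; [lra|left; apply Rinv_0_lt_compat, Hbl]).
    assert (0 <= Ar / br) by (apply Rmult_le_pos; [lra|left; apply Rinv_0_lt_compat, Hbr]).
    pose proof (exp_pos (- (bl * (PI / 2)) * sinh X)). pose proof (exp_pos (- (br * (PI / 2)) * sinh X)).
    nra.
Qed.

Lemma side_decay : exists S0, 0 <= S0 /\ forall X y, 0 < X -> Rabs y < d ->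
  Cmod (F (X, y)) <= S0 / X /\ Cmod (F (- X, y)) <= S0 / X.
Proof.
  pose proof PI_RGT_0 as Hpi.
  set (G := fun A b => A * (PI / 2) * (4 / (b * (PI / 2)) ^ 2 + / (b * (PI / 2)))).
  assert (HG : forall A b, 0 <= A -> 0 < b -> 0 <= G A b).
  { intros A b HA Hb. assert (0 < b * (PI / 2)) by (apply Rmult_lt_0_compat; lra).
    apply Rmult_le_pos; [apply Rmult_le_pos; lra|].
    apply Rplus_le_le_0_compat; [|left; apply Rinv_0_lt_compat; assumption].
    apply Rmult_le_pos; [lra|left; apply Rinv_0_lt_compat, pow_lt; assumption]. }
  pose proof (HG Al bl HAl Hbl) as G1. pose proof (HG Ar br HAr Hbr) as G2.
  exists (G Al bl + G Ar br). split; [lra|]. intros X y HX Hy.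
  assert (HiX : 0 < / X) by (apply Rinv_0_lt_compat, HX).
  split.
  - eapply Rle_trans; [apply HR; [exact Hy|lra]|].
    eapply Rle_trans; [apply de_bound_le_inv; assumption|]. fold (G Ar br). unfold Rdiv. nra.
  - eapply Rle_trans; [apply HL; [exact Hy|lra]|]. rewrite Ropp_involutive.
    eapply Rle_trans; [apply de_bound_le_inv; assumption|]. fold (G Al bl). unfold Rdiv. nra.
Qed.

(** The additive [eps] stands in for the convergence of the infinite sum: one half covers the
    approach of D to d, the other the vertical sides and the truncated integral. *)
Lemma trapezoid (I : C) :
  (forall n : nat, (1 <= n)%nat -> forall a b, INR n <= a -> INR n <= b ->
    Cmod (Hint F 0 (- a) b - I) <= 3 * tail / INR n) ->
  let q := exp (- (2 * PI / h * d)) in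
  forall eps, 0 < eps -> exists m0, forall m, (m0 <= m)%nat ->
    Cmod (I - RtoC h * nodes F h m) <= q / (1 - q) * (2 * T) + eps.
Proof.
  intros HI q eps He. pose proof PI_RGT_0 as Hpi.
  assert (Hk : 0 < 2 * PI / h) by (apply Rdiv_lt_0_compat; lra).
  assert (HT : 0 <= T).
  { apply Rplus_le_le_0_compat; apply Rmult_le_pos; trivial; left; apply Rinv_0_lt_compat; assumption. }
  (* The finite estimate needs a closed strip inside the open one; the edge factor is continuous in
     the height, so some D < d loses at most [eps / 2]. *)
  assert (exists D, 0 < D /\ D < d /\ exp (- (2 * PI / h * D)) / (1 - exp (- (2 * PI / h * D))) * (2 * T)
            <= q / (1 - q) * (2 * T) + eps / 2) as (D & HD & HDd & HDq).
  { assert (Hc : continuous (fun D => exp (- (2 * PI / h * D)) / (1 - exp (- (2 * PI / h * D))) * (2 * T)) d).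
    { apply (ex_derive_continuous (K := R_AbsRing) (V := R_NormedModule)). auto_derive.
      assert (exp (- (2 * PI / h * d)) < 1) by (rewrite <- exp_0; apply exp_increasing; nra).
      unfold Rdiv in *. lra. }
    destruct (proj1 (filterlim_locally (F := locally d) _ _) Hc (mkposreal (eps / 2) ltac:(lra))) as [del Hdel].
    pose proof (cond_pos del) as Hdp.
    exists (d - Rmin (del / 2) (d / 2)).
    pose proof (Rmin_l (del / 2) (d / 2)). pose proof (Rmin_r (del / 2) (d / 2)).
    assert (0 < Rmin (del / 2) (d / 2)) by (apply Rmin_glb_lt; lra).
    split; [lra|]. split; [lra|].
    specialize (Hdel (d - Rmin (del / 2) (d / 2))).
    assert (E : ball (d : R_UniformSpace) del (d - Rmin (del / 2) (d / 2))).
    { change (Rabs (d - Rmin (del / 2) (d / 2) - d) < del). apply Rabs_lt_between. lra. }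
    specialize (Hdel E).
    match type of Hdel with ball ?u _ ?v => change (Rabs (v - u) < eps / 2) in Hdel end.
    apply Rabs_lt_between in Hdel. unfold q. lra. }
  destruct side_decay as (S0 & HS0 & HS).
  set (W := 3 * tail + 6 * D * S0 / h + 1).
  assert (HW0 : 0 <= 6 * D * S0 / h).
  { apply Rmult_le_pos; [|left; apply Rinv_0_lt_compat, Hh]. apply Rmult_le_pos; lra. }
  pose proof tail_pos as Htp.
  destruct (archimed_cor1 (eps / (2 * W))) as (N & HN & HN0); [apply Rdiv_lt_0_compat; unfold W; lra|].
  assert (HNp : 0 < INR N) by (apply lt_0_INR, HN0).
  assert (HNe : W / INR N <= eps / 2).
  { apply Rle_trans with (W * (eps / (2 * W))); [apply Rmult_le_compat_l; unfold W in *; lra|right; field; unfold W; lra]. }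
  (* Makes the half width X at least N, for the integral, and at least N h, for the vertical
     sides. *)
  destruct (INR_unbounded (INR N / h + INR N)) as [m0 Hm0].
  exists m0. intros m Hm. apply le_INR in Hm.
  set (X := (INR m + / 2) * h).
  assert (HiN : 0 <= INR N / h) by (apply Rmult_le_pos; [lra|left; apply Rinv_0_lt_compat, Hh]).
  assert (HXN : INR N <= X).
  { unfold X. replace (INR N) with (INR N / h * h) by (field; lra). apply Rmult_le_compat_r; lra. }
  assert (HXh : INR N * h <= X) by (unfold X; apply Rmult_le_compat_r; lra).
  destruct (two_sided_bound_RInt X ltac:(lra)) as (T' & HT1 & HT2).
  pose proof (trapezoid_finite F two_sided_bound h D (S0 / X) T' m Hh HD
    (fun x y Hy => HF x y (Rle_lt_trans _ _ _ Hy HDd))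
    (fun x y Hy => two_sided_bound_spec x y (Rle_lt_trans _ _ _ Hy HDd))
    (fun y Hy => HS X y ltac:(lra) (Rle_lt_trans _ _ _ Hy HDd)) HT1) as HQ.
  cbv zeta in HQ. fold X in HQ.
  pose proof (HI N HN0 X X HXN HXN) as HIN.
  replace (I - RtoC h * nodes F h m)%C with (- (Hint F 0 (- X) X - I) + (Hint F 0 (- X) X - RtoC h * nodes F h m))%C by ring.
  eapply Rle_trans; [apply Cmod_triangle|]. rewrite Cmod_opp.
  set (qD := exp (- (2 * PI / h * D))) in *.
  assert (HqD1 : qD < 1) by (unfold qD; rewrite <- exp_0; apply exp_increasing; nra).
  assert (HqD : 0 <= qD / (1 - qD)) by (apply Rmult_le_pos; [left; apply exp_pos|left; apply Rinv_0_lt_compat; lra]).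
  assert (HqT : qD / (1 - qD) * (2 * T') <= qD / (1 - qD) * (2 * T)) by (apply Rmult_le_compat_l; lra).
  assert (Hside : 6 * D * (S0 / X) <= 6 * D * S0 / h / INR N).
  { replace (6 * D * S0 / h / INR N) with (6 * D * (S0 / (INR N * h))) by (field; lra).
    apply Rmult_le_compat_l; [lra|]. apply Rmult_le_compat_l; [lra|].
    apply Rinv_le_contravar; [apply Rmult_lt_0_compat; lra|exact HXh]. }
  assert (HWN : 3 * tail / INR N + 6 * D * S0 / h / INR N <= W / INR N).
  { unfold W, Rdiv. rewrite !Rmult_plus_distr_r. assert (0 < / INR N) by (apply Rinv_0_lt_compat, HNp). lra. }
  lra.
Qed.
End Trapezoid.

(** * Estimates for the double exponential map *)

(** From cosh a = 1 + 2 sinh (a / 2)^2 and |sinh t| >= |t|. *)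
Lemma cosh_ge_quadratic (a : R) : 1 + a ^ 2 / 2 <= cosh a.
Proof.
  assert (E : cosh a = 1 + 2 * (sinh (a / 2)) ^ 2).
  { unfold cosh, sinh. pose proof (exp_pos (a / 2)).
    assert (E1 : exp a = exp (a / 2) * exp (a / 2)) by (rewrite <- exp_plus; f_equal; field).
    assert (E2 : exp (- a) = exp (- (a / 2)) * exp (- (a / 2))) by (rewrite <- exp_plus; f_equal; field).
    assert (E3 : exp (a / 2) * exp (- (a / 2)) = 1) by (rewrite <- exp_plus, Rplus_opp_r; apply exp_0).
    rewrite E1, E2. set (u := exp (a / 2)) in *. set (v := exp (- (a / 2))) in *.
    replace (1 + 2 * ((u - v) / 2) ^ 2) with ((u * u + v * v) / 2 + (1 - u * v)) by field.
    rewrite E3. ring. }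
  rewrite E. assert ((a / 2) ^ 2 <= sinh (a / 2) ^ 2).
  { destruct (Rle_dec 0 a) as [L|L].
    - apply pow_incr. split; [lra|apply sinh_ge_id; lra].
    - pose proof (sinh_ge_id (- (a / 2)) ltac:(lra)) as H.
      assert (O : sinh (- (a / 2)) = - sinh (a / 2)) by (unfold sinh; rewrite Ropp_involutive; field).
      rewrite O in H. replace ((a / 2) ^ 2) with ((- (a / 2)) ^ 2) by ring.
      replace (sinh (a / 2) ^ 2) with ((- sinh (a / 2)) ^ 2) by ring.
      apply pow_incr. lra. }
  lra.
Qed.

Lemma PI_bounds : 3 < PI <= 4.
Proof. pose proof PI2_3_2. pose proof PI_4. lra. Qed.

(** The factor pi/2 + b is chosen to meet pi/2 - b in [sin_dilate_le], where (pi/2)^2 - b^2 occurs.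
    Up to 1 the cubic Taylor bound gives sin t >= 5 t / 6; beyond 1 monotonicity leaves sin b >=
    5/6. *)
Lemma sin_jordan (b : R) : 0 <= b -> b <= PI / 2 -> b <= (PI / 2 + b) * sin b.
Proof.
  intros H0 H1. destruct PI_bounds as [P3 P4].
  assert (HL : forall t, 0 <= t -> t <= 1 -> 5 / 6 * t <= sin t).
  { intros t Ht0 Ht1. destruct (pre_sin_bound t 0 Ht0 ltac:(lra)) as [L _].
    unfold sin_approx, sin_term in L. cbn in L.
    assert (t * t * t <= t) by nra. lra. }
  destruct (Rle_dec b 1) as [L|L].
  - specialize (HL b H0 L). nra.
  - assert (5 / 6 <= sin b).
    { apply Rle_trans with (sin 1); [specialize (HL 1); lra|]. left. apply sin_increasing_1; lra. }
    nra.
Qed.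

Lemma Rabs_sin_le (t : R) : 0 <= t -> Rabs (sin t) <= t.
Proof.
  intros Ht. pose proof (SIN_bound t). destruct PI_bounds as [P3 P4]. apply Rabs_le. split.
  - destruct (Rle_dec t 1); [|lra]. pose proof (sin_ge_0 t Ht ltac:(lra)). lra.
  - destruct (Rle_lt_or_eq_dec _ _ Ht) as [L|<-]; [left; apply sin_lt_x, L|rewrite sin_0; lra].
Qed.

(* With [k = PI / 2] and [m = c - 1]: [|sin (b + m b)| <= sin b + m b cos b], and
   [b cos b <= (k - b) b <= (k - b) (k + b) sin b]. *)
Lemma sin_dilate_le (a b c : R) : Rabs b <= PI / 2 -> 1 <= c ->
  a ^ 2 = (c ^ 2 - 1) * ((PI / 2) ^ 2 - b ^ 2) ->
  sin (c * b) ^ 2 <= sin b ^ 2 * cosh a ^ 2.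
Proof.
  intros Hb Hc Ha.
  assert (Hpos : forall b, 0 <= b -> b <= PI / 2 -> a ^ 2 = (c ^ 2 - 1) * ((PI / 2) ^ 2 - b ^ 2) ->
     sin (c * b) ^ 2 <= sin b ^ 2 * cosh a ^ 2).
  { clear b Hb Ha. intros b H0 H1 Ha. destruct PI_bounds as [P3 P4].
    pose proof (sin_jordan b H0 H1) as J. pose proof (cosh_ge_quadratic a) as Q. rewrite Ha in Q.
    assert (Hs : 0 <= sin b) by (apply sin_ge_0; lra).
    assert (Hco : 0 <= cos b) by (apply cos_ge_0; lra).
    assert (Hcs : cos b <= PI / 2 - b).
    { rewrite <- sin_shift. eapply Rle_trans; [apply Rle_abs|apply Rabs_sin_le; lra]. }
    set (m := c - 1). assert (Hm : 0 <= m) by (unfold m; lra).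
    assert (Hmb : 0 <= m * b) by (apply Rmult_le_pos; lra).
    pose proof (Rabs_sin_le (m * b) Hmb) as Hsm. pose proof (COS_bound (m * b)) as Hcm.
    replace (c * b) with (b + m * b) by (unfold m; ring). rewrite sin_plus.
    apply Rabs_le_between in Hsm.
    assert (U : Rabs (sin b * cos (m * b) + cos b * sin (m * b)) <= sin b + cos b * (m * b)).
    { apply Rabs_le. split; nra. }
    assert (H2 : cos b * b <= ((PI / 2) ^ 2 - b ^ 2) * sin b).
    { apply Rle_trans with ((PI / 2 - b) * b); [apply Rmult_le_compat_r; lra|].
      replace (((PI / 2) ^ 2 - b ^ 2) * sin b) with ((PI / 2 - b) * ((PI / 2 + b) * sin b)) by ring.
      apply Rmult_le_compat_l; lra. }
    (* Here (c^2 - 1) / 2 = m + m^2 / 2; the first term is [H2] times m, the second a nonnegative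
       surplus. *)
    assert (H3 : cos b * (m * b) <= sin b * ((c ^ 2 - 1) * ((PI / 2) ^ 2 - b ^ 2) / 2)).
    { replace (sin b * ((c ^ 2 - 1) * ((PI / 2) ^ 2 - b ^ 2) / 2))
        with (m * (((PI / 2) ^ 2 - b ^ 2) * sin b) + m ^ 2 / 2 * (((PI / 2) ^ 2 - b ^ 2) * sin b)) by (unfold m; field).
      assert (0 <= ((PI / 2) ^ 2 - b ^ 2) * sin b) by (apply Rmult_le_pos; nra).
      assert (0 <= m ^ 2 / 2 * (((PI / 2) ^ 2 - b ^ 2) * sin b)) by (apply Rmult_le_pos; nra).
      assert (m * (cos b * b) <= m * (((PI / 2) ^ 2 - b ^ 2) * sin b)) by (apply Rmult_le_compat_l; lra).
      lra. }
    replace (sin b ^ 2 * cosh a ^ 2) with ((sin b * cosh a) ^ 2) by ring.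
    rewrite <- (pow2_abs (sin b * cos (m * b) + cos b * sin (m * b))).
    apply pow_incr. split; [apply Rabs_pos|]. eapply Rle_trans; [exact U|].
    assert (sin b * (1 + (c ^ 2 - 1) * ((PI / 2) ^ 2 - b ^ 2) / 2) <= sin b * cosh a) by (apply Rmult_le_compat_l; lra).
    lra. }
  destruct (Rle_dec 0 b) as [L|L].
  - rewrite Rabs_right in Hb by lra. apply Hpos; assumption.
  - rewrite Rabs_left in Hb by lra. specialize (Hpos (- b)).
    rewrite Ropp_mult_distr_r_reverse, !sin_neg in Hpos.
    replace (sin (c * b) ^ 2) with ((- sin (c * b)) ^ 2) by ring.
    replace (sin b ^ 2) with ((- sin b) ^ 2) by ring. apply Hpos; try lra.
Qed.

(** * Complex hyperbolic functions and the lower bound in the strip *)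

Definition Ccosh (z : C) : C := ((Cexp z + Cexp (- z)) / 2)%C.

Lemma Ccosh_xy (x y : R) : Ccosh (x, y) = (cosh x * cos y, sinh x * sin y).
Proof.
  unfold Ccosh, Cexp, Cdiv, Cplus, Copp, Cmult, Cinv, RtoC, Re, Im, cosh, sinh; cbn [fst snd].
  rewrite cos_neg, sin_neg. f_equal; field.
Qed.

Lemma Csinh_xy (x y : R) : Csinh (x, y) = (sinh x * cos y, cosh x * sin y).
Proof.
  unfold Csinh, Cexp, Cdiv, Cminus, Cplus, Copp, Cmult, Cinv, RtoC, Re, Im, cosh, sinh; cbn [fst snd].
  rewrite cos_neg, sin_neg. f_equal; field.
Qed.

Lemma cosh2_sinh2 (x : R) : cosh x ^ 2 = 1 + sinh x ^ 2.
Proof.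
  unfold cosh, sinh. assert (E : exp x * exp (- x) = 1) by (rewrite <- exp_plus, Rplus_opp_r; apply exp_0).
  replace (((exp x + exp (- x)) / 2) ^ 2) with (((exp x - exp (- x)) / 2) ^ 2 + exp x * exp (- x)) by field.
  rewrite E. ring.
Qed.

Lemma cos2_sin2 (y : R) : cos y ^ 2 = 1 - sin y ^ 2.
Proof. pose proof (sin2_cos2 y) as H. unfold Rsqr in H. lra. Qed.

Lemma Cmod_Ccosh_sqr (x y : R) : Cmod (Ccosh (x, y)) ^ 2 = cosh x ^ 2 - sin y ^ 2.
Proof.
  rewrite Ccosh_xy. unfold Cmod; cbn [fst snd]. rewrite pow2_sqrt by nra.
  replace ((cosh x * cos y) ^ 2 + (sinh x * sin y) ^ 2) with (cosh x ^ 2 * cos y ^ 2 + sinh x ^ 2 * sin y ^ 2) by ring.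
  rewrite cos2_sin2. pose proof (cosh2_sinh2 x). nra.
Qed.

Lemma Cmod_Ccosh_le (x y : R) : Cmod (Ccosh (x, y)) <= cosh x.
Proof.
  apply Rsqr_incr_0; [|apply Cmod_ge_0|left; apply cosh_pos].
  rewrite !Rsqr_pow2, Cmod_Ccosh_sqr. pose proof (pow2_ge_0 (sin y)). lra.
Qed.

(** The argument is a + i b cosh x with a = pi/2 sinh x cos y and b = pi/2 sin y. By
    [Cmod_Ccosh_sqr] the squared claim becomes sin (c b)^2 <= sin b^2 cosh a^2 with c = cosh x, and
    a^2 = (c^2 - 1) ((pi/2)^2 - b^2) is the relation that [sin_dilate_le] asks for. *)
Lemma Cmod_Ccosh_Csinh_ge (x y : R) : Rabs y < PI / 2 ->
  cosh (PI / 2 * (sinh x * cos y)) * cos (PI / 2 * sin y) <= Cmod (Ccosh (RtoC (PI / 2) * Csinh (x, y))%C).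
Proof.
  intros Hy. destruct PI_bounds as [P3 P4].
  set (b := PI / 2 * sin y). set (a := PI / 2 * (sinh x * cos y)).
  replace (RtoC (PI / 2) * Csinh (x, y))%C with ((a, cosh x * b) : C)
    by (rewrite Csinh_xy; unfold a, b, RtoC, Cmult; cbn [fst snd]; f_equal; ring).
  pose proof (SIN_bound y).
  assert (Hb : Rabs b <= PI / 2) by (apply Rabs_le; unfold b; nra).
  assert (Hc : 0 <= cos b).
  { apply Rabs_le_between in Hb. apply cos_ge_0; lra. }
  pose proof (cosh_ge_1 x). pose proof (cosh_pos a).
  apply Rsqr_incr_0; [|apply Rmult_le_pos; lra|apply Cmod_ge_0].
  rewrite !Rsqr_pow2, Cmod_Ccosh_sqr.
  assert (D : sin (cosh x * b) ^ 2 <= sin b ^ 2 * cosh a ^ 2).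
  { apply sin_dilate_le; try assumption. rewrite cosh2_sinh2. unfold a, b.
    replace ((PI / 2 * (sinh x * cos y)) ^ 2) with ((PI / 2) ^ 2 * sinh x ^ 2 * cos y ^ 2) by ring.
    rewrite cos2_sin2. ring. }
  replace ((cosh a * cos b) ^ 2) with (cosh a ^ 2 * cos b ^ 2) by ring.
  rewrite cos2_sin2. lra.
Qed.

Lemma Cderiv_opp_Cexp (z : C) : Cderiv (fun w => Cexp (- w))%C z (- Cexp (- z))%C.
Proof.
  assert (H : Cderiv (fun w => - w)%C z (- (1))%C).
  { refine (Cderiv_ext _ _ z _ _ _ _ (Cderiv_minus _ _ z _ _ (Cderiv_const 0 z) (Cderiv_id z))); [intros w|]; ring. }
  refine (Cderiv_ext _ _ z _ _ (fun w => eq_refl) _ (Cderiv_comp Cexp _ z _ _ (Cderiv_Cexp _) H)). ring.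
Qed.

Lemma Cderiv_Csinh (z : C) : Cderiv Csinh z (Ccosh z).
Proof.
  refine (Cderiv_ext _ _ z _ _ _ _ (Cderiv_scal (/ 2) _ z _
    (Cderiv_minus _ _ z _ _ (Cderiv_Cexp z) (Cderiv_opp_Cexp z)))); [intros w|]; unfold Csinh, Ccosh; field.
Qed.

Lemma Cderiv_Ccosh (z : C) : Cderiv Ccosh z (Csinh z).
Proof.
  refine (Cderiv_ext _ _ z _ _ _ _ (Cderiv_scal (/ 2) _ z _
    (Cderiv_plus _ _ z _ _ (Cderiv_Cexp z) (Cderiv_opp_Cexp z)))); [intros w|]; unfold Csinh, Ccosh; field.
Qed.

Lemma Ccosh2_Csinh2 (z : C) : (1 + Csinh z * Csinh z = Ccosh z * Ccosh z)%C.
Proof.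
  assert (E : (Cexp z * Cexp (- z) = 1)%C) by (rewrite <- Cexp_add, <- Cexp_0; f_equal; ring).
  unfold Csinh, Ccosh.
  replace ((Cexp z + Cexp (- z)) / 2 * ((Cexp z + Cexp (- z)) / 2))%C
    with ((Cexp z - Cexp (- z)) / 2 * ((Cexp z - Cexp (- z)) / 2) + Cexp z * Cexp (- z))%C by field.
  rewrite E. ring.
Qed.

Definition dpsi (w : C) : C := (RtoC (PI / 2) * Ccosh w * Ccosh (RtoC (PI / 2) * Csinh w))%C.

Lemma Cderiv_psi (z : C) : Cderiv psi z (dpsi z).
Proof. exact (Cderiv_comp Csinh _ z _ _ (Cderiv_Csinh _) (Cderiv_scal (RtoC (PI / 2)) _ z _ (Cderiv_Csinh z))). Qed.

Lemma Cderiv_dpsi (z : C) : exists l, Cderiv dpsi z l.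
Proof.
  eexists. apply Cderiv_mult; [apply Cderiv_scal, Cderiv_Ccosh|].
  exact (Cderiv_comp Ccosh _ z _ _ (Cderiv_Ccosh _) (Cderiv_scal (RtoC (PI / 2)) _ z _ (Cderiv_Csinh z))).
Qed.

Lemma psi_real (t : R) : psi (RtoC t) = RtoC (psiR t).
Proof.
  assert (H : forall u, Csinh (RtoC u) = RtoC (sinh u)).
  { intros u. unfold RtoC. rewrite Csinh_xy, sin_0, cos_0. f_equal; ring. }
  unfold psi, psiR. rewrite H, <- RtoC_mult, H. reflexivity.
Qed.

Definition dpsiR (t : R) : R := PI / 2 * cosh t * cosh (PI / 2 * sinh t).

Lemma is_derive_psiR (t : R) : is_derive psiR t (dpsiR t).
Proof. unfold psiR, dpsiR. auto_derive; trivial. ring. Qed.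

Lemma dpsi_real (t : R) : dpsi (RtoC t) = RtoC (dpsiR t).
Proof.
  assert (H : forall u, Ccosh (RtoC u) = RtoC (cosh u)).
  { intros u. unfold RtoC. rewrite Ccosh_xy, sin_0, cos_0. f_equal; ring. }
  assert (H' : forall u, Csinh (RtoC u) = RtoC (sinh u)).
  { intros u. unfold RtoC. rewrite Csinh_xy, sin_0, cos_0. f_equal; ring. }
  unfold dpsi, dpsiR. rewrite H', <- RtoC_mult, !H, <- !RtoC_mult. reflexivity.
Qed.

Lemma cos_abs_le (y D : R) : Rabs y <= D -> D <= PI -> cos D <= cos y.
Proof.
  intros Hy HD.
  assert (E : cos y = cos (Rabs y)) by (unfold Rabs; destruct (Rcase_abs y); [rewrite cos_neg|]; reflexivity).
  rewrite E. pose proof (Rabs_pos y). apply cos_decr_1; lra.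
Qed.

Lemma cos_sin_pos (D : R) : 0 <= D -> D < PI / 2 -> 0 < cos (PI / 2 * sin D).
Proof.
  intros H0 H1. destruct PI_bounds as [P3 P4].
  assert (0 <= sin D) by (apply sin_ge_0; lra).
  assert (sin D < 1) by (rewrite <- sin_PI2; apply sin_increasing_1; lra).
  apply cos_gt_0; nra.
Qed.

Lemma cos_sin_abs_le (y D : R) : Rabs y <= D -> D < PI / 2 -> cos (PI / 2 * sin D) <= cos (PI / 2 * sin y).
Proof.
  intros Hy HD. destruct PI_bounds as [P3 P4]. pose proof (Rabs_pos y).
  pose proof (SIN_bound D).
  assert (0 <= sin D) by (apply sin_ge_0; lra).
  apply Rabs_le_between in Hy.
  assert (sin y <= sin D) by (apply sin_incr_1; lra).
  assert (- sin D <= sin y) by (rewrite <- sin_neg; apply sin_incr_1; lra).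
  apply cos_abs_le; [apply Rabs_le|]; nra.
Qed.

Lemma sinh_opp (x : R) : sinh (- x) = - sinh x.
Proof. unfold sinh. rewrite Ropp_involutive. field. Qed.

Lemma cosh_opp (x : R) : cosh (- x) = cosh x.
Proof. unfold cosh. rewrite Ropp_involutive. field. Qed.

Lemma cosh_abs (x : R) : cosh (Rabs x) = cosh x.
Proof. unfold Rabs. destruct (Rcase_abs x); [apply cosh_opp|reflexivity]. Qed.

Lemma sinh_abs (x : R) : sinh (Rabs x) = Rabs (sinh x).
Proof.
  destruct (Rle_dec 0 x) as [L|L].
  - pose proof (sinh_ge_id x L). rewrite !Rabs_right by lra. reflexivity.
  - pose proof (sinh_ge_id (- x) ltac:(lra)) as H. rewrite sinh_opp in H.
    rewrite !Rabs_left1 by lra. apply sinh_opp.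
Qed.

Lemma exp_le_mono (x y : R) : x <= y -> exp x <= exp y.
Proof. intros [L|<-]; [left; apply exp_increasing, L|right; reflexivity]. Qed.

Lemma exp_le_2cosh (u a : R) : u <= Rabs a -> exp u / 2 <= cosh a.
Proof.
  intros H. rewrite <- cosh_abs. apply exp_le_mono in H. unfold cosh.
  pose proof (exp_pos (- Rabs a)). lra.
Qed.

(** The modulus c of cosh (pi/2 sinh w) enters with power - (g + 1) from the decay of f and with
    power 1 from psi', which leaves c^(-g). The parameter [D] serves twice: D = d over the strip and
    D = 0 on the real line, where both cosines are 1. *)
Lemma de_estimate (f : C -> C) (K g D x y : R) : 0 < K -> 0 < g -> D < PI / 2 -> Rabs y <= D ->
  Cmod (f (psi (x, y))) <= K * Rpower (Cmod (1 + psi (x, y) * psi (x, y))) (- (g + 1) / 2) ->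
  Cmod (f (psi (x, y)) * dpsi (x, y)) <=
    de_bound (K * (Rpower 2 g / Rpower (cos (PI / 2 * sin D)) g)) (g * cos D) (Rabs x).
Proof.
  intros HK Hg HD Hy Hf. destruct PI_bounds as [P3 P4]. pose proof (Rabs_pos y) as Hy0.
  set (c := Cmod (Ccosh (RtoC (PI / 2) * Csinh (x, y))%C)).
  assert (HcD : 0 < cos (PI / 2 * sin D)) by (apply cos_sin_pos; lra).
  assert (HcD' : 0 < cos D) by (apply cos_gt_0; lra).
  set (E := PI / 2 * (sinh (Rabs x) * cos D)).
  assert (Hc : exp E / 2 * cos (PI / 2 * sin D) <= c).
  { eapply Rle_trans; [|apply Cmod_Ccosh_Csinh_ge; lra].
    pose proof (exp_pos E).
    apply Rmult_le_compat; try lra; [|apply cos_sin_abs_le; assumption].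
    apply exp_le_2cosh. unfold E. rewrite !Rabs_mult, (Rabs_right (PI / 2)) by lra.
    apply Rmult_le_compat_l; [lra|].
    pose proof (sinh_ge_id (Rabs x) (Rabs_pos x)) as Hs. pose proof (Rabs_pos x).
    pose proof (cos_abs_le y D Hy ltac:(lra)) as Hcos.
    replace (Rabs (sinh x)) with (sinh (Rabs x)).
    - apply Rmult_le_compat; try lra. eapply Rle_trans; [exact Hcos|apply Rle_abs].
    - apply sinh_abs. }
  assert (Hlow : 0 < exp E / 2 * cos (PI / 2 * sin D)).
  { pose proof (exp_pos E). apply Rmult_lt_0_compat; lra. }
  assert (Hcpos : 0 < c) by lra.
  assert (E1 : (1 + psi (x, y) * psi (x, y) = Ccosh (RtoC (PI / 2) * Csinh (x, y)) * Ccosh (RtoC (PI / 2) * Csinh (x, y)))%C)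
    by apply Ccosh2_Csinh2.
  rewrite E1, Cmod_mult in Hf. fold c in Hf.
  rewrite Cmod_mult. unfold dpsi at 1. rewrite !Cmod_mult. fold c.
  rewrite Cmod_R, Rabs_right by lra.
  assert (HP : Rpower (c * c) (- (g + 1) / 2) * c = / Rpower c g).
  { rewrite <- Rpower_mult_distr by assumption. rewrite <- Rpower_plus.
    rewrite <- (Rpower_1 c) at 2 by assumption. rewrite <- Rpower_plus, <- Rpower_Ropp. f_equal. field. }
  assert (HPc : / Rpower c g <= Rpower 2 g / Rpower (cos (PI / 2 * sin D)) g * exp (- (g * E))).
  { assert (HB : Rpower (exp E / 2 * cos (PI / 2 * sin D)) g <= Rpower c g) by (apply Rle_Rpower_l; lra).
    assert (Hp : forall u v, 0 < Rpower u v) by (intros; apply exp_pos).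
    assert (Heq : Rpower (exp E / 2 * cos (PI / 2 * sin D)) g = exp (g * E) / Rpower 2 g * Rpower (cos (PI / 2 * sin D)) g).
    { pose proof (exp_pos E). rewrite <- Rpower_mult_distr by lra. f_equal.
      unfold Rdiv. rewrite <- Rpower_mult_distr by lra. f_equal.
      - unfold Rpower. rewrite ln_exp. reflexivity.
      - unfold Rpower. rewrite ln_Rinv by lra. rewrite <- exp_Ropp. f_equal. ring. }
    rewrite Heq in HB.
    assert (HQ : 0 < exp (g * E) / Rpower 2 g * Rpower (cos (PI / 2 * sin D)) g).
    { apply Rmult_lt_0_compat; [apply Rdiv_lt_0_compat; [apply exp_pos|apply Hp]|apply Hp]. }
    apply Rle_trans with (/ (exp (g * E) / Rpower 2 g * Rpower (cos (PI / 2 * sin D)) g)).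
    - apply Rinv_le_contravar; assumption.
    - right. rewrite exp_Ropp. field. repeat split; apply Rgt_not_eq; first [apply Hp|apply exp_pos]. }
  pose proof (Cmod_Ccosh_le x y) as Hch. pose proof (Cmod_ge_0 (Ccosh (x, y))) as Hch0.
  unfold de_bound. rewrite cosh_abs.
  replace (- (g * cos D * (PI / 2)) * sinh (Rabs x)) with (- (g * E)) by (unfold E; ring).
  apply Rle_trans with (K * Rpower (c * c) (- (g + 1) / 2) * (PI / 2 * cosh x * c)).
  - apply Rmult_le_compat; trivial.
    + apply Cmod_ge_0.
    + apply Rmult_le_pos; [apply Rmult_le_pos; lra|lra].
    + apply Rmult_le_compat_r; [lra|]. apply Rmult_le_compat_l; lra.
  - replace (K * Rpower (c * c) (- (g + 1) / 2) * (PI / 2 * cosh x * c))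
      with (K * (PI / 2 * cosh x) * (Rpower (c * c) (- (g + 1) / 2) * c)) by ring.
    rewrite HP. pose proof (cosh_pos x).
    replace (K * (Rpower 2 g / Rpower (cos (PI / 2 * sin D)) g) * (PI / 2 * cosh x * exp (- (g * E))))
      with (K * (PI / 2 * cosh x) * (Rpower 2 g / Rpower (cos (PI / 2 * sin D)) g * exp (- (g * E)))) by ring.
    apply Rmult_le_compat_l; [|exact HPc]. apply Rmult_le_pos; [lra|apply Rmult_le_pos; lra].
Qed.

(** * The substitution t = psi(x) on the real line *)

Lemma psiR_surj (t : R) : psiR (arcsinh (2 / PI * arcsinh t)) = t.
Proof.
  pose proof PI_RGT_0. unfold psiR. rewrite sinh_arcsinh.
  replace (PI / 2 * (2 / PI * arcsinh t)) with (arcsinh t) by (field; lra). apply sinh_arcsinh.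
Qed.

Lemma psiR_inv_ge (X t : R) : psiR X <= t -> X <= arcsinh (2 / PI * arcsinh t).
Proof.
  intros H. pose proof PI_RGT_0. rewrite <- (arcsinh_sinh X). apply arcsinh_le.
  apply Rmult_le_reg_l with (PI / 2); [lra|].
  replace (PI / 2 * (2 / PI * arcsinh t)) with (arcsinh t) by (field; lra).
  rewrite <- (arcsinh_sinh (PI / 2 * sinh X)). apply arcsinh_le, H.
Qed.

Lemma psiR_opp (x : R) : psiR (- x) = - psiR x.
Proof. unfold psiR. rewrite sinh_opp, Ropp_mult_distr_r_reverse. apply sinh_opp. Qed.

Lemma is_RInt_psi (f : C -> C) (a b : R) : a <= b ->
  (forall x, Ccont f (RtoC x)) ->
  is_RInt (V := C_R_CompleteNormedModule) (fun t => f (RtoC t)) (psiR a) (psiR b)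
    (Hint (fun w => f (psi w) * dpsi w)%C 0 a b).
Proof.
  intros Hab Hf.
  assert (Hex : ex_RInt (V := C_R_CompleteNormedModule) (fun t => f (RtoC t)) (psiR a) (psiR b)).
  { apply (ex_RInt_continuous (V := C_R_CompleteNormedModule)). intros x _. apply Ccont_H, Hf. }
  replace (Hint (fun w => f (psi w) * dpsi w)%C 0 a b)
    with (RInt (V := C_R_CompleteNormedModule) (fun t => f (RtoC t)) (psiR a) (psiR b)).
  { apply (RInt_correct (V := C_R_CompleteNormedModule)), Hex. }
  symmetry. apply (is_RInt_unique (V := C_R_CompleteNormedModule)).
  eapply (is_RInt_ext (V := C_R_CompleteNormedModule)).
  2:{ apply (is_RInt_comp (V := C_R_CompleteNormedModule) (fun t => f (RtoC t)) psiR dpsiR).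
      - intros x _. apply Ccont_H, Hf.
      - intros x _. split; [apply is_derive_psiR|].
        apply (ex_derive_continuous (K := R_AbsRing) (V := R_NormedModule)).
        unfold dpsiR. auto_derive. trivial. }
  intros x _. cbn beta. change ((x, 0) : C) with (RtoC x). rewrite psi_real, dpsi_real.
  unfold scal; cbn. unfold prod_scal, scal; cbn. unfold mult; cbn.
  unfold Cmult, RtoC; cbn [fst snd]. f_equal; ring.
Qed.

(** * Truncation of the sum *)

Lemma is_derive_continuity_pt (g : R -> R) (x l : R) : is_derive g x l -> continuity_pt g x.
Proof.
  intros H. apply continuity_pt_filterlim, (ex_derive_continuous (K := R_AbsRing) (V := R_NormedModule)).
  exists l. exact H.
Qed.

Lemma antitone_of_derive (g g' : R -> R) (a b : R) : a <= b ->
  (forall x, is_derive g x (g' x)) -> (forall x, a <= x <= b -> g' x <= 0) -> g b <= g a.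
Proof.
  intros Hab Hd Hn.
  destruct (MVT_gen g a b g') as (c & Hc & E).
  - intros x _. apply Hd.
  - intros x _. exact (is_derive_continuity_pt _ _ _ (Hd x)).
  - rewrite Rmin_left, Rmax_right in Hc by exact Hab. specialize (Hn c Hc). nra.
Qed.

Lemma sinh_mono (x y : R) : x <= y -> sinh x <= sinh y.
Proof. intros [L|<-]; [left; apply sinh_lt, L|right; reflexivity]. Qed.

(** Minus the derivative of exp (- p sinh x), and [de_bound] up to a factor when p = b pi / 2. Its
    derivative has the sign of sinh x - p cosh x^2, a quadratic in sinh x. *)
Definition de_dens (p x : R) : R := p * cosh x * exp (- p * sinh x).

Lemma is_derive_de_dens (p x : R) :
  is_derive (de_dens p) x (p * exp (- p * sinh x) * (sinh x - p * cosh x ^ 2)).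
Proof. unfold de_dens. auto_derive; trivial. ring. Qed.

Lemma is_derive_exp_sinh (p x : R) : is_derive (fun x => exp (- p * sinh x)) x (- de_dens p x).
Proof. unfold de_dens. auto_derive; trivial. ring. Qed.

Lemma de_dens_antitone (p a b : R) : 0 < p -> a <= b ->
  (forall x, a <= x <= b -> sinh x <= p * cosh x ^ 2) -> de_dens p b <= de_dens p a.
Proof.
  intros Hp Hab H. apply (antitone_of_derive _ _ a b Hab (is_derive_de_dens p)).
  intros x Hx. specialize (H x Hx). pose proof (exp_pos (- p * sinh x)).
  assert (0 < p * exp (- p * sinh x)) by (apply Rmult_lt_0_compat; lra). nra.
Qed.

Lemma de_dens_monotone (p a b : R) : 0 < p -> a <= b ->
  (forall x, a <= x <= b -> p * cosh x ^ 2 <= sinh x) -> de_dens p a <= de_dens p b.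
Proof.
  intros Hp Hab H.
  cut (- de_dens p b <= - de_dens p a); [lra|].
  apply (antitone_of_derive (fun x => - de_dens p x) (fun x => - (p * exp (- p * sinh x) * (sinh x - p * cosh x ^ 2))) a b Hab).
  - intros x. apply (is_derive_opp (K := R_AbsRing) (V := R_NormedModule)), is_derive_de_dens.
  - intros x Hx. specialize (H x Hx). pose proof (exp_pos (- p * sinh x)).
    assert (0 < p * exp (- p * sinh x)) by (apply Rmult_lt_0_compat; lra). nra.
Qed.

(** Mean value theorem on one step: where the density decreases, its value at the right end is the
    smallest on the step. *)
Lemma de_dens_telescope (p x h : R) : 0 < p -> 0 <= h ->
  (forall y, x <= y <= x + h -> sinh y <= p * cosh y ^ 2) ->
  h * de_dens p (x + h) <= exp (- p * sinh x) - exp (- p * sinh (x + h)).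
Proof.
  intros Hp Hh H.
  destruct (MVT_gen (fun x => exp (- p * sinh x)) x (x + h) (fun x => - de_dens p x)) as (c & Hc & E).
  - intros y _. exact (is_derive_exp_sinh p y).
  - intros y _. exact (is_derive_continuity_pt _ _ _ (is_derive_exp_sinh p y)).
  - rewrite Rmin_left, Rmax_right in Hc by lra.
    assert (de_dens p (x + h) <= de_dens p c) by (apply de_dens_antitone; [exact Hp|lra|intros; apply H; lra]).
    replace (x + h - x) with h in E by ring. nra.
Qed.

(** [W] plays the part of a tail integral of [Q], but any function dropping by at least h Q(x + h)
    over each step will do; this freedom is used where the density still rises. *)
Lemma csum_telescope (g : nat -> C) (Q W : R -> R) (A X h : R) (L : nat) : 0 <= A -> 0 <= h ->
  (forall i, (i < L)%nat -> Cmod (g i) <= A * Q (X + (INR i + 1) * h)) ->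
  (forall x, X <= x -> h * Q (x + h) <= W x - W (x + h)) ->
  h * Cmod (csum g L) <= A * (W X - W (X + INR L * h)).
Proof.
  intros HA Hh Hg HW. induction L as [|L IH].
  - cbn [csum INR]. rewrite Cmod_0, Rmult_0_l, Rplus_0_r. lra.
  - cbn [csum]. specialize (IH (fun i Hi => Hg i (Nat.lt_lt_succ_r _ _ Hi))).
    specialize (Hg L (Nat.lt_succ_diag_r L)). pose proof (pos_INR L) as HL.
    specialize (HW (X + INR L * h) ltac:(nra)).
    rewrite S_INR. replace (X + INR L * h + h) with (X + (INR L + 1) * h) in HW by ring.
    pose proof (Cmod_triangle (csum g L) (g L)).
    assert (h * Cmod (csum g L + g L) <= h * (Cmod (csum g L) + Cmod (g L))) by (apply Rmult_le_compat_l; lra).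
    assert (h * Cmod (g L) <= h * (A * Q (X + (INR L + 1) * h))) by (apply Rmult_le_compat_l; lra).
    assert (A * (h * Q (X + (INR L + 1) * h)) <= A * (W (X + INR L * h) - W (X + (INR L + 1) * h)))
      by (apply Rmult_le_compat_l; lra).
    lra.
Qed.

(** Used where p cosh X^2 <= sinh X, to obtain p (exp X - X) <= X. The proof rests on the tangent
    bound exp (1 - X) >= 2 - X. *)
Lemma sinh_mul_exp_sub_le (X : R) : 1 <= X -> sinh X * (exp X - X) <= X * cosh X ^ 2.
Proof.
  intros HX. unfold sinh, cosh.
  assert (E1 : exp X * exp (- X) = 1) by (rewrite <- exp_plus, Rplus_opp_r; apply exp_0).
  pose proof (exp_pos X). pose proof (exp_pos (- X)). pose proof exp_le_3 as He3.
  assert (He : exp X * exp (1 - X) = exp 1) by (rewrite <- exp_plus; f_equal; ring).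
  pose proof (exp_ineq1_le (1 - X)) as H2.
  pose proof (exp_ineq1_le 1) as He2.
  set (E := exp X) in *. set (u := exp (- X)) in *. set (e := exp 1) in *.
  assert (K1 : E * (2 - X) <= e).
  { rewrite <- He. apply Rmult_le_compat_l; lra. }
  (* After multiplication by 2 - X and use of [K1], the claim amounts to (4 - e) (X - 1) >= 0. *)
  assert (K2 : E * (e - 2 * X) <= e * (e - 2)).
  { destruct (Rle_dec (e - 2 * X) 0) as [L|L]; [nra|].
    assert (0 < 2 - X) by lra.
    apply Rmult_le_reg_r with (2 - X); [assumption|].
    apply Rle_trans with (e * (e - 2 * X)); [nra|].
    assert (0 <= (4 - e) * (X - 1)) by (apply Rmult_le_pos; lra).
    nra. }
  assert (K3 : e * (e - 2) <= 3) by nra.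
  assert (K4 : E * E * (2 - X) <= E * e) by nra.
  assert (K5 : 0 <= X * (1 - u) ^ 2) by (apply Rmult_le_pos; [lra|apply pow2_ge_0]).
  assert (K6 : (E - u) / 2 * E = (E * E - 1) / 2) by nra.
  replace ((E - u) / 2 * (E - X)) with ((E - u) / 2 * E - X * (E - u) / 2) by field.
  rewrite K6.
  replace (X * ((E + u) / 2) ^ 2) with (X * (E * E + 2 * (E * u) + u ^ 2) / 4) by field.
  rewrite E1. nra.
Qed.

(** * Sums of the density beyond the threshold *)

Section Tail.
Variables (p X : R).
Hypotheses (Hp : 0 < p) (HX : 1 <= X).
Hypothesis Hthr : p < / 2 -> sqrt (1 + sqrt (1 - (2 * p) ^ 2)) / (2 * p) <= sinh X.

(** In sinh X the part with exp (- X) <= 1 costs the factor exp (p / 2), which becomes exp (pi nu /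
    4) in [C1]; X >= 1 allows the division of the exponent by X. *)
Lemma de_target_ge_exp_sinh : exp (- p * sinh X) <= exp (p / 2) * exp (- (p * exp X / (2 * X))).
Proof.
  rewrite <- exp_plus. apply exp_le_mono. unfold sinh.
  assert (exp (- X) <= 1) by (rewrite <- exp_0; apply exp_le_mono; lra).
  assert (p * exp X / (2 * X) <= p * exp X / 2).
  { apply Rmult_le_compat_l; [left; apply Rmult_lt_0_compat; [exact Hp|apply exp_pos]|].
    apply Rinv_le_contravar; lra. }
  nra.
Qed.

(* Beyond the last critical point of the density its sum is bounded by its integral.  Before that
   point the density is replaced by its maximum, which the threshold on [sinh X] makes affordable. *)
Lemma de_tail_majorant : exists W : R -> R,
  (forall x, 0 <= W x) /\
  (forall x h, X <= x -> 0 <= h -> h * de_dens p (x + h) <= W x - W (x + h)) /\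
  W X <= exp (p / 2) * exp (- (p * exp X / (2 * X))).
Proof.
  set (E := fun x => exp (- p * sinh x)).
  assert (HE : forall x, 0 < E x) by (intros; apply exp_pos).
  assert (Hdec : (forall x, X <= x -> sinh x <= p * cosh x ^ 2) -> exists W : R -> R,
    (forall x, 0 <= W x) /\
    (forall x h, X <= x -> 0 <= h -> h * de_dens p (x + h) <= W x - W (x + h)) /\
    W X <= exp (p / 2) * exp (- (p * exp X / (2 * X)))).
  { intros H. exists E. split; [intros; left; apply HE|]. split; [|apply de_target_ge_exp_sinh].
    intros x h Hx Hh. apply de_dens_telescope; trivial. intros y Hy. apply H. lra. }
  assert (Hsx1 : 1 <= sinh X) by (pose proof (sinh_ge_id X ltac:(lra)); lra).
  destruct (Rlt_dec p (/ 2)) as [Lp|Lp].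
  (* For p >= 1/2, (sinh x - 1)^2 >= 0 shows that the density never increases. *)
  2:{ apply Hdec. intros x Hx. rewrite cosh2_sinh2. pose proof (pow2_ge_0 (sinh x - 1)).
      assert (/ 2 * (1 + sinh x ^ 2) <= p * (1 + sinh x ^ 2)) by (apply Rmult_le_compat_r; nra). nra. }
  specialize (Hthr Lp).
  set (r := sqrt (1 - (2 * p) ^ 2)) in *.
  assert (Hr2 : r * r = 1 - (2 * p) ^ 2) by (apply sqrt_sqrt; nra).
  assert (Hr0 : 0 <= r) by apply sqrt_pos.
  assert (Hr1 : r < 1) by nra.
  (* Since p^2 = v (1 - v), the critical values of sinh x are v / p and its reciprocal p / v; [s1]
     is the larger. *)
  set (v := (1 + r) / 2). assert (Hv : / 2 <= v < 1) by (unfold v; lra).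
  assert (Hpv : p * p = v * (1 - v)) by (unfold v; nra).
  set (s1 := v / p).
  assert (Hs1 : p * s1 = v) by (unfold s1; field; lra).
  assert (Hs1p : 0 < s1) by (apply Rdiv_lt_0_compat; lra).
  assert (Hfac : forall s, p * (1 + s ^ 2) - s = (p * s - v) * (v * s - p) / v).
  { intros s. apply Rmult_eq_reg_r with v; [|lra]. unfold Rdiv. rewrite Rmult_assoc, Rinv_l, Rmult_1_r by lra.
    replace ((p * s - v) * (v * s - p)) with (p * v * s ^ 2 - s * (p * p + v * v) + p * v) by ring.
    rewrite Hpv. ring. }
  assert (Hvp : p <= v) by nra.
  set (x1 := arcsinh s1). assert (Hx1 : sinh x1 = s1) by apply sinh_arcsinh.
  assert (Hafter : forall x, x1 <= x -> sinh x <= p * cosh x ^ 2).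
  { intros x Hx. rewrite cosh2_sinh2. apply sinh_mono in Hx. rewrite Hx1 in Hx.
    assert (0 <= (p * sinh x - v) * (v * sinh x - p) / v); [|rewrite <- Hfac in *; lra].
    assert (v <= p * sinh x) by (rewrite <- Hs1; apply Rmult_le_compat_l; lra).
    assert (v <= sinh x) by nra.
    apply Rmult_le_pos; [|left; apply Rinv_0_lt_compat; lra].
    apply Rmult_le_pos; [lra|]. nra. }
  assert (Hbefore : forall x, X <= x -> x <= x1 -> p * cosh x ^ 2 <= sinh x).
  { intros x Hx Hxx. rewrite cosh2_sinh2. apply sinh_mono in Hx. apply sinh_mono in Hxx. rewrite Hx1 in Hxx.
    assert (0 <= (v - p * sinh x) * (v * sinh x - p) / v).
    2:{ replace ((v - p * sinh x) * (v * sinh x - p) / v) with (- ((p * sinh x - v) * (v * sinh x - p) / v)) in H by (field; lra).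
        rewrite <- Hfac in H. lra. }
    assert (p * sinh x <= v) by (rewrite <- Hs1; apply Rmult_le_compat_l; lra).
    apply Rmult_le_pos; [|left; apply Rinv_0_lt_compat; lra].
    apply Rmult_le_pos; [lra|]. nra. }
  destruct (Rle_dec x1 X) as [Lx|Lx]; [apply Hdec; intros; apply Hafter; lra|].
  set (Qm := de_dens p x1).
  assert (HQm0 : 0 < Qm).
  { unfold Qm, de_dens. apply Rmult_lt_0_compat; [apply Rmult_lt_0_compat; [exact Hp|apply cosh_pos]|apply exp_pos]. }
  assert (HQm : forall x, X <= x -> de_dens p x <= Qm).
  { intros x Hx. destruct (Rle_dec x x1) as [L|L].
    - apply de_dens_monotone; trivial. intros y Hy. apply Hbefore; lra.
    - apply de_dens_antitone; try lra. intros y Hy. apply Hafter; lra. }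
  (* Descends with slope [Qm] up to [x1], then equals the tail integral itself. *)
  exists (fun x => if Rle_dec x x1 then E x1 + Qm * (x1 - x) else E x).
  split; [|split].
  - intros x. pose proof (HE x). pose proof (HE x1). destruct (Rle_dec x x1); nra.
  - intros x h Hx Hh. pose proof (HQm (x + h) ltac:(lra)) as Hq.
    destruct (Rle_dec x x1) as [L1|L1]; destruct (Rle_dec (x + h) x1) as [L2|L2]; try lra.
    + nra.
    + assert (T : (x + h - x1) * de_dens p (x1 + (x + h - x1)) <= E x1 - E (x1 + (x + h - x1))).
      { apply de_dens_telescope; try lra. intros y Hy. apply Hafter. lra. }
      replace (x1 + (x + h - x1)) with (x + h) in T by ring. nra.
    + apply de_dens_telescope; trivial. intros y Hy. apply Hafter. lra.
  - destruct (Rle_dec X x1) as [_|N]; [|lra].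
    assert (EE : E x1 = exp (- v)) by (unfold E; rewrite Hx1; f_equal; lra).
    assert (EQ : Qm <= exp (- v)).
    { unfold Qm, de_dens. rewrite Hx1. replace (- p * s1) with (- v) by lra.
      (* Its square is p^2 + (p s1)^2 = p^2 + v^2 = v. *)
      assert (p * cosh x1 <= 1).
      { apply Rsqr_incr_0; [|left; apply Rmult_lt_0_compat; [exact Hp|apply cosh_pos]|lra].
        rewrite !Rsqr_pow2. replace ((p * cosh x1) ^ 2) with (p * p * cosh x1 ^ 2) by ring.
        rewrite cosh2_sinh2, Hx1. replace (p * p * (1 + s1 ^ 2)) with (p * p + (p * s1) ^ 2) by ring.
        rewrite Hs1, Hpv. nra. }
      rewrite <- (Rmult_1_l (exp (- v))) at 2. apply Rmult_le_compat_r; [left; apply exp_pos|assumption]. }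
    (* exp (x1 - X) <= sinh x1 / sinh X, and the threshold makes this quotient at most sqrt (2 v);
       then exp u >= 1 + u with u = 2 (x1 - X) gives the bound. *)
    assert (Hdel : x1 - X <= v - / 2).
    { assert (G : exp (x1 - X) * sinh X <= s1).
      { rewrite <- Hx1. unfold sinh.
        assert (A1 : exp (x1 - X) * exp X = exp x1) by (rewrite <- exp_plus; f_equal; ring).
        assert (A2 : exp (- x1) <= exp (x1 - X) * exp (- X)) by (rewrite <- exp_plus; apply exp_le_mono; lra).
        lra. }
      set (w := sqrt (1 + r)) in *.
      assert (Hw2 : w * w = 2 * v) by (unfold w, v; rewrite sqrt_sqrt; lra).
      assert (Hw0 : 0 < w) by (apply sqrt_lt_R0; lra).
      pose proof (exp_pos (x1 - X)) as Hep.
      assert (G2 : exp (x1 - X) * w <= 2 * v).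
      { assert (exp (x1 - X) * (w / (2 * p)) <= s1).
        { eapply Rle_trans; [apply Rmult_le_compat_l; [lra|exact Hthr]|exact G]. }
        apply Rmult_le_reg_r with (/ (2 * p)); [apply Rinv_0_lt_compat; lra|].
        replace (2 * v * / (2 * p)) with s1 by (unfold s1; field; lra).
        unfold Rdiv in *. lra. }
      assert (G3 : exp (x1 - X) <= w) by nra.
      assert (G4 : exp ((x1 - X) + (x1 - X)) <= 2 * v) by (rewrite exp_plus; nra).
      pose proof (exp_ineq1_le ((x1 - X) + (x1 - X))). lra. }
    (* The value at [X] is at most exp (- v) (1 + v - 1/2) <= exp (- 1/2); it remains to see that
       the target is no smaller than exp (- 1/2). *)
    apply Rle_trans with (exp (- / 2)).
    { apply Rle_trans with (exp (- v) * exp (v - / 2)).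
      - pose proof (exp_ineq1_le (v - / 2)). pose proof (exp_pos (- v)). rewrite EE. nra.
      - rewrite <- exp_plus. right. f_equal. ring. }
    rewrite <- exp_plus. apply exp_le_mono.
    (* [X] lies before the last critical point, so the density has not yet begun to fall;
       [sinh_mul_exp_sub_le] turns this into p exp X <= X + p X. *)
    assert (Hpc : p * cosh X ^ 2 <= sinh X) by (apply Hbefore; lra).
    pose proof (sinh_mul_exp_sub_le X HX) as Hid.
    assert (Hc2 : 0 < cosh X ^ 2) by (apply pow_lt, cosh_pos).
    assert (HeX : 0 <= exp X - X) by (pose proof (exp_ineq1_le X); lra).
    assert (Hfin : p * (exp X - X) <= X).
    { apply Rmult_le_reg_r with (1 := Hc2). apply Rle_trans with (sinh X * (exp X - X)); [|exact Hid].
      replace (p * (exp X - X) * cosh X ^ 2) with (p * cosh X ^ 2 * (exp X - X)) by ring.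
      apply Rmult_le_compat_r; assumption. }
    assert (p * exp X / (2 * X) <= (X + p * X) / (2 * X)).
    { apply Rmult_le_compat_r; [left; apply Rinv_0_lt_compat; lra|lra]. }
    replace ((X + p * X) / (2 * X)) with (/ 2 + p / 2) in H by (field; lra). lra.
Qed.

Lemma de_tail_sum (g : nat -> C) (A h : R) (L : nat) : 0 <= A -> 0 <= h ->
  (forall i, (i < L)%nat -> Cmod (g i) <= A * de_dens p (X + (INR i + 1) * h)) ->
  h * Cmod (csum g L) <= A * (exp (p / 2) * exp (- (p * exp X / (2 * X)))).
Proof.
  intros HA Hh Hg. destruct de_tail_majorant as (W & W0 & W1 & W2).
  eapply Rle_trans; [apply (csum_telescope g (de_dens p) W A X h L HA Hh Hg)|].
  - intros x Hx. apply W1; assumption.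
  - apply Rmult_le_compat_l; [exact HA|]. specialize (W0 (X + INR L * h)). lra.
Qed.
End Tail.

(** * Assembling the error estimate *)

Lemma csum_ext (f g : nat -> C) (n : nat) : (forall i, (i < n)%nat -> f i = g i) -> csum f n = csum g n.
Proof.
  induction n as [|n IH]; intros H; [reflexivity|]. cbn [csum]. rewrite IH, (H n) by auto. reflexivity.
Qed.

Lemma csum_app (g : nat -> C) (a b : nat) : csum g (a + b) = (csum g a + csum (fun i => g (a + i)%nat) b)%C.
Proof.
  induction b as [|b IH]; [rewrite Nat.add_0_r; cbn [csum]; ring|].
  rewrite Nat.add_succ_r. cbn [csum]. rewrite IH. ring.
Qed.

Lemma csum_rev (g : nat -> C) (n : nat) : csum g n = csum (fun i => g (n - 1 - i)%nat) n.
Proof.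
  induction n as [|n IH]; [reflexivity|].
  transitivity (csum (fun i => g (S n - 1 - i)%nat) (1 + n)); [|reflexivity].
  rewrite csum_app. cbn [csum]. rewrite IH.
  replace (S n - 1 - 0)%nat with n by lia.
  rewrite (csum_ext (fun i => g (S n - 1 - (1 + i))%nat) (fun i => g (n - 1 - i)%nat)); [ring|].
  intros i Hi. f_equal. lia.
Qed.

Lemma zsum_csum (a b : Z) (g : Z -> C) : zsum a b g = csum (fun i => g (a + Z.of_nat i)%Z) (Z.to_nat (b - a + 1)).
Proof.
  unfold zsum. generalize (Z.to_nat (b - a + 1)). intros n.
  set (G := fun i => g (a + Z.of_nat i)%Z).
  assert (H : forall l c, fold_right Cplus c l = (fold_right Cplus (RtoC 0) l + c)%C).
  { induction l as [|x l IH]; intros c; cbn [fold_right]; [ring|]. rewrite IH. ring. }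
  induction n as [|n IH]; [reflexivity|].
  rewrite seq_S, map_app, fold_right_app. cbn [map fold_right]. rewrite H, IH. cbn [csum Nat.add]. ring.
Qed.

(** The left tail is reversed so that both tails run outwards from the truncation points, the order
    in which [truncation_side] bounds them. *)
Lemma nodes_split (F : C -> C) (h : R) (M N : Z) (m : nat) :
  (0 <= M)%Z -> (0 <= N)%Z -> (M <= Z.of_nat m)%Z -> (N <= Z.of_nat m)%Z ->
  let G := fun k => F (RtoC (IZR k * h)) in
  nodes F h m = (csum (fun j => G (- (M + 1 + Z.of_nat j))%Z) (m - Z.to_nat M) + zsum (- M) N G
    + csum (fun j => G (N + 1 + Z.of_nat j)%Z) (m - Z.to_nat N))%C.
Proof.
  intros HM HN HMm HNm G. unfold nodes. fold G.
  replace (2 * m + 1)%nat with ((m - Z.to_nat M) + (Z.to_nat (N - - M + 1) + (m - Z.to_nat N)))%nat by lia.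
  rewrite csum_app, csum_app, zsum_csum, Cplus_assoc. f_equal; [f_equal|].
  - rewrite csum_rev. apply csum_ext. intros i Hi. change (G (- Z.of_nat m + Z.of_nat (m - Z.to_nat M - 1 - i))%Z = G (- (M + 1 + Z.of_nat i))%Z). f_equal. lia.
  - apply csum_ext. intros i Hi.
    change (G (- Z.of_nat m + Z.of_nat (m - Z.to_nat M + i))%Z = G (- M + Z.of_nat i)%Z). f_equal. lia.
  - apply csum_ext. intros i Hi.
    change (G (- Z.of_nat m + Z.of_nat (m - Z.to_nat M + (Z.to_nat (N - - M + 1) + i)))%Z = G (N + 1 + Z.of_nat i)%Z). f_equal. lia.
Qed.

(** Turns lower bounds on X and ln t into lower bounds on exp X / X and t / ln t, the quantities in
    the exponents. *)
Lemma exp_div_id_mono (x y : R) : 1 <= x -> x <= y -> exp x / x <= exp y / y.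
Proof.
  intros Hx Hxy. replace y with (x + (y - x)) at 1 by ring. rewrite exp_plus.
  pose proof (exp_ineq1_le (y - x)). pose proof (exp_pos x).
  apply Rmult_le_reg_r with (x * y); [apply Rmult_lt_0_compat; lra|].
  replace (exp x / x * (x * y)) with (exp x * y) by (field; lra).
  replace (exp x * exp (y - x) / y * (x * y)) with (exp x * (exp (y - x) * x)) by (field; lra).
  apply Rmult_le_compat_l; [lra|]. nra.
Qed.

Lemma x_gamma_threshold (g X : R) : 0 < g -> x_gamma (g / 2) <= X -> g * (PI / 2) < / 2 ->
  sqrt (1 + sqrt (1 - (2 * (g * (PI / 2))) ^ 2)) / (2 * (g * (PI / 2))) <= sinh X.
Proof.
  intros Hg HX Hp. pose proof PI_RGT_0 as Hpi. unfold x_gamma in HX.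
  destruct (Rlt_dec (g / 2) (/ (2 * PI))) as [L|L].
  - replace (2 * PI * (g / 2)) with (2 * (g * (PI / 2))) in HX by field.
    apply sinh_mono in HX. rewrite sinh_arcsinh in HX. exact HX.
  - exfalso. apply L. apply Rmult_lt_reg_r with (2 * PI); [lra|]. rewrite Rinv_l by lra. lra.
Qed.

Lemma de_bound_dens (A b x : R) : 0 < b -> de_bound A b x = A / b * de_dens (b * (PI / 2)) x.
Proof. intros Hb. unfold de_bound, de_dens. field. lra. Qed.

(** The exponent p exp X / (2 X) = (pi c / 4) exp X / X is at least (pi mu / 4) t / ln t, which for
    t = 8 d n / mu is the discretization exponent 2 pi d n / ln t. Dividing by [ln t] rather than by
    ln (t mu / c) makes the bound the same on both sides. *)
Lemma truncation_side (g : nat -> C) (K c mu nu t h X : R) (L : nat) :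
  0 < K -> 0 < mu -> mu <= c -> c <= nu -> 0 < t -> 0 <= h ->
  1 <= ln (t * mu / c) -> ln (t * mu / c) <= X -> x_gamma (c / 2) <= X ->
  (forall i, (i < L)%nat -> Cmod (g i) <= de_bound (K * Rpower 2 c) c (X + (INR i + 1) * h)) ->
  h * Cmod (csum g L) <= Rpower 2 nu * K / mu * exp (PI * nu / 4) * exp (- (PI * mu * t / (4 * ln t))).
Proof.
  intros HK Hmu Hc Hnu Ht Hh H1 HX Hthr Hg. pose proof PI_RGT_0 as Hpi.
  assert (Hp : 0 < c * (PI / 2)) by (apply Rmult_lt_0_compat; lra).
  assert (H2c : 0 < Rpower 2 c) by apply exp_pos.
  assert (HA : 0 <= K * Rpower 2 c / c) by (apply Rmult_le_pos; [apply Rmult_le_pos; lra|left; apply Rinv_0_lt_compat; lra]).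
  pose proof (de_tail_sum (c * (PI / 2)) X Hp ltac:(lra)
    (x_gamma_threshold c X ltac:(lra) Hthr) g (K * Rpower 2 c / c) h L HA Hh) as H.
  assert (HT0 : 0 < t * mu / c) by (apply Rdiv_lt_0_compat; [apply Rmult_lt_0_compat; lra|lra]).
  assert (HTt : t * mu / c <= t).
  { apply Rmult_le_reg_r with c; [lra|]. unfold Rdiv. rewrite Rmult_assoc, Rinv_l, Rmult_1_r by lra.
    apply Rmult_le_compat_l; lra. }
  assert (Hlt : ln (t * mu / c) <= ln t) by (apply ln_le; assumption).
  pose proof (exp_div_id_mono _ _ H1 HX) as HM. rewrite exp_ln in HM by assumption.
  assert (HM2 : t * mu / c / ln t <= exp X / X).
  { eapply Rle_trans; [|exact HM]. apply Rmult_le_compat_l; [lra|]. apply Rinv_le_contravar; lra. }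
  eapply Rle_trans; [apply H|].
  { intros i Hi. rewrite <- de_bound_dens by lra. apply Hg, Hi. }
  replace (Rpower 2 nu * K / mu * exp (PI * nu / 4) * exp (- (PI * mu * t / (4 * ln t))))
    with (Rpower 2 nu * K / mu * (exp (PI * nu / 4) * exp (- (PI * mu * t / (4 * ln t))))) by ring.
  apply Rmult_le_compat; [exact HA| | |].
  - left. apply Rmult_lt_0_compat; apply exp_pos.
  - apply Rmult_le_compat.
    + apply Rmult_le_pos; lra.
    + left. apply Rinv_0_lt_compat. lra.
    + rewrite Rmult_comm. apply Rmult_le_compat_r; [lra|]. apply Rle_Rpower; lra.
    + apply Rinv_le_contravar; lra.
  - apply Rmult_le_compat; try (left; apply exp_pos).
    + apply exp_le_mono. replace (c * (PI / 2) / 2) with (PI * c / 4) by field.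
      apply Rmult_le_compat_r; [lra|]. apply Rmult_le_compat_l; lra.
    + apply exp_le_mono, Ropp_le_contravar.
      replace (PI * mu * t / (4 * ln t)) with (PI * c / 4 * (t * mu / c / ln t)) by (field; lra).
      replace (c * (PI / 2) * exp X / (2 * X)) with (PI * c / 4 * (exp X / X)) by (field; lra).
      apply Rmult_le_compat_l; [|exact HM2]. apply Rmult_le_pos; [apply Rmult_le_pos; lra|lra].
Qed.

(** The explicit inverse of [psiR] carries endpoints in t to endpoints in x, so an estimate for all
    large intervals [- a, b] becomes a limit along the product filter. *)
Lemma is_RInt_gen_psi (f : C -> C) (I : C) :
  (forall x, Ccont f (RtoC x)) ->
  (forall eps, 0 < eps -> exists X, forall a b, X <= a -> X <= b ->
     Cmod (Hint (fun w => f (psi w) * dpsi w)%C 0 (- a) b - I) < eps) ->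
  is_RInt_gen (V := C_R_NormedModule) (fun t : R => f (RtoC t)) (Rbar_locally m_infty) (Rbar_locally p_infty) I.
Proof.
  intros Hf HI. unfold is_RInt_gen. apply filterlimi_locally. intros eps.
  destruct (HI eps (cond_pos eps)) as [X0 HX].
  (* Nonnegativity ensures - xa <= xb, as the substitution requires. *)
  set (X := Rmax X0 0).
  assert (X0 <= X) by apply Rmax_l. assert (0 <= X) by apply Rmax_r.
  apply (Filter_prod _ _ _ (fun a => a < - psiR X) (fun b => psiR X < b)).
  - exists (- psiR X). intros a Ha. exact Ha.
  - exists (psiR X). intros b Hb. exact Hb.
  - intros a b Ha Hb. cbn [fst snd].
    set (xa := arcsinh (2 / PI * arcsinh (- a))). set (xb := arcsinh (2 / PI * arcsinh b)).
    assert (HXa : X <= xa) by (apply psiR_inv_ge; lra).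
    assert (HXb : X <= xb) by (apply psiR_inv_ge; lra).
    exists (Hint (fun w => f (psi w) * dpsi w)%C 0 (- xa) xb). split.
    + pose proof (is_RInt_psi f (- xa) xb ltac:(lra) Hf) as R.
      rewrite psiR_opp in R.
      replace (psiR xa) with (- a) in R by (symmetry; apply psiR_surj).
      replace (psiR xb) with b in R by (symmetry; apply psiR_surj).
      rewrite Ropp_involutive in R. exact R.
    + apply C_NormedModule_mixin_compat1. apply HX; lra.
Qed.

Lemma Rpower_base_le_1 (k g nu : R) : 0 < k -> k <= 1 -> g <= nu -> Rpower k nu <= Rpower k g.
Proof.
  intros Hk Hk1 Hg. apply exp_le_mono.
  assert (ln k <= 0) by (rewrite <- ln_1; apply ln_le; assumption). nra.
Qed.

(** Replacing c by mu in the denominator and by nu in the powers increases the constant; for the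
    power of k this rests on k <= 1. Both half lines thereby get one constant. *)
Lemma discretization_constant_le (K k co c mu nu : R) : 0 < K -> 0 < k -> k <= 1 -> 0 < co ->
  0 < mu -> mu <= c -> c <= nu ->
  K * (Rpower 2 c / Rpower k c) / (c * co) <= Rpower 2 nu * K / mu / (Rpower k nu * co).
Proof.
  intros HK Hk Hk1 Hco Hmu Hc Hnu.
  assert (Hp : forall u v, 0 < Rpower u v) by (intros; apply exp_pos).
  pose proof (Hp 2 c). pose proof (Hp k c). pose proof (Hp 2 nu). pose proof (Hp k nu).
  replace (K * (Rpower 2 c / Rpower k c) / (c * co)) with (K / co * (Rpower 2 c * / Rpower k c * / c)) by (field; lra).
  replace (Rpower 2 nu * K / mu / (Rpower k nu * co)) with (K / co * (Rpower 2 nu * / Rpower k nu * / mu)) by (field; lra).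
  apply Rmult_le_compat_l; [left; apply Rdiv_lt_0_compat; lra|].
  apply Rmult_le_compat.
  - left. apply Rmult_lt_0_compat; [lra|apply Rinv_0_lt_compat; lra].
  - left. apply Rinv_0_lt_compat. lra.
  - apply Rmult_le_compat; [lra|left; apply Rinv_0_lt_compat; lra|apply Rle_Rpower; lra|].
    apply Rinv_le_contravar; [lra|apply Rpower_base_le_1; assumption].
  - apply Rinv_le_contravar; lra.
Qed.

(** [M] and [N] enter through lower bounds on M h and N h, so alpha and beta play symmetric roles
    and the case distinction is left to the theorem. In the constant, the summand with cosines comes
    from the edges of the strip and exp (pi nu / 4) from the tails, which lie on the real line. *)
Lemma de_quadrature_error (d K alpha beta mu nu : R) (f : C -> C) (n : nat) (M N : Z) :
  0 < d -> d < PI / 2 ->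
  analytic_on (psi_image (strip d)) f ->
  0 < K -> 0 < mu -> mu <= alpha <= nu -> mu <= beta <= nu ->
  (forall z, psi_image (strip_minus d) z ->
     Cmod (f z) <= K * Rpower (Cmod (1 + z * z)%C) (- (alpha + 1) / 2)) ->
  (forall z, psi_image (strip_plus d) z ->
     Cmod (f z) <= K * Rpower (Cmod (1 + z * z)%C) (- (beta + 1) / 2)) ->
  (0 < n)%nat -> (0 <= M)%Z -> (0 <= N)%Z ->
  let t := 8 * d * INR n / mu in
  let h := ln t / INR n in
  1 <= ln (t * mu / alpha) -> 1 <= ln (t * mu / beta) ->
  ln (t * mu / alpha) <= IZR M * h -> ln (t * mu / beta) <= IZR N * h ->
  x_gamma (alpha / 2) <= IZR M * h -> x_gamma (beta / 2) <= IZR N * h ->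
  exists I : C,
    is_RInt_gen (V := C_R_NormedModule) (fun t : R => f (RtoC t)) (Rbar_locally m_infty) (Rbar_locally p_infty) I /\
    Cmod (I - RtoC h * zsum (- M) N
              (fun k => f (RtoC (psiR (IZR k * h))) * RtoC (Derive psiR (IZR k * h))))%C
    <= Rpower 2 (nu + 1) * K / mu *
      (2 / ((1 - exp (- PI * mu * exp 1 / 4)) * Rpower (cos (PI / 2 * sin d)) nu * cos d)
       + exp (PI * nu / 4)) * exp (- 2 * PI * d * INR n / ln t).
Proof.
  intros Hd Hd2 Han HK Hmu Ha Hb Hfm Hfp Hn HM HN t h Hta Htb HtM HtN HxM HxN.
  pose proof PI_RGT_0 as Hpi. apply lt_0_INR in Hn. fold (INR n) in Hn.
  assert (Ht : 0 < t) by (apply Rdiv_lt_0_compat; [apply Rmult_lt_0_compat; lra|lra]).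
  assert (HL : 1 <= ln t).
  { eapply Rle_trans; [exact Hta|]. apply ln_le.
    - apply Rdiv_lt_0_compat; [apply Rmult_lt_0_compat|]; lra.
    - apply Rmult_le_reg_r with alpha; [lra|]. unfold Rdiv. rewrite Rmult_assoc, Rinv_l, Rmult_1_r by lra.
      apply Rmult_le_compat_l; lra. }
  assert (Hh : 0 < h) by (apply Rdiv_lt_0_compat; lra).
  set (F := fun w => (f (psi w) * dpsi w)%C).
  set (k := cos (PI / 2 * sin d)).
  assert (Hk : 0 < k) by (apply cos_sin_pos; lra).
  assert (Hk1 : k <= 1) by apply COS_bound.
  assert (Hco : 0 < cos d) by (apply cos_gt_0; lra).
  set (A := fun c => K * (Rpower 2 c / Rpower k c)).
  assert (HA : forall c, 0 <= A c).
  { intros c. apply Rmult_le_pos; [lra|]. left. apply Rdiv_lt_0_compat; apply exp_pos. }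
  assert (HF : forall x y, Rabs y < d -> exists l, Cderiv F (x, y) l).
  { intros x y Hy. destruct (ex_derive_Cderiv f (psi (x, y))) as [l1 H1].
    - apply Han. exists (x, y). split; [exact Hy|reflexivity].
    - destruct (Cderiv_dpsi (x, y)) as [l2 H2]. eexists.
      apply Cderiv_mult; [exact (Cderiv_comp f psi (x, y) _ _ H1 (Cderiv_psi _))|exact H2]. }
  assert (HR : forall D x y, 0 <= D -> D <= d -> Rabs y <= D -> Rabs y < d -> 0 <= x ->
    Cmod (F (x, y)) <= de_bound (K * (Rpower 2 beta / Rpower (cos (PI / 2 * sin D)) beta)) (beta * cos D) x).
  { intros D x y HD0 HDd HyD Hy Hx. pose proof (de_estimate f K beta D x y HK ltac:(lra) ltac:(lra) HyD) as H.
    rewrite (Rabs_right x) in H by lra. apply H, Hfp. exists (x, y). split; [split; assumption|reflexivity]. }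
  assert (HLf : forall D x y, 0 <= D -> D <= d -> Rabs y <= D -> Rabs y < d -> x < 0 ->
    Cmod (F (x, y)) <= de_bound (K * (Rpower 2 alpha / Rpower (cos (PI / 2 * sin D)) alpha)) (alpha * cos D) (- x)).
  { intros D x y HD0 HDd HyD Hy Hx. pose proof (de_estimate f K alpha D x y HK ltac:(lra) ltac:(lra) HyD) as H.
    rewrite (Rabs_left x) in H by lra. apply H, Hfm. exists (x, y). split; [split; assumption|reflexivity]. }
  assert (Hreal : forall c, K * (Rpower 2 c / Rpower (cos (PI / 2 * sin 0)) c) = K * Rpower 2 c).
  { intros c. rewrite sin_0, Rmult_0_r, cos_0. unfold Rpower at 2. rewrite ln_1, Rmult_0_r, exp_0. field. }
  assert (HR0 : forall x, 0 <= x -> Cmod (F (RtoC x)) <= de_bound (K * Rpower 2 beta) beta x).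
  { intros x Hx. pose proof (HR 0 x 0) as H. rewrite Rabs_R0, Hreal, cos_0, Rmult_1_r in H. apply H; lra. }
  assert (HL0 : forall x, 0 < x -> Cmod (F (RtoC (- x))) <= de_bound (K * Rpower 2 alpha) alpha x).
  { intros x Hx. pose proof (HLf 0 (- x) 0) as H. rewrite Rabs_R0, Hreal, cos_0, Rmult_1_r, Ropp_involutive in H. apply H; lra. }
  destruct (trapezoid_integral F d (A alpha) (alpha * cos d) (A beta) (beta * cos d)) as [I HI]; trivial;
    try (apply Rmult_lt_0_compat; lra).
  { intros x y Hy Hx. apply (HR d); lra. }
  { intros x y Hy Hx. apply (HLf d); lra. }
  pose proof (trapezoid F d h (A alpha) (alpha * cos d) (A beta) (beta * cos d) Hd Hh (HA _) (HA _)
    ltac:(apply Rmult_lt_0_compat; lra) ltac:(apply Rmult_lt_0_compat; lra) HF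
    ltac:(intros x y Hy Hx; apply (HR d); lra) ltac:(intros x y Hy Hx; apply (HLf d); lra) I HI) as HT.
  cbv zeta in HT.
  exists I. split.
  { apply is_RInt_gen_psi.
    - intros x. rewrite <- (psiR_surj x), <- psi_real.
      destruct (ex_derive_Cderiv f (psi (RtoC (arcsinh (2 / PI * arcsinh x))))) as [l Hl].
      + apply Han. eexists. split; [|reflexivity]. unfold strip, RtoC, Im; cbn [snd]. rewrite Rabs_R0. exact Hd.
      + exact (Cderiv_cont _ _ _ Hl).
    - intros eps He.
      match type of HI with context [Rle _ (?w / _)] => set (W := w) in HI end.
      assert (HW : 0 <= W).
      { specialize (HI 1%nat (le_n _) 1 1 (Req_le _ _ eq_refl) (Req_le _ _ eq_refl)).
        pose proof (Cmod_ge_0 (Hint F 0 (- (1)) 1 - I)). simpl INR in HI. lra. }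
      destruct (archimed_cor1 (eps / (W + 1))) as (m & Hm & Hm0); [apply Rdiv_lt_0_compat; lra|].
      exists (INR m). intros a b Ha' Hb'. eapply Rle_lt_trans; [apply (HI m Hm0 a b Ha' Hb')|].
      assert (0 < / INR m) by (apply Rinv_0_lt_compat, lt_0_INR, Hm0).
      apply Rle_lt_trans with ((W + 1) * / INR m); [unfold Rdiv; nra|].
      replace eps with ((W + 1) * (eps / (W + 1))) by (field; lra). apply Rmult_lt_compat_l; lra. }
  (* Removes the slack of [trapezoid]; for each [eps], m is taken beyond M and N so that the node
     sum splits. *)
  apply Rle_plus_epsilon. intros eps He.
  destruct (HT eps He) as [m0 Hm0]. clear HT.
  set (m := (m0 + Z.to_nat M + Z.to_nat N)%nat). specialize (Hm0 m ltac:(unfold m; lia)).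
  pose proof (nodes_split F h M N m HM HN ltac:(unfold m; lia) ltac:(unfold m; lia)) as HS. cbv zeta in HS.
  assert (EZ : zsum (- M) N (fun k => (f (RtoC (psiR (IZR k * h))) * RtoC (Derive psiR (IZR k * h)))%C)
     = zsum (- M) N (fun k => F (RtoC (IZR k * h)))).
  { rewrite !zsum_csum. apply csum_ext. intros i _. unfold F. rewrite psi_real, dpsi_real.
    rewrite (is_derive_unique _ _ _ (is_derive_psiR _)). reflexivity. }
  rewrite EZ. set (Z0 := zsum (- M) N (fun k => F (RtoC (IZR k * h)))) in *.
  set (SL := csum (fun j => F (RtoC (IZR (- (M + 1 + Z.of_nat j)) * h))) (m - Z.to_nat M)) in *.
  set (SR := csum (fun j => F (RtoC (IZR (N + 1 + Z.of_nat j) * h))) (m - Z.to_nat N)) in *.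
  assert (BR : h * Cmod SR <= Rpower 2 nu * K / mu * exp (PI * nu / 4) * exp (- (PI * mu * t / (4 * ln t)))).
  { apply (truncation_side _ K beta mu nu t h (IZR N * h)); try lra.
    intros i _. replace (IZR (N + 1 + Z.of_nat i) * h) with (IZR N * h + (INR i + 1) * h)
      by (rewrite !plus_IZR, <- INR_IZR_INZ; ring).
    apply HR0. apply IZR_le in HN. pose proof (pos_INR i).
    apply Rplus_le_le_0_compat; apply Rmult_le_pos; lra. }
  assert (BL : h * Cmod SL <= Rpower 2 nu * K / mu * exp (PI * nu / 4) * exp (- (PI * mu * t / (4 * ln t)))).
  { apply (truncation_side _ K alpha mu nu t h (IZR M * h)); try lra.
    intros i _. replace (IZR (- (M + 1 + Z.of_nat i)) * h) with (- (IZR M * h + (INR i + 1) * h))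
      by (rewrite opp_IZR, !plus_IZR, <- INR_IZR_INZ; ring).
    set (x := IZR M * h + (INR i + 1) * h).
    assert (Hx : 0 < x).
    { unfold x. apply IZR_le in HM. pose proof (pos_INR i).
      assert (0 <= IZR M * h) by (apply Rmult_le_pos; lra).
      assert (0 < (INR i + 1) * h) by (apply Rmult_lt_0_compat; lra). lra. }
    apply HL0, Hx. }
  assert (Eq : exp (- (2 * PI / h * d)) = exp (- 2 * PI * d * INR n / ln t)) by (f_equal; unfold h; field; lra).
  assert (Emt : mu * t = 8 * d * INR n) by (unfold t; field; lra).
  assert (Et : exp (- (PI * mu * t / (4 * ln t))) = exp (- 2 * PI * d * INR n / ln t)).
  { f_equal. replace (PI * mu * t) with (PI * (8 * d * INR n)) by (rewrite <- Emt; ring). field. lra. }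
  rewrite Et in BL, BR. rewrite Eq in Hm0.
  set (q := exp (- 2 * PI * d * INR n / ln t)) in *.
  assert (Hq0 : 0 < q) by apply exp_pos.
  (* q = exp (- (pi mu / 4) t / ln t) and t / ln t >= e, because exp x / x is least at 1; this is
     the source of the factor with exp 1 in [C1]. *)
  assert (Hq : q <= exp (- PI * mu * exp 1 / 4)).
  { apply exp_le_mono.
    assert (G : exp 1 <= t / ln t).
    { rewrite <- (exp_ln t) at 1 by assumption. rewrite <- (Rdiv_1_r (exp 1)). apply exp_div_id_mono; lra. }
    replace (- 2 * PI * d * INR n / ln t) with (- (PI * mu / 4 * (t / ln t)))
      by (replace (PI * mu / 4 * (t / ln t)) with (PI * (mu * t) / 4 / ln t) by (field; lra); rewrite Emt; field; lra).
    replace (- PI * mu * exp 1 / 4) with (- (PI * mu / 4 * exp 1)) by field.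
    apply Ropp_le_contravar, Rmult_le_compat_l; [|exact G]. assert (0 < PI * mu) by (apply Rmult_lt_0_compat; lra). lra. }
  set (q0 := exp (- PI * mu * exp 1 / 4)) in *.
  assert (Hq01 : q0 < 1).
  { apply Rlt_le_trans with (exp 0); [apply exp_increasing|rewrite exp_0; lra].
    assert (0 < PI * mu * exp 1) by (apply Rmult_lt_0_compat; [apply Rmult_lt_0_compat; lra|apply exp_pos]). lra. }
  set (T1 := Rpower 2 nu * K / mu) in *.
  assert (HT1 : 0 < T1) by (apply Rdiv_lt_0_compat; [apply Rmult_lt_0_compat; [apply exp_pos|lra]|lra]).
  set (kc := Rpower k nu * cos d).
  assert (Hkc : 0 < kc) by (apply Rmult_lt_0_compat; [apply exp_pos|lra]).
  assert (Dl : A alpha / (alpha * cos d) <= T1 / kc) by (apply discretization_constant_le; lra).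
  assert (Dr : A beta / (beta * cos d) <= T1 / kc) by (apply discretization_constant_le; lra).
  assert (HDl : 0 <= A alpha / (alpha * cos d) + A beta / (beta * cos d)).
  { apply Rplus_le_le_0_compat; (apply Rmult_le_pos; [apply HA|left; apply Rinv_0_lt_compat, Rmult_lt_0_compat; lra]). }
  (* Two edges and two half lines give four terms T1 / kc, written as 2 T1 times 2 / kc to match
     [C1]. *)
  assert (Hdisc : q / (1 - q) * (2 * (A alpha / (alpha * cos d) + A beta / (beta * cos d))) <= 2 * T1 * (2 / ((1 - q0) * kc)) * q).
  { replace (2 * T1 * (2 / ((1 - q0) * kc)) * q) with (q * / (1 - q0) * (2 * (T1 / kc + T1 / kc))) by (field; lra).
    apply Rmult_le_compat; try lra.
    - left. apply Rdiv_lt_0_compat; lra.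
    - apply Rmult_le_compat_l; [lra|]. apply Rinv_le_contravar; lra. }
  assert (E2 : Rpower 2 (nu + 1) * K / mu = 2 * T1).
  { unfold T1. rewrite Rpower_plus, Rpower_1 by lra. field. lra. }
  rewrite E2.
  replace (I - RtoC h * Z0)%C with ((I - RtoC h * nodes F h m) + (RtoC h * SL + RtoC h * SR))%C by (rewrite HS; ring).
  eapply Rle_trans; [apply Cmod_triangle|].
  eapply Rle_trans; [apply Rplus_le_compat_l, Cmod_triangle|].
  rewrite !Cmod_mult, Cmod_R, (Rabs_right h) by lra.
  replace ((1 - q0) * Rpower k nu * cos d) with ((1 - q0) * kc) by (unfold kc; ring).
  lra.
Qed.

Theorem theorem7 (d K alpha beta : R) (f : C -> C) (n : nat) :
  0 < d -> d < PI / 2 ->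
  analytic_on (psi_image (strip d)) f ->
  0 < K -> 0 < alpha -> 0 < beta ->
  (forall z, psi_image (strip_minus d) z ->
     Cmod (f z) <= K * Rpower (Cmod (1 + z * z)%C) (- (alpha + 1) / 2)) ->
  (forall z, psi_image (strip_plus d) z ->
     Cmod (f z) <= K * Rpower (Cmod (1 + z * z)%C) (- (beta + 1) / 2)) ->
  let mu := Rmin alpha beta in
  let nu := Rmax alpha beta in
  (0 < n)%nat ->
  let h := ln (8 * d * INR n / mu) / INR n in
  let M : Z := if Rle_dec alpha beta then Z.of_nat n
               else (Z.of_nat n - floorZ (ln (alpha / beta) / h))%Z in
  let N : Z := if Rle_dec alpha beta then (Z.of_nat n - floorZ (ln (beta / alpha) / h))%Z
               else Z.of_nat n in
  INR n >= nu * exp 1 / (8 * d) ->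
  IZR M * h >= x_gamma (alpha / 2) ->
  IZR N * h >= x_gamma (beta / 2) ->
  let C1 := Rpower 2 (nu + 1) * K / mu *
      (2 / ((1 - exp (- PI * mu * exp 1 / 4)) * Rpower (cos (PI / 2 * sin d)) nu * cos d)
       + exp (PI * nu / 4)) in
  exists I : C,
    is_RInt_gen (fun t : R => f (RtoC t)) (Rbar_locally m_infty) (Rbar_locally p_infty) I /\
    Cmod (I - RtoC h * zsum (- M) N
              (fun k => f (RtoC (psiR (IZR k * h))) * RtoC (Derive psiR (IZR k * h))))%C
    <= C1 * exp (- 2 * PI * d * INR n / ln (8 * d * INR n / mu)).
Proof.
  intros Hd Hd2 Han HK Ha Hb Hfm Hfp mu nu Hn h M N Hnu HxM HxN C1.
  pose proof (lt_0_INR n Hn) as Hn'.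
  assert (Hmu : 0 < mu) by (apply Rmin_glb_lt; assumption).
  assert (Ham : mu <= alpha <= nu) by (split; [apply Rmin_l|apply Rmax_l]).
  assert (Hbm : mu <= beta <= nu) by (split; [apply Rmin_r|apply Rmax_r]).
  set (t := 8 * d * INR n / mu) in *.
  assert (Ht : 0 < t) by (apply Rdiv_lt_0_compat; [apply Rmult_lt_0_compat; lra|lra]).
  (* The lower bound on n says that 8 d n / c >= e for every c up to nu. *)
  assert (Hln : forall c, mu <= c <= nu -> 1 <= ln (t * mu / c)).
  { intros c Hc. rewrite <- (ln_exp 1). apply ln_le; [apply exp_pos|].
    replace (t * mu / c) with (8 * d * INR n / c) by (unfold t; field; lra).
    apply Rmult_le_reg_r with (c / (8 * d)); [apply Rdiv_lt_0_compat; lra|].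
    replace (8 * d * INR n / c * (c / (8 * d))) with (INR n) by (field; lra).
    eapply Rle_trans; [|apply Rge_le, Hnu].
    replace (exp 1 * (c / (8 * d))) with (c * exp 1 / (8 * d)) by (field; lra).
    apply Rmult_le_compat_r; [left; apply Rinv_0_lt_compat; lra|].
    apply Rmult_le_compat_r; [left; apply exp_pos|lra]. }
  assert (Hratio : forall c, mu <= c <= nu -> ln (t * mu / c) = ln t - ln (c / mu)).
  { intros c Hc. replace (t * mu / c) with (t / (c / mu)) by (field; lra).
    apply ln_div; [exact Ht|apply Rdiv_lt_0_compat; lra]. }
  assert (Hlnmu : ln (t * mu / mu) = ln t) by (f_equal; field; lra).
  pose proof (Hln mu ltac:(lra)) as HLt. rewrite Hlnmu in HLt.
  assert (Hh : 0 < h) by (apply Rdiv_lt_0_compat; lra).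
  assert (Hnh : INR n * h = ln t) by (unfold h; field; lra).
  assert (Hfull : ln (t * mu / mu) <= IZR (Z.of_nat n) * h).
  { rewrite Hlnmu, <- INR_IZR_INZ, Hnh. lra. }
  (* Subtracting a floor removes at most ln (c / mu) from n h = ln t, so the shortened side still
     reaches ln (8 d n / c). *)
  assert (Hpart : forall c, mu <= c <= nu ->
     ln (t * mu / c) <= IZR (Z.of_nat n - floorZ (ln (c / mu) / h)) * h).
  { intros c Hc. rewrite (Hratio c Hc), minus_IZR, <- INR_IZR_INZ, Rmult_minus_distr_r, Hnh.
    destruct (base_Int_part (ln (c / mu) / h)) as [Hfl _]. fold (floorZ (ln (c / mu) / h)) in Hfl.
    apply Rmult_le_compat_r with (r := h) in Hfl; [|lra].
    replace (ln (c / mu) / h * h) with (ln (c / mu)) in Hfl by (field; lra). lra. }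
  (* The definitions of [M] and [N] subtract a floor from n and leave the sign open; the bounds M h
     >= 1 and N h >= 1 settle it. *)
  assert (Hpos : forall k : Z, 1 <= IZR k * h -> (0 <= k)%Z).
  { intros k Hk. apply le_IZR. apply Rmult_le_reg_r with h; lra. }
  assert (HtM : ln (t * mu / alpha) <= IZR M * h).
  { unfold M. destruct (Rle_dec alpha beta) as [L|L].
    - replace alpha with mu by (apply Rmin_left, L). exact Hfull.
    - replace beta with mu by (apply Rmin_right; lra). apply Hpart, Ham. }
  assert (HtN : ln (t * mu / beta) <= IZR N * h).
  { unfold N. destruct (Rle_dec alpha beta) as [L|L].
    - replace alpha with mu by (apply Rmin_left, L). apply Hpart, Hbm.
    - replace beta with mu by (apply Rmin_right; lra). exact Hfull. }
  pose proof (Hln alpha Ham) as Hla. pose proof (Hln beta Hbm) as Hlb.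
  exact (de_quadrature_error d K alpha beta mu nu f n M N Hd Hd2 Han HK Hmu Ham Hbm Hfm Hfp Hn
    (Hpos M (Rle_trans _ _ _ Hla HtM)) (Hpos N (Rle_trans _ _ _ Hlb HtN))
    Hla Hlb HtM HtN (Rge_le _ _ HxM) (Rge_le _ _ HxN)).
Qed.
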